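(* Let $K$ be a non-compact hypergroup with a left Haar measure $\mu$, and let $\Omega$ be a Banach ideal space on $K$ satisfying (I)–(VI) of the context. Assume that for every compact neighborhood $U$ of the identity element $e$ of $K$ there exist some $\omega\in(1,\infty)$ and a strictly increasing sequence $\{n_k\}_{k\in\mathbb{N}}\subset\mathbb{N}$ such that, writing $U^{n}:=U\ast\cdots\ast U$ ($n$ times), $$\mu(U^{2n_k})<\omega\,\mu(U^{n_k})\quad\text{for all }k\in\mathbb{N},$$ and there exists some $k_0\in\mathbb{N}$ such that, for any $x\in U^{n_{k_0}}$, $$\delta_{x}\ast\delta_{x^-}=\delta_e=\delta_{x^-}\ast\delta_{x}.$$ Let $\varphi_1,\varphi_2,\varphi_3$ be Young functions with $\varphi_i(b_{\varphi_i})>0$ for $i=1,2,3$ and $$\liminf_{x\to0^+}\frac{\varphi_1^{-1}(x)\varphi_2^{-1}(x)}{x\,\varphi_3^{-1}(x)}=\infty.$$ Then the set $$\left\{(f,g)\in\Omega_{\varphi_1}(K)\times\Omega_{\varphi_2}(K):\ |f|\ast|g|\in\Omega_{\varphi_3}(K)\right\}$$ is of first category (in the sense of Baire) in $\Omega_{\varphi_1}(K)\times\Omega_{\varphi_2}(K)$.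
   Context: **Hypergroups.** Let $K$ be a locally compact Hausdorff space, $\mathcal{M}(K)$ the space of complex-valued Radon measures on $K$, $\mathcal{M}^+(K)$ its non-negative elements, and $\delta_x$ the Dirac measure at $x$. $K$ is a (locally compact) hypergroup if there are a convolution $\ast:\mathcal{M}(K)\times\mathcal{M}(K)\to\mathcal{M}(K)$, an involution $x\mapsto x^-$ on $K$ and an element $e\in K$ (the identity) such that: (i) $(\mathcal{M}(K),+,\ast)$ is a complex Banach algebra; (ii) $\mu\ast\nu\in\mathcal{M}^+(K)$ for $\mu,\nu\in\mathcal{M}^+(K)$, and $(\mu,\nu)\mapsto\mu\ast\nu$ from $\mathcal{M}^+(K)\times\mathcal{M}^+(K)$ to $\mathcal{M}^+(K)$ is continuous for the cone topology, i.e. the weakest topology for which $\mu\mapsto\int_K f\,d\mu$ (each non-negative continuous compactly supported $f$) and $\mu\mapsto\mu(K)$ are continuous; (iii) $\delta_x\ast\delta_y$ is a probability measure with compact support for all $x,y\in K$; (iv) $\delta_e\ast\delta_x=\delta_x=\delta_x\ast\delta_e$; (v) $x\mapsto x^-$ is a homeomorphism, $(x^-)^-=x$, $(\delta_x\ast\delta_y)^-=\delta_{y^-}\ast\delta_{x^-}$, where $\mu^-(A):=\mu(\{x^-:x\in A\})$, and $e\in\operatorname{supp}(\delta_x\ast\delta_y)$ if and only if $x=y^-$; (vi) $(x,y)\mapsto\operatorname{supp}(\delta_x\ast\delta_y)$ is continuous from $K\times K$ into the space $\mathfrak{C}(K)$ of non-empty compact subsets of $K$ with the Michael topology, whose subbasis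 consists of the sets $\{H\in\mathfrak{C}(K): H\cap U\ne\emptyset,\ H\subset V\}$, $U,V\subset K$ open. A left Haar measure on $K$ is a nonzero non-negative Radon measure $\mu$ with $\delta_x\ast\mu=\mu$ for all $x\in K$. For $x,y\in K$, $U,V\subset K$: $\{x\}\ast\{y\}:=\operatorname{supp}(\delta_x\ast\delta_y)$ and $U\ast V:=\bigcup_{x\in U,\,y\in V}\{x\}\ast\{y\}$. $L^0(K)$ is the space of $\mu$-measurable complex-valued functions on $K$. For $f,g\in L^0(K)$, $$(f\ast g)(x):=\int_K f(y)\,g(y^-\ast x)\,d\mu(y),\qquad g(y^-\ast x):=\int_K g(t)\,d(\delta_{y^-}\ast\delta_x)(t).$$ **Young functions.** A Young function is a function $\varphi:\mathbb{R}\to[0,\infty]$ that is convex, even, left continuous on $(0,\infty)$, with $\varphi(0)=0$, and neither identically $0$ nor identically $\infty$ on $(0,\infty)$. Put $b_\varphi:=\sup\{x\in\mathbb{R}:\varphi(x)<\infty\}$ (if $b_\varphi=\infty$, $\varphi(b_\varphi)$ means $\lim_{x\to\infty}\varphi(x)=\infty$) and $\varphi^{-1}(y):=\sup\{x\in[0,\infty):\varphi(x)\le y\}$ for $y\in[0,\infty)$. **Banach ideal spaces.** A Banach space $(\Omega,\|\cdot\|_\Omega)$ is a Banach ideal space on $K$ if $\Omega$ is a linear subspace of $L^0(K)$ and whenever $f\in\Omega$, $g\in L^0(K)$, $|g|\le|f|$ a.e., then $g\in\Omega$ and $\|g\|_\Omega\le\|f\|_\Omega$. The conditions on $\Omega$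 are: (I) if $0\le f_n\in\Omega$, $f\in L^0(K)$ and $f_n\uparrow f$ a.e., then $\|f_n\|_\Omega\uparrow\|f\|_\Omega$ if $f\in\Omega$, and $\|f_n\|_\Omega\to\infty$ if $f\notin\Omega$; (II) $\mathbf{1}_E\in\Omega$ for every measurable $E\subset K$ with $\mu(E)<\infty$; (III) for every measurable $E$ with $\mu(E)<\infty$ there is a positive constant $C_E$ with $\int_E|f|\,d\mu\le C_E\|f\|_\Omega$ for all $f\in\Omega$; (IV) if non-negative $f,g\in\Omega$ are equimeasurable ($\mu(\{f>s\})=\mu(\{g>s\})$ for all $s\ge0$), then $\|f\|_\Omega=\|g\|_\Omega$; (V) $\lim_{s\to0}\Phi_\Omega(s)=0$; (VI) $\lim_{s\to\infty}\Phi_\Omega(s)=\infty$; where $\Phi_\Omega$ is the fundamental function, $\Phi_\Omega(\mu(E)):=\|\mathbf{1}_E\|_\Omega$ for measurable $E$ with $\mu(E)<\infty$ (well defined by (IV); limits are taken along attained values $s=\mu(E)$). **Calderón–Lozanovskiĭ spaces.** For a Young function $\varphi$ and $f\in L^0(K)$ let $I_\varphi(f):=\|\varphi(|f|)\|_\Omega$ if $\varphi(|f|)\in\Omega$ and $I_\varphi(f):=\infty$ otherwise. $\Omega_\varphi(K)$ is the set of $f\in L^0(K)$ with $I_\varphi(f/\lambda)<\infty$ for some $\lambda\in(0,\infty)$, with norm $\|f\|_{\Omega_\varphi(K)}:=\inf\{\lambda>0: I_\varphi(f/\lambda)\le1\}$. The product $\Omega_{\varphi_1}(K)\times\Omega_{\varphi_2}(K)$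 carries the norm $\max\{\|f\|_{\Omega_{\varphi_1}(K)},\|g\|_{\Omega_{\varphi_2}(K)}\}$. *)

(* Defs.v *)
From HB Require Import structures.
From mathcomp Require Import all_boot all_order all_algebra.
From mathcomp Require Import all_classical all_reals all_analysis.
From mathcomp Require Import complex.

Set Implicit Arguments.
Unset Strict Implicit.
Unset Printing Implicit Defensive.

Import Order.TTheory GRing.Theory Num.Theory.
Import numFieldNormedType.Exports.

Local Open Scope classical_set_scope.
Local Open Scope ring_scope.
Local Open Scope complex_scope.

Notation cabs := ComplexField.Normc.normc.

Definition nowhere_dense (T : topologicalType) (A : set T) : Prop :=
  interior (closure A) = set0.

Definition first_category (T : topologicalType) (A : set T) : Prop :=
  exists2 F : nat -> set T,
    forall n, nowhere_dense (F n) & A = \bigcup_n F n.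

(** [V], normed by [N], is a complex Banach space of functions, where the
    functions satisfying [null] are identified with 0. *)
Record banach_space (R : realType) (T : Type) (null : set (T -> R[i]))
    (V : set (T -> R[i])) (N : (T -> R[i]) -> R) : Prop := {
  bs_0 : V (fun=> 0) ;
  bs_add : forall f g, V f -> V g -> V (fun x => f x + g x) ;
  bs_scale : forall (a : R[i]) f, V f -> V (fun x => a * f x) ;
  bs_norm_ge0 : forall f, V f -> 0 <= N f ;
  bs_norm_eq0 : forall f, V f -> (N f = 0 <-> null f) ;
  bs_norm_add : forall f g, V f -> V g -> N (fun x => f x + g x) <= N f + N g ;
  bs_norm_scale : forall (a : R[i]) f, V f ->
    N (fun x => a * f x) = cabs a * N f ;
  bs_complete : forall u : nat -> T -> R[i], (forall n, V (u n)) ->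
    (forall eps : R, 0 < eps -> exists n0 : nat, forall m n : nat,
       (n0 <= m)%N -> (n0 <= n)%N -> N (fun x => u m x - u n x) < eps) ->
    exists2 f, V f & (fun n => N (fun x => u n x - f x)) @ \oo --> (0 : R)
}.

(** The subset [V] of [E] with the topology whose open sets are the unions of
    [d]-balls, for [d] the distance given by a (semi)norm on representatives.
    As closed sets are unions of classes of points at distance 0, being of
    first category means the same here and in the quotient by these classes. *)
Definition metric_subspace (R : realType) (E : Type) (V : set E)
  (d : E -> E -> R) : Type := {x : E | V x}.

Section MetricSubspace.
Context (R : realType) (E : Type) (V : set E) (d : E -> E -> R).
Local Notation S := (metric_subspace V d).

Definition metric_open (U : set S) : Prop := forall x : S, U x ->
  exists2 r : R, 0 < r & forall y : S, d (sval x) (sval y) < r -> U y.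

Lemma metric_openT : metric_open setT.
Proof. by move=> x _; exists 1. Qed.

Lemma metric_openI (A B : set S) :
  metric_open A -> metric_open B -> metric_open (A `&` B).
Proof.
move=> oA oB x [/oA[r r0 rA] /oB[s s0 sB]].
exists (Num.min r s); first by rewrite lt_min r0 s0.
by move=> y; rewrite lt_min => /andP[/rA Ay /sB By].
Qed.

Lemma metric_open_bigU (I : Type) (f : I -> set S) :
  (forall i, metric_open (f i)) -> metric_open (\bigcup_i f i).
Proof.
move=> of_ x [i _ fx]; have [r r0 rf] := of_ i x fx.
by exists r => // y /rf fy; exists i.
Qed.

HB.instance Definition _ := gen_eqMixin S.
HB.instance Definition _ := gen_choiceMixin S.
HB.instance Definition _ :=
  isOpenTopological.Build S metric_openT metric_openI metric_open_bigU.
End MetricSubspace.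

Notation borel K := (g_sigma_algebraType (@open K)).

(** Radon measures are taken in the form given by the Riesz representation
    theorem; they may be infinite on non-compact sets. *)
Definition is_radon (R : realType) (K : ptopologicalType)
    (mu : {measure set (borel K) -> \bar R}) : Prop :=
  [/\ forall C : set K, compact C -> (mu C < +oo)%E,
      forall A : set (borel K), measurable A ->
        mu A = ereal_inf [set mu U | U in [set U : set K | open U /\ A `<=` U]]
    & forall U : set K, open U ->
        mu U =
        ereal_sup [set mu C | C in [set C : set K | compact C /\ C `<=` U]]].

Section ComplexMeasures.
Context (R : realType) (K : ptopologicalType).
Implicit Types nu : set K -> R[i].

Definition total_variation nu (A : set K) : \bar R :=
  ereal_sup [set (\sum_(0 <= n <oo) (cabs (nu (F n)))%:E)%E
            | F in [set F : nat -> set K |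
                [/\ forall n, measurable (F n : set (borel K)),
                    trivIset setT F & \bigcup_n F n = A]]].

(** M(K). A complex measure is a function on all subsets which is 0 outside of
    the Borel sigma-algebra, so that equal measures are equal functions. *)
Definition complex_radon : set (set K -> R[i]) := [set nu |
  [/\ forall A : set (borel K), ~ measurable A -> nu A = 0,
      forall F : nat -> set (borel K), (forall n, measurable (F n)) ->
        trivIset setT F ->
        (fun n => \sum_(i < n) nu (F i)) @ \oo --> (nu (\bigcup_n F n) : R[i]^o),
      (total_variation nu setT < +oo)%E
    & forall A : set (borel K), measurable A ->
        total_variation nu A =
        ereal_sup [set total_variation nu C
                  | C in [set C : set K | compact C /\ C `<=` A]]]].

Definition variation_norm nu : R := fine (total_variation nu setT).

(** M^+(K) *)
Definition positive_radon : set (set K -> R[i]) :=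
  [set nu | complex_radon nu /\ forall A, 0 <= nu A].

(** A positive [nu] as a set function to integrate against. *)
Definition emeas nu : set (borel K) -> \bar R := fun A => (complex.Re (nu A))%:E.

Definition mdirac (x : K) : set K -> R[i] :=
  fun A => if `[< measurable (A : set (borel K)) >] then \1_A x else 0.

Definition msupp nu : set K :=
  [set x | forall U : set K, open U -> U x -> (0 < total_variation nu U)%E].

Definition Cc_plus : set (K -> R) :=
  [set f : K -> R | [/\ continuous f, forall x, 0 <= f x
             & compact (closure [set x | f x != 0])]].

End ComplexMeasures.

Arguments complex_radon : clear implicits.
Arguments positive_radon : clear implicits.
Arguments mdirac R {K} x.
Arguments Cc_plus : clear implicits.

(** M^+(K) with the cone topology. *)
Definition cone_space (R : realType) (K : ptopologicalType) : Type :=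
  {nu : set K -> R[i] | positive_radon R K nu}.

Section ConeTopology.
Context (R : realType) (K : ptopologicalType).

Definition cone_subbase : set (set (cone_space R K)) :=
  [set W | exists (f : K -> R) (V : set R), [/\ Cc_plus R K f, open V &
     W = [set nu | V (fine (\int[emeas (sval nu)]_x (f x)%:E)%E)]]] `|`
  [set W | exists V : set R,
     open V /\ W = [set nu | V (complex.Re (sval nu setT))]].

HB.instance Definition _ := gen_eqMixin (cone_space R K).
HB.instance Definition _ := gen_choiceMixin (cone_space R K).
HB.instance Definition _ :=
  isSubBaseTopological.Build (cone_space R K) cone_subbase id.
End ConeTopology.

(** The space of non-empty compact subsets with the Michael topology. *)
Definition compact_subsets (K : topologicalType) : Type :=
  {H : set K | compact H /\ H !=set0}.

Section MichaelTopology.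
Context (K : topologicalType).

Definition michael_subbase : set (set (compact_subsets K)) :=
  [set W | exists U V : set K, [/\ open U, open V &
     W = [set H | sval H `&` U !=set0 /\ sval H `<=` V]]].

HB.instance Definition _ := gen_eqMixin (compact_subsets K).
HB.instance Definition _ := gen_choiceMixin (compact_subsets K).
HB.instance Definition _ :=
  isSubBaseTopological.Build (compact_subsets K) michael_subbase id.
End MichaelTopology.

(** Convolution is a total function on set functions, constrained on M(K) only.
    That [hinv] is a homeomorphism follows from [hg_inv_continuous] and
    [hg_invK]. *)
Record hypergroup (R : realType) (K : ptopologicalType) := Hypergroup {
  hconv : (set K -> R[i]) -> (set K -> R[i]) -> set K -> R[i] ;
  hinv : K -> K ;
  hunit : K ;
  hg_hausdorff : hausdorff_space K ;
  hg_locally_compact : locally_compact [set: K] ;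
  hg_banach : banach_space (fun nu => nu = fun=> 0)
    (complex_radon R K) (@variation_norm R K) ;
  hg_conv_closed : forall mu nu, complex_radon R K mu ->
    complex_radon R K nu -> complex_radon R K (hconv mu nu) ;
  hg_convA : forall mu nu rho, complex_radon R K mu -> complex_radon R K nu ->
    complex_radon R K rho ->
    hconv mu (hconv nu rho) = hconv (hconv mu nu) rho ;
  hg_convDl : forall mu nu rho, complex_radon R K mu -> complex_radon R K nu ->
    complex_radon R K rho ->
    hconv (fun A => mu A + nu A) rho =
      (fun A => hconv mu rho A + hconv nu rho A) ;
  hg_convDr : forall mu nu rho, complex_radon R K mu -> complex_radon R K nu ->
    complex_radon R K rho ->
    hconv mu (fun A => nu A + rho A) =
      (fun A => hconv mu nu A + hconv mu rho A) ;
  hg_convZl : forall (a : R[i]) mu nu, complex_radon R K mu ->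
    complex_radon R K nu ->
    hconv (fun A => a * mu A) nu = (fun A => a * hconv mu nu A) ;
  hg_convZr : forall (a : R[i]) mu nu, complex_radon R K mu ->
    complex_radon R K nu ->
    hconv mu (fun A => a * nu A) = (fun A => a * hconv mu nu A) ;
  hg_conv_norm : forall mu nu, complex_radon R K mu -> complex_radon R K nu ->
    variation_norm (hconv mu nu) <= variation_norm mu * variation_norm nu ;
  hg_conv_cone : exists2 F : cone_space R K * cone_space R K -> cone_space R K,
    forall p, sval (F p) = hconv (sval p.1) (sval p.2) & continuous F ;
  hg_conv_ge0 : forall x y A, 0 <= hconv (mdirac R x) (mdirac R y) A ;
  hg_conv_prob : forall x y, hconv (mdirac R x) (mdirac R y) setT = 1 ;
  hg_conv_supp : forall x y,
    compact (msupp (hconv (mdirac R x) (mdirac R y))) ;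
  hg_conv1l : forall x, hconv (mdirac R hunit) (mdirac R x) = mdirac R x ;
  hg_conv1r : forall x, hconv (mdirac R x) (mdirac R hunit) = mdirac R x ;
  hg_inv_continuous : continuous hinv ;
  hg_invK : involutive hinv ;
  hg_conv_inv : forall x y (A : set (borel K)), measurable A ->
    hconv (mdirac R x) (mdirac R y) [set hinv z | z in A] =
    hconv (mdirac R (hinv y)) (mdirac R (hinv x)) A ;
  hg_conv_unit : forall x y,
    msupp (hconv (mdirac R x) (mdirac R y)) hunit <-> x = hinv y ;
  hg_supp_continuous : exists2 F : K * K -> compact_subsets K,
    forall p, sval (F p) = msupp (hconv (mdirac R p.1) (mdirac R p.2))
    & continuous F
}.

Section HypergroupTheory.
Context (R : realType) (K : ptopologicalType) (H : hypergroup R K).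

Definition pconv (x y : K) : set K -> R[i] :=
  hconv H (mdirac R x) (mdirac R y).

Definition set_conv (U V : set K) : set K :=
  \bigcup_(x in U) \bigcup_(y in V) msupp (pconv x y).

(** U^n, for n >= 1. *)
Definition set_pow (U : set K) (n : nat) : set K := iter n.-1 (set_conv U) U.

(** g(x * y) for non-negative [g] *)
Definition transl (g : K -> \bar R) (x y : K) : \bar R :=
  (\int[emeas (pconv x y)]_t g t)%E.

(** [nu] is delta_x * mu: as [mu] may be infinite, this is read through the
    functional on C_c(K) that the Radon measure delta_x * mu represents. *)
Definition is_dirac_conv (x : K)
    (mu nu : {measure set (borel K) -> \bar R}) : Prop :=
  forall f, Cc_plus R K f ->
    (\int[nu]_y (f y)%:E = \int[mu]_y transl (EFin \o f) x y)%E.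

Definition left_haar (mu : {measure set (borel K) -> \bar R}) : Prop :=
  [/\ is_radon mu, mu setT != 0%E & forall x, is_dirac_conv x mu mu].

End HypergroupTheory.

(** "mu-measurable" is Caratheodory measurability for the outer measure induced
    by [mu], and [mubar] below is the resulting complete measure. Elements of
    function spaces are represented by functions, with equality almost
    everywhere. The integral of a non-negative function which is not measurable
    for the measure at hand is its lower integral. *)

Section FunctionSpaces.
Context (R : realType) (K : ptopologicalType)
        (mu : {measure set (borel K) -> \bar R}).

Local Notation Kbar := (caratheodory_type (mu^*)%mu).
Local Notation mubar := (@completed_measure_extension _ _ _ mu).

Definition L0 : set (K -> R[i]) :=
  [set f | measurable_fun [set: Kbar] (fun x : Kbar => complex.Re (f x)) /\
           measurable_fun [set: Kbar] (fun x : Kbar => complex.Im (f x))].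

(** The convolution of non-negative functions, with values in [0, +oo]. *)
Definition fun_conv (H : hypergroup R K) (f g : K -> \bar R) (x : K) : \bar R :=
  (\int[mubar]_y (f y * transl H g (hinv H y) x))%E.

Definition eabs (f : K -> R[i]) (x : K) : \bar R := (cabs (f x))%:E.

(** Membership in a space of classes of functions for [0, +oo]-valued
    functions: these have to be finite almost everywhere. *)
Definition finite_part (h : K -> \bar R) (x : K) : R[i] := (fine (h x))%:C.

Definition ext_mem (V : set (K -> R[i])) (h : K -> \bar R) : Prop :=
  {ae mubar, forall x, h x \is a fin_num} /\ V (finite_part h).

Section BanachIdeal.
Variables (Om : set (K -> R[i])) (N : (K -> R[i]) -> R).

Record banach_ideal_space : Prop := {
  bis_L0 : Om `<=` L0 ;
  bis_banach : banach_space (fun f => {ae mubar, forall x, f x = 0}) Om N ;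
  bis_ideal : forall f g, Om f -> L0 g ->
    {ae mubar, forall x, cabs (g x) <= cabs (f x)} -> Om g /\ N g <= N f
}.

Definition cond_I : Prop :=
  forall (f_ : nat -> K -> R[i]) (f : K -> R[i]),
    (forall n, Om (f_ n)) -> L0 f ->
    (forall n, {ae mubar, forall x, 0 <= f_ n x}) ->
    {ae mubar, forall x, nondecreasing_seq (f_ ^~ x) /\
                         f_ ^~ x @ \oo --> (f x : R[i]^o)} ->
    (Om f -> nondecreasing_seq (N \o f_) /\ N \o f_ @ \oo --> N f) /\
    (~ Om f -> N \o f_ @ \oo --> +oo).

Definition cond_II : Prop := forall E : set Kbar, measurable E ->
  (mubar E < +oo)%E -> Om \1_E.

Definition cond_III : Prop := forall E : set Kbar, measurable E ->
  (mubar E < +oo)%E -> exists2 C : R, 0 < C &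
  forall f, Om f -> (\int[mubar]_(x in E) eabs f x <= (C * N f)%:E)%E.

Definition cond_IV : Prop := forall f g, Om f -> Om g ->
  {ae mubar, forall x, 0 <= f x} -> {ae mubar, forall x, 0 <= g x} ->
  (forall s : R, 0 <= s ->
     mubar [set x | s%:C < f x] = mubar [set x | s%:C < g x]) ->
  N f = N g.

Definition attained : set R :=
  [set s | exists2 E : set Kbar, measurable E & mubar E = s%:E].

(** Well defined on [attained] under [cond_II] and [cond_IV]. *)
Definition fundamental (s : R) : R :=
  get [set t : R | exists E : set Kbar,
         [/\ measurable E, mubar E = s%:E & t = N \1_E]].

Definition cond_V : Prop := fundamental @ within attained 0^'+ --> (0 : R).

Definition cond_VI : Prop := fundamental @ within attained +oo --> +oo.

End BanachIdeal.
End FunctionSpaces.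

Section Young.
Context (R : realType).
Implicit Types phi : R -> \bar R.

Record young_function phi : Prop := {
  yf_ge0 : forall x, (0 <= phi x)%E ;
  yf_convex : forall t x y, 0 <= t <= 1 ->
    (phi (t * x + (1 - t) * y)%R <= t%:E * phi x + (1 - t)%:E * phi y)%E ;
  yf_even : forall x, phi (- x) = phi x ;
  yf_left_continuous : forall x, 0 < x -> phi @ x^'- --> phi x ;
  yf_0 : phi 0 = 0%E ;
  yf_neq0 : exists2 x, 0 < x & phi x <> 0%E ;
  yf_neqy : exists2 x, 0 < x & phi x <> +oo%E
}.

Definition young_b phi : \bar R :=
  ereal_sup [set x%:E | x in [set x | (phi x < +oo)%E]].

(** phi(b_phi), read as the limit of phi at +oo if b_phi = +oo. *)
Definition young_at_b phi : \bar R :=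
  if young_b phi is b%:E then phi b else lim (phi x @[x --> +oo]).

Definition young_inv phi (y : R) : R := sup [set x | 0 <= x /\ (phi x <= y%:E)%E].

End Young.

Section CalderonLozanovskii.
Context (R : realType) (K : ptopologicalType)
        (mu : {measure set (borel K) -> \bar R}).
Variables (Om : set (K -> R[i])) (N : (K -> R[i]) -> R).
Implicit Types phi : R -> \bar R.

Definition modular phi (f : K -> R[i]) : \bar R :=
  let h := fun x => phi (cabs (f x)) in
  if `[< ext_mem mu Om h >] then (N (finite_part h))%:E else +oo%E.

Definition CL_space phi : set (K -> R[i]) := [set f | L0 mu f /\
  exists2 l : R, 0 < l & (modular phi (fun x => f x / l%:C)%R < +oo)%E].

Definition CL_norm phi (f : K -> R[i]) : R :=
  inf [set l : R | 0 < l /\ (modular phi (fun x => f x / l%:C)%R <= 1)%E].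

Definition CL_prod_dist phi1 phi2 (p q : (K -> R[i]) * (K -> R[i])) : R :=
  Num.max (CL_norm phi1 (fun x => p.1 x - q.1 x))
          (CL_norm phi2 (fun x => p.2 x - q.2 x)).

Definition CL_prod phi1 phi2 :=
  metric_subspace (CL_space phi1 `*` CL_space phi2) (CL_prod_dist phi1 phi2).

HB.instance Definition _ phi1 phi2 := Topological.on (CL_prod phi1 phi2).

End CalderonLozanovskii.

(* Main.v *)
Require Import Defs.
From HB Require Import structures.
From mathcomp Require Import all_boot all_order all_algebra finmap.
From mathcomp Require Import all_classical all_reals all_analysis.
From mathcomp Require Import measurable_realfun.
From mathcomp Require Import complex ring lra.

Set Implicit Arguments.
Unset Strict Implicit.
Unset Printing Implicit Defensive.

Import Order.TTheory GRing.Theory Num.Theory.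
Import numFieldNormedType.Exports.

Local Open Scope classical_set_scope.
Local Open Scope ring_scope.
Local Open Scope complex_scope.

(** Let [K] satisfy the growth hypothesis. Since it applies to every compact
    neighborhood of the identity, and any point can be added to such a set, all
    points of [K] are invertible. Convolution by an invertible point is an
    automorphism of the ordered cone of positive measures, so it preserves point
    masses ([pconv_dirac]); thus [K] is a locally compact group
    ([hypergroup_group]) and the left Haar measure is translation invariant
    ([haar_translate]).

    Large sets. There are compact symmetric sets [D] of arbitrarily large measure
    with [mu (D * D) <= omega * mu D] for a fixed [omega] ([haar_doubling]).
    Moreover every set has subsets of all smaller measures that occur
    ([subset_of_measure]); by [cond_IV] the norms of indicators are then
    subadditive in the measure ([norm_indic_scale]). Hence, with
    [Phi := N \1_D], the indicator of [D * D] has norm at most [k * Phi], and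
    [Phi <= C * mu D], where [k] and [C] do not depend on [D].

    The construction. Put [x := Phi^-1]. Constants [c] and [d] close to
    [r * young_inv phi1 x] and [r * young_inv phi2 x] give functions [c * \1_D]
    and [d * \1_(D * D)] of norm at most [r]. As [inv v * u] lies in [D * D] for
    [u] and [v] in [D], their convolution is at least [c * d * mu D] on [D]. By
    [cond_VI] [x] tends to [0] when [D] grows, and the hypothesis on the
    inverses makes this value larger than any given multiple of
    [young_inv phi3 x], hence the modular of the convolution as large as desired
    ([scale_choice]).

    The category argument. The set of the theorem is the union of the sets
    [bounded_conv n.+1], where the modular of the convolution divided by [n.+1]
    is at most [n.+1]. Given a pair [(f0, g0)], one can move [f0] and [g0] away
    from [0] on [D] and [D * D] by [c] and [d] ([push_away_from0]), at the
    expense of a small norm. For pairs close to the new one, the lower bounds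
    persist outside of subsets of small measure, by [cond_III]
    ([CL_level], [level_stable]). What these subsets remove from the convolution
    at a point of [D] is the measure of one of them and of the inverse of the
    other. The latter is small as well: on compact sets inversion multiplies
    Haar measure by at most a constant ([haar_inverse]), which follows from
    exchanging integrals of continuous functions with compact support. So a
    neighborhood of the new pair misses [bounded_conv n.+1]
    ([bounded_conv_nowhere_dense]). *)

(** * Lower integrals *)

Section LowerIntegral.
Local Open Scope ereal_scope.
Context d (T : measurableType d) (R : realType).

Lemma le_lower_integral (m : set T -> \bar R) (f g : T -> \bar R) :
  (forall x, 0 <= f x) -> (forall x, f x <= g x) ->
  \int[m]_x f x <= \int[m]_x g x.
Proof.
move=> f0 fg; have g0 x : 0 <= g x by exact: le_trans (fg x).
rewrite /integral !patch_setT.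
have -> : [eta f]^\- = [eta g]^\-.
  by apply/funext => x; rewrite !funenegE !max_r// oppe_le0.
apply: leeD2r; apply: ereal_sup_le => _ [h hf <-]; exists h => // x.
by apply: le_trans (hf x) _; rewrite !funeposE !max_l.
Qed.

(** No measurability is needed at a point mass: [f] lies between measurable
    functions that agree with it at the only point that matters. *)
Lemma lower_integral_point (m : {measure set T -> \bar R}) (z : T)
    (f : T -> \bar R) : measurable [set z] ->
  (forall A, measurable A -> m A = \d_z A) -> (forall x, 0 <= f x) ->
  \int[m]_x f x = f z.
Proof.
move=> mz mE f0.
pose g (c : \bar R) (x : T) := if x == z then f z else c.
have gE c : 0 <= c -> \int[m]_x g c x = f z.
  move=> c0.
  rewrite (eq_measure_integral \d_z)//; last by move=> A mA _; exact: mE.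
  rewrite integral_dirac// ?diracT ?mul1e /g ?eqxx//.
  apply: measurable_fun_ifT => //.
  apply: (measurable_fun_bool true); rewrite setTI.
  by rewrite (_ : _ @^-1` _ = [set z])//; apply/seteqP; split => x /eqP.
apply/eqP; rewrite eq_le; apply/andP; split.
  rewrite -(gE +oo)//; apply: le_lower_integral => // x.
  by rewrite /g; case: eqP => [->//|_]; exact: leey.
rewrite -(gE 0)//; apply: le_lower_integral => // x.
  by rewrite /g; case: eqP.
by rewrite /g; case: eqP => [->//|_].
Qed.

End LowerIntegral.

(** * Locally compact Hausdorff spaces *)

Section Topology.
Context (K : ptopologicalType).

(** Compactness as an induction principle: a property that holds locally and
    passes to finite unions holds for a neighborhood of a compact set. *)
Lemma compact_ind (P : set K -> Prop) (C : set K) : compact C -> P set0 ->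
  (forall A B, P A -> P B -> P (A `|` B)) ->
  (forall x, C x -> exists2 U, open_nbhs x U & P U) ->
  exists U, [/\ open U, C `<=` U & P U].
Proof.
move=> cC P0 PU Ploc.
have /choice[V VP] : forall x, exists V, C x -> open_nbhs x V /\ P V.
  move=> x; have [Cx|nCx] := pselect (C x); last by exists set0.
  by have [V Vx PV] := Ploc x Cx; exists V.
move: cC; rewrite compact_cover => /(_ _ C V).
case=> [x /VP[[]]//|x Cx|D DC CV]; first by exists x => //; case: (VP x Cx) => -[].
exists (cover [set` D] V); split => //.
  by apply: bigcup_open => x /= /DC /set_mem /VP[[]].
rewrite /cover bigcup_seq big_seq.
by elim/big_ind : _ => // x /DC /set_mem /VP[].
Qed.

Lemma open_borel (U : set K) : open U -> measurable (U : set (borel K)).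
Proof. by move=> oU; exact: sub_sigma_algebra. Qed.

Lemma closed_borel (U : set K) : closed U -> measurable (U : set (borel K)).
Proof.
move=> cU; rewrite -(setCK U); apply: measurableC; apply: open_borel.
by rewrite openC.
Qed.

Lemma continuous_borel (R : realType) (f : K -> R) : continuous f ->
  measurable_fun [set: borel K] (f : borel K -> R).
Proof.
move=> /continuousP cf; apply: (measurability _ (RGenOInfty.measurableE R)).
move=> _ [_ [a ->] <-]; rewrite setTI; apply: open_borel.
by apply: cf; exact: interval_open.
Qed.

Hypothesis hK : hausdorff_space K.

Lemma compact_borel (U : set K) : compact U -> measurable (U : set (borel K)).
Proof. by move=> cU; apply: closed_borel; exact: compact_closed. Qed.

Lemma borel_set1 (x : K) : measurable ([set x] : set (borel K)).
Proof. by apply: compact_borel; exact: compact_set1. Qed.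

Hypothesis lcK : locally_compact [set: K].

Lemma compact_nbhs (x : K) : exists2 U, nbhs x U & compact U.
Proof. by have [W] := lcK (I : setT x); rewrite withinET => Wx [cW _]; exists W. Qed.

Lemma compact_thicken (C : set K) : compact C ->
  exists U, [/\ open U, C `<=` U & exists2 Z, compact Z & U `<=` Z].
Proof.
move=> cC; apply: compact_ind => //.
- by exists set0 => //; exact: compact0.
- move=> A B [Z cZ AZ] [Y cY BY]; exists (Z `|` Y); first exact: compactU.
  exact: setUSS.
- move=> x Cx; have [Z Zx cZ] := compact_nbhs x.
  exists (Z°)%classic; last by exists Z => //; exact: interior_subset.
  by rewrite open_nbhsE; split; [exact: open_interior|exact: nbhs_interior].
Qed.

Lemma Cc_plus_support (R : realType) (f : K -> R) (Z : set K) : continuous f ->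
  (forall x, 0 <= f x) -> compact Z -> (forall x, f x != 0 -> Z x) ->
  Cc_plus R K f.
Proof.
move=> cf f0 cZ fZ; split => //.
apply: (subclosed_compact _ cZ); first exact: closed_closure.
rewrite (closure_id Z).1; last exact: compact_closed.
exact: closure_subset.
Qed.

(** Complete regularity separates points of [C] from the complement of [O];
    finitely many such functions add up to a function larger than [1] on [C],
    which is then truncated. *)
Lemma urysohn_compact (R : realType) (C O : set K) : compact C -> open O ->
  C `<=` O -> exists u : K -> R, [/\ Cc_plus R K u, forall x, u x <= 1,
    forall x, C x -> u x = 1 & forall x, u x != 0 -> O x].
Proof.
move=> cC oO CO.
pose P (U : set K) := exists g : K -> R, exists2 Z : set K, compact Z &
  [/\ continuous g, forall x, 0 <= g x, forall x, U x -> 1 < g x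
    & forall x, g x != 0 -> Z x /\ O x].
have [||x Cx|U [oU CU [g [Z cZ [cg g0 g1 gZ]]]]] := @compact_ind P C cC.
- exists (cst 0), set0; first exact: compact0.
  by split => // x; [exact: cvg_cst|rewrite eqxx].
- move=> A B [g [Z cZ [cg g0 g1 gZ]]] [h [Y cY [ch h0 h1 hY]]].
  exists (fun x => g x + h x), (Z `|` Y); first exact: compactU.
  split.
  + by move=> x; apply: cvgD; [exact: cg|exact: ch].
  + by move=> x; rewrite addr_ge0.
  + by move=> x [/g1|/h1] ?; [rewrite ltr_wpDr|rewrite ltr_wpDl].
  + move=> x gh; have [gx|/gZ[]] := eqVneq (g x) 0; last by split; [left|].
    by move: gh; rewrite gx add0r => /hY[]; split; [right|].
- have [Z Zx cZ] := compact_nbhs x.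
  have oV : open (O `&` (Z°)%classic) by apply: openI => //; exact: open_interior.
  have := @locally_compact_completely_regular K R lcK hK x (~` (O `&` (Z°)%classic)).
  rewrite closedC => /(_ oV).
  have OZx : ~ (~` (O `&` (Z°)%classic)) x by apply; split; [exact: CO|exact: Zx].
  move=> /(_ OZx) /(@uniform_separatorP _ R)[f [cf f01 fx fV]].
  have f0 z : 0 <= f z <= 1 by have := f01 (f z); rewrite /= in_itv /=; apply; exists z.
  exists [set z | f z < 1/2].
    split; first by apply: (@open_comp _ _ f [set z | z < 1/2]) => //; exact: open_lt.
    by rewrite /= (fx (f x)) //; exists x.
  exists (fun z => 2 * (1 - f z)), Z => //; split.
  + move=> z; apply: cvgM; first exact: cvg_cst.
    by apply: cvgB; [exact: cvg_cst|exact: cf].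
  + by move=> z; have /andP[] := f0 z; lra.
  + by move=> z /=; lra.
  + move=> z; apply: contra_neqP => nz.
    rewrite (fV (f z)) ?subrr ?mulr0//; exists z => //= -[Oz Zz]; apply: nz.
    by split => //; exact: interior_subset.
exists (fun x => Num.min 1 (g x)); split.
- apply: (Cc_plus_support (Z := Z)) => //.
  + by move=> x; apply: continuous_min; [exact: cvg_cst|exact: cg].
  + by move=> x; rewrite le_min ler01 g0.
  + by move=> x gx; apply: (gZ _ _).1; apply: contraNneq gx => ->; rewrite /Num.min ltr10.
- by move=> x; rewrite ge_min lexx.
- by move=> x /CU/g1 /ltW; rewrite /Num.min; case: ltgtP.
- by move=> x gx; apply: (gZ _ _).2; apply: contraNneq gx => ->; rewrite /Num.min ltr10.
Qed.

End Topology.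

(** * Complex numbers and positive measures *)

Section ComplexNumbers.
Context (R : realType).

Lemma complex_ge0P (z : R[i]) : 0 <= z -> z = (complex.Re z)%:C /\ 0 <= complex.Re z.
Proof. by case: z => a b; rewrite lecE /= => /andP[/eqP -> ->]. Qed.

Lemma cabs_ge0E (z : R[i]) : 0 <= z -> cabs z = complex.Re z.
Proof.
move=> /complex_ge0P[-> /= z0].
by rewrite expr0n /= addr0 sqrtr_sqr ger0_norm.
Qed.

Lemma norm_cabs (z : R[i]) : `|z| = (cabs z)%:C. Proof. by []. Qed.

Lemma ReD (z w : R[i]) : complex.Re (z + w) = complex.Re z + complex.Re w.
Proof. by case: z w => a b []. Qed.

Lemma ReB (z w : R[i]) : complex.Re (z - w) = complex.Re z - complex.Re w.
Proof. by case: z w => a b []. Qed.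

Lemma Re_sum I (r : seq I) P (F : I -> R[i]) :
  complex.Re (\sum_(i <- r | P i) F i) = \sum_(i <- r | P i) complex.Re (F i).
Proof. exact: (big_morph _ ReD). Qed.

Lemma Re_le_cabs (z : R[i]) : `|complex.Re z| <= cabs z.
Proof. by rewrite -lecR; exact: normc_ge_Re. Qed.

Lemma cvg_complex_Re (u : nat -> R[i]) (l : R[i]) :
  u @ \oo --> (l : R[i]^o) -> (fun n => complex.Re (u n)) @ \oo --> complex.Re l.
Proof.
move=> ul; apply/cvgrPdist_lt => e e0.
have e0' : 0 < e%:C :> R[i] by rewrite ltcR.
have [n _ nP] := (@cvgrPdist_lt _ R[i]^o _ _ _ u l).1 ul _ e0'.
exists n => // m /nP /=.
rewrite norm_cabs ltcR; apply: le_lt_trans.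
by rewrite -ReB; exact: Re_le_cabs.
Qed.

Lemma cabs_ge0 (z : R[i]) : 0 <= cabs z.
Proof. by case: z => a b; rewrite sqrtr_ge0. Qed.

Lemma cabs_real (r : R) : cabs r%:C = `|r|.
Proof. by rewrite /= expr0n /= addr0 sqrtr_sqr. Qed.

Lemma cabsM (z w : R[i]) : cabs (z * w) = cabs z * cabs w.
Proof. by apply: (@complexI R); rewrite rmorphM -!norm_cabs normrM. Qed.

Lemma cabs_div (z : R[i]) (l : R) : 0 < l -> cabs (z / l%:C) = cabs z / l.
Proof.
by move=> l0; rewrite cabsM -fmorphV cabs_real ger0_norm// invr_ge0 ltW.
Qed.

Lemma cabs_sub (z w : R[i]) : cabs (z - w) <= cabs z + cabs w.
Proof. by rewrite -lecR rmorphD -!norm_cabs; exact: ler_normB. Qed.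

End ComplexNumbers.

Section PointMasses.
Context (R : realType) (K : ptopologicalType).
Implicit Types nu : set K -> R[i].

(** The part of [positive_radon] that does not mention regularity. *)
Record positive_measure nu : Prop := {
  pm_out : forall A : set (borel K), ~ measurable A -> nu A = 0 ;
  pm_sum : forall F : nat -> set (borel K), (forall n, measurable (F n)) ->
    trivIset setT F ->
    (fun n => \sum_(i < n) nu (F i)) @ \oo --> (nu (\bigcup_n F n) : R[i]^o) ;
  pm_ge0 : forall A, 0 <= nu A }.

Lemma positive_radon_measure nu : positive_radon R K nu -> positive_measure nu.
Proof. by case=> -[n0 ns _ _] n1; split. Qed.

Lemma positive_measureE nu A : positive_measure nu -> nu A = (complex.Re (nu A))%:C.
Proof. by case=> _ _ /(_ A)/complex_ge0P[]. Qed.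

Lemma positive_measure_Re_ge0 nu A : positive_measure nu -> 0 <= complex.Re (nu A).
Proof. by case=> _ _ /(_ A)/complex_ge0P[]. Qed.

(** Regularity in [complex_radon] is phrased with the total variation; on
    positive measures this turns it into ordinary inner regularity. *)
Lemma total_variation_positive nu (A : set (borel K)) : positive_measure nu ->
  measurable A -> Defs.total_variation nu A = (complex.Re (nu A))%:E.
Proof.
move=> pn mA.
have sumE (F : nat -> set K) : (forall n, measurable (F n : set (borel K))) ->
    trivIset setT F ->
    (\sum_(0 <= n <oo) (cabs (nu (F n)))%:E)%E =
    (complex.Re (nu (\bigcup_n F n)))%:E.
  move=> mF tF; apply/cvg_lim => //.
  have h := cvg_complex_Re (pm_sum pn mF tF).
  apply/fine_cvgP; split.
    by apply: nearW => n; rewrite /= sumEFin.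
  apply: cvg_trans h; apply: near_eq_cvg; apply: nearW => n /=.
  rewrite sumEFin /= Re_sum big_mkord; apply: eq_bigr => i _.
  by rewrite cabs_ge0E//; exact: (pm_ge0 pn).
apply/eqP; rewrite eq_le; apply/andP; split.
  by apply: ge_ereal_sup => _ [F [mF tF <-] <-]; rewrite sumE.
apply: ereal_sup_ubound; exists (fun n => if n is 0%N then A else set0).
  split => //.
  - by case.
  - by apply/trivIsetP => -[|i] [|j]// _ _ _; rewrite ?setI0 ?set0I.
  - apply/seteqP; split => [x [[|n] _]//|x Ax]; by exists 0%N.
rewrite sumE//.
- congr (complex.Re (nu _))%:E.
  by apply/seteqP; split => [x [[|n] _]//|x Ax]; exists 0%N.
- by case.
- by apply/trivIsetP => -[|i] [|j]// _ _ _; rewrite ?setI0 ?set0I.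
Qed.

(** The constant family of empty sets is disjoint, so the multiples of the value
    at the empty set converge to that value. *)
Lemma positive_measure0 nu : positive_measure nu -> nu set0 = 0.
Proof.
move=> pn.
have := pm_sum pn (fun n : nat => measurable0) (@trivIset_set0 _ _ setT).
rewrite bigcup0// => h.
have := cvg_complex_Re h.
have -> : (fun n => complex.Re (\sum_(i < n) nu set0)) =
  (fun n => complex.Re (nu set0) *+ n).
  by apply/funext => n; rewrite Re_sum sumr_const card_ord.
move=> h'.
suff r0 : complex.Re (nu set0) = 0 by rewrite positive_measureE// r0.
apply/eqP; rewrite eq_le positive_measure_Re_ge0// andbT leNgt; apply/negP => r0.
have /cvgrPdist_lt/(_ _ r0)[n _ nP] := h'.
have := nP (n + 2)%N; rewrite /= leq_addr => /(_ isT).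
apply/negP; rewrite -leNgt distrC mulrnDr mulr2n addrA addrK.
by rewrite ger0_norm ?lerDr ?addr_ge0 ?mulrn_wge0 // ltW.
Qed.

Lemma positive_measureU nu (A B : set (borel K)) : positive_measure nu ->
  measurable A -> measurable B -> A `&` B = set0 -> nu (A `|` B) = nu A + nu B.
Proof.
move=> pn mA mB AB.
pose F := bigcup2 A B.
have mF n : measurable (F n) by case: n => [|[|n]]; rewrite /F /bigcup2 //=; exact: measurable0.
have tF : trivIset setT F.
  apply/trivIsetP => -[|[|i]] [|[|j]]// _ _ _; rewrite /F/= ?setI0 ?set0I//.
  by rewrite setIC.
have := cvg_complex_Re (pm_sum pn mF tF); rewrite bigcup2E => h.
have h2 : (fun n => complex.Re (\sum_(i < n) nu (F i))) @ \oo -->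
    complex.Re (nu A + nu B).
  apply: cvg_near_cst; exists 2%N => // n /= n2.
  rewrite -(subnKC n2) big_split_ord /= big_ord_recl big_ord1.
  by rewrite (eq_bigr (fun=> 0)) ?big1 ?addr0// => i _; exact: positive_measure0.
have := cvg_unique _ h h2 => /(_ (@Rhausdorff R)) E.
rewrite positive_measureE// E ReD rmorphD /=.
by rewrite -!positive_measureE.
Qed.

Lemma positive_measure_le nu (A B : set (borel K)) : positive_measure nu ->
  measurable A -> measurable B -> A `<=` B ->
  complex.Re (nu A) <= complex.Re (nu B).
Proof.
move=> pn mA mB AB.
rewrite -(setDUK AB) positive_measureU//; last 2 first.
  exact: measurableD.
  by rewrite setIDA setIC -setIDA setDv setI0.
by rewrite ReD lerDl positive_measure_Re_ge0.
Qed.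

Definition measure_part nu (A : set (borel K)) : set K -> R[i] :=
  fun E => if `[< measurable (E : set (borel K)) >] then nu (A `&` E) else 0.

Hypothesis hK : hausdorff_space K.

Lemma inner_regular_positive_radon nu : positive_measure nu ->
  (forall A : set (borel K), measurable A -> ((complex.Re (nu A))%:E <=
    ereal_sup [set (complex.Re (nu C))%:E | C in [set C : set K | compact C /\ C `<=` A]])%E) ->
  positive_radon R K nu.
Proof.
move=> pn reg; split; last exact: pm_ge0.
split => //; [exact: pm_out|exact: pm_sum| |].
  by rewrite total_variation_positive// ltry.
move=> A mA; rewrite total_variation_positive//.
have -> : [set Defs.total_variation nu C | C in [set C : set K | compact C /\ C `<=` A]]
  = [set (complex.Re (nu C))%:E | C in [set C : set K | compact C /\ C `<=` A]].
  apply/seteqP; split => [_ [C [cC CA] <-]|_ [C [cC CA] <-]]; exists C => //;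
  by rewrite total_variation_positive//; exact: compact_borel.
apply/eqP; rewrite eq_le reg//=.
apply: ge_ereal_sup => _ [C [cC CA] <-].
by rewrite lee_fin positive_measure_le//; exact: compact_borel.
Qed.

Lemma positive_radon_inner nu (A : set (borel K)) : positive_radon R K nu ->
  measurable A -> (complex.Re (nu A))%:E =
    ereal_sup [set (complex.Re (nu C))%:E | C in [set C : set K | compact C /\ C `<=` A]].
Proof.
move=> pr mA; have pn := positive_radon_measure pr.
case: pr => -[_ _ _ /(_ A mA)] + _.
rewrite total_variation_positive// => ->; congr ereal_sup.
apply/seteqP; split => [_ [C [cC CA] <-]|_ [C [cC CA] <-]]; exists C => //;
by rewrite total_variation_positive//; exact: compact_borel.
Qed.

Lemma positive_radon_part nu (A : set (borel K)) : positive_radon R K nu ->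
  measurable A -> positive_radon R K (measure_part nu A).
Proof.
move=> pr mA; have pn := positive_radon_measure pr.
apply: inner_regular_positive_radon.
  split.
  - by move=> B nB; rewrite /measure_part; case: asboolP.
  - move=> F mF tF.
    have := @pm_sum _ pn (fun n => A `&` F n).
    rewrite -setI_bigcupr => h.
    rewrite {2}/measure_part asboolT; last exact: bigcup_measurable.
    rewrite (_ : (fun n => _) = (fun n => \sum_(i < n) nu (A `&` F i))).
      apply: h => [n|]; first exact: measurableI.
      exact: trivIset_setIl.
    apply/funext => n; apply: eq_bigr => i _.
    by rewrite /measure_part asboolT.
  - by move=> B; rewrite /measure_part; case: asboolP => _ //; exact: pm_ge0.
move=> E mE; rewrite {1}/measure_part asboolT//.
rewrite positive_radon_inner//; last exact: measurableI.
apply: ge_ereal_sup => _ [C [cC CA] <-].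
apply: ereal_sup_ubound; exists C; first by split => // x /CA[].
rewrite /measure_part asboolT; last exact: compact_borel.
by rewrite setIidr// => x /CA[].
Qed.

Lemma measure_part_split nu (A : set (borel K)) : positive_radon R K nu ->
  measurable A ->
  nu = (fun E => measure_part nu A E + measure_part nu (~` A) E).
Proof.
move=> /positive_radon_measure pn mA; apply/funext => E; rewrite /measure_part.
case: asboolP => mE; last by rewrite addr0 pm_out.
rewrite -positive_measureU//; try (by apply: measurableI => //; exact: measurableC).
- by rewrite -setIUl setUv setTI.
- by rewrite setIACA setICr set0I.
Qed.

Lemma positive_radon_mdirac x : positive_radon R K (mdirac R x).
Proof.
apply: inner_regular_positive_radon.
  split.
  - by move=> A mA; rewrite /mdirac; case: asboolP.
  - move=> F mF tF.
    rewrite {2}/mdirac asboolT; last exact: bigcup_measurable.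
    have [[k _ Fk]|nF] := pselect ((\bigcup_n F n) x).
      apply: (@cvg_near_cst nat R[i]^o).
      exists k.+1 => // n /= kn; rewrite indicE mem_set; last by exists k.
      rewrite (bigD1 (Ordinal kn))//= big1 ?addr0.
        by rewrite /mdirac asboolT// indicE mem_set.
      move=> i ik; rewrite /mdirac asboolT// indicE memNset// => Fi.
      move/eqP: ik; apply; apply/val_inj => /=.
      by apply: (tF i k I I); exists x.
    apply: (@cvg_near_cst nat R[i]^o); apply: nearW => n.
    rewrite indicE memNset//= big1// => i _.
    by rewrite /mdirac asboolT// indicE memNset// => Fi; apply: nF; exists i.
  - by move=> A; rewrite /mdirac; case: asboolP => // _; rewrite indicE ler0n.
move=> A mA; rewrite {1}/mdirac asboolT// indicE.
have [/set_mem xA|xA] := boolP (x \in A).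
  apply: ereal_sup_ubound; exists [set x].
    by split; [exact: compact_set1|move=> _ ->].
  by rewrite /mdirac asboolT ?indicE ?mem_set//; exact: borel_set1.
apply: ereal_sup_ubound; exists set0; first by split; [exact: compact0|].
by rewrite /mdirac asboolT ?indicE ?in_set0//; exact: measurable0.
Qed.

Lemma mdirac_inj : injective (@mdirac R K).
Proof.
move=> x y /(congr1 (@^~ [set x])); rewrite /mdirac asboolT; last exact: borel_set1.
rewrite !indicE mem_set//; case: (boolP (y \in _)) => [/set_mem ->//|_] /eqP.
by rewrite oner_eq0.
Qed.

Lemma msupp_mdirac (x : K) : msupp (mdirac R x) = [set x].
Proof.
have pm := positive_radon_measure (positive_radon_mdirac x).
apply/seteqP; split => [y sy|_ -> U oU Ux].
  apply: contrapT => yx.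
  have oU : open (~` [set x]).
    by rewrite openC; apply: compact_closed => //; exact: compact_set1.
  have := sy _ oU yx; rewrite total_variation_positive//; last exact: open_borel.
  rewrite /mdirac asboolT; last exact: open_borel.
  by rewrite indicE memNset ?ltxx//= => /(_ erefl).
rewrite total_variation_positive//; last exact: open_borel.
rewrite /mdirac asboolT; last exact: open_borel.
by rewrite indicE mem_set//= lte01.
Qed.

Lemma positive_radon_scale (a : R) nu : 0 <= a -> positive_radon R K nu ->
  positive_radon R K (fun A => a%:C * nu A).
Proof.
move=> a0 pr; have pn := positive_radon_measure pr.
have aE A : a%:C * nu A = (a * complex.Re (nu A))%:C.
  by rewrite {1}positive_measureE// rmorphM.
apply: inner_regular_positive_radon.
  split.
  - by move=> A mA; rewrite (pm_out pn)// mulr0.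
  - move=> F mF tF; under eq_fun do rewrite -mulr_sumr.
    by apply: (@cvgMr _ _ _ _ (_ : nat -> R[i]^o)); exact: pm_sum.
  - by move=> A; rewrite aE lecR mulr_ge0// positive_measure_Re_ge0.
move=> A mA; rewrite aE /= EFinM positive_radon_inner//.
have [->|an0] := eqVneq a 0.
  rewrite mul0e; apply: ereal_sup_ubound; exists set0; first by split; [exact: compact0|].
  by rewrite mul0r.
rewrite -lee_pdivlMl ?lt0r ?an0//; apply: ge_ereal_sup => _ [C [cC CA] <-].
rewrite lee_pdivlMl ?lt0r ?an0//.
by apply: ereal_sup_ubound; exists C => //; rewrite aE.
Qed.

(** [emeas nu] is a plain function on sets; the integration lemmas need a
    bundled measure equal to it. *)
Lemma emeas_measure nu : positive_measure nu ->
  exists m : {measure set (borel K) -> \bar R}, m = emeas nu :> (set (borel K) -> \bar R).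
Proof.
move=> pn.
have m0 : emeas nu set0 = 0%E by rewrite /emeas positive_measure0.
have mge0 A : (0 <= emeas nu A)%E by rewrite lee_fin positive_measure_Re_ge0.
have ms : semi_sigma_additive (emeas nu).
  move=> F mF tF _; have h := cvg_complex_Re (pm_sum pn mF tF).
  apply/fine_cvgP; split; first by apply: nearW => n; rewrite sumEFin.
  apply: cvg_trans h; apply: near_eq_cvg; apply: nearW => n /=.
  by rewrite sumEFin /= Re_sum big_mkord.
pose M := isMeasure.Build _ _ _ (emeas nu) m0 mge0 ms.
pose m : {measure set (borel K) -> \bar R} := HB.pack (emeas nu) M.
by exists m.
Qed.

End PointMasses.

(** * A hypergroup with inverses is a group *)

Record lc_group (K : ptopologicalType) := LcGroup {
  gmul : K -> K -> K ;
  gone : K ;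
  ginv : K -> K ;
  g_hausdorff : hausdorff_space K ;
  g_locally_compact : locally_compact [set: K] ;
  gmulA : associative gmul ;
  gmul1g : left_id gone gmul ;
  gmulg1 : right_id gone gmul ;
  gmulVg : left_inverse gone ginv gmul ;
  gmulgV : right_inverse gone ginv gmul ;
  gmul_continuous : continuous (fun p : K * K => gmul p.1 p.2) ;
  ginv_continuous : continuous ginv
}.

Section IntegralBounds.
Local Open Scope ereal_scope.
Context (R : realType) (K : ptopologicalType).

(** The mean value bounds, for a measure carried by [U]. *)
Lemma emeas_integral_bounds (nu : set K -> R[i]) (U : set (borel K))
    (f : K -> R) (a b : R) : positive_measure nu ->
  measurable U -> nu (~` U) = 0%R -> continuous f -> (forall x, 0 <= f x)%R ->
  (0 <= a)%R -> (forall x, U x -> a <= f x <= b)%R ->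
  ((a * complex.Re (nu U))%:E <= \int[emeas nu]_x (f x)%:E <=
   (b * complex.Re (nu U))%:E)%E.
Proof.
move=> pn mU nU cf f0 a0 fab.
have [m mE] := emeas_measure pn; rewrite -mE.
have mUE : m U = (complex.Re (nu U))%:E by rewrite mE.
have mf : measurable_fun [set: borel K] (EFin \o f).
  by apply/measurable_EFinP; exact: continuous_borel.
have -> : \int[m]_x (f x)%:E = \int[m]_(x in setT `\` ~` U) (f x)%:E.
  apply: ge0_negligible_integral => //.
  - exact: measurableC.
  - by move=> x _; rewrite lee_fin.
  - by rewrite mE /emeas nU.
rewrite setDE setCK setTI !EFinM -mUE -!integral_cst//.
apply/andP; split; apply: ge0_le_integral => //.
- exact: measurable_funS mf.
- by move=> x /fab/andP[]; rewrite lee_fin.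
- by move=> x _; rewrite lee_fin.
- exact: measurable_funS mf.
- by move=> x /fab/andP[]; rewrite lee_fin.
Qed.

End IntegralBounds.

Section GroupOfHypergroup.
Context (R : realType) (K : ptopologicalType) (H : hypergroup R K).
Implicit Types (x y z : K) (nu : set K -> R[i]).

Let hK : hausdorff_space K := hg_hausdorff H.

Lemma positive_radon_conv mu nu : positive_radon R K mu ->
  positive_radon R K nu -> positive_radon R K (hconv H mu nu).
Proof.
move=> pm pn; have [F FE _] := hg_conv_cone H.
by rewrite -(FE (exist _ mu pm, exist _ nu pn)); exact: (svalP (F _)).
Qed.

Lemma complex_radon_mdirac x : complex_radon R K (mdirac R x).
Proof. by have [] := positive_radon_mdirac R hK x. Qed.

Lemma positive_radon_pconv x y : positive_radon R K (pconv H x y).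
Proof. by apply: positive_radon_conv; exact: positive_radon_mdirac. Qed.

(** A point mass spans an extreme ray of the cone of positive measures. *)
Lemma dominated_by_mdirac x sigma tau : positive_radon R K sigma ->
  positive_radon R K tau ->
  mdirac R x = (fun A => sigma A + tau A) ->
  sigma = (fun A => sigma setT * mdirac R x A).
Proof.
move=> /positive_radon_measure ps /positive_radon_measure pt E.
have null (A : set (borel K)) : measurable A -> ~ A x -> sigma A = 0.
  move=> mA nAx; have := congr1 (@^~ A) E; rewrite /mdirac asboolT// indicE.
  rewrite memNset// => /esym/eqP; rewrite paddr_eq0 ?pm_ge0//.
  by case/andP => /eqP.
apply/funext => A; rewrite /mdirac; case: asboolP => mA; last first.
  by rewrite (pm_out ps)// mulr0.
rewrite indicE; have [Ax|nAx] := pselect (A x); last first.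
  by rewrite memNset// mulr0; exact: null.
rewrite mem_set// mulr1 -[in RHS](setUv A) positive_measureU//; last 2 first.
- exact: measurableC.
- by rewrite setICr.
by rewrite [X in _ + X]null ?addr0//; exact: measurableC.
Qed.

Lemma michael_open (W : set (compact_subsets K)) :
  michael_subbase W -> open W.
Proof.
move=> mW; exists [set W]; last by rewrite bigcup_set1.
by move=> _ ->; exact: finI_from1.
Qed.

Lemma cone_open (W : set (cone_space R K)) : cone_subbase W -> open W.
Proof.
move=> mW; exists [set W]; last by rewrite bigcup_set1.
by move=> _ ->; exact: finI_from1.
Qed.

(** Neighborhoods in the cone topology in terms of its subbase: it suffices to
    control finitely many test functions. *)
Lemma cone_subbase_nbhs (p : cone_space R K) (W : set (cone_space R K)) :
  nbhs p W -> exists2 D : {fset set (cone_space R K)},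
    (forall V, V \in D -> cone_subbase V /\ V p) &
    \bigcap_(V in [set` D]) V `<=` W.
Proof.
rewrite nbhsE => -[V [[D DF <-] [U DU Up]] VW].
have [E EF UE] := DF _ DU.
exists E.
  move=> A EA; split; first by have /set_mem := EF _ EA.
  by move: Up; rewrite /= -UE; apply.
by move=> q Eq; apply: VW; exists U => //=; rewrite -UE.
Qed.

Lemma msupp_measure_gt0 nu (U : set K) : positive_radon R K nu -> open U ->
  (0 < Defs.total_variation nu U)%E -> 0 < complex.Re (nu U).
Proof.
move=> pr oU; rewrite total_variation_positive ?lte_fin//.
  exact: positive_radon_measure.
exact: open_borel.
Qed.

(** The normalized restrictions of [nu] to small neighbourhoods of [z]
    converge to [mdirac z] in the cone topology. *)
Lemma normalized_parts_cvg nu z (pz : positive_radon R K (mdirac R z))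
    (W : set (cone_space R K)) : positive_radon R K nu -> msupp nu z ->
  nbhs (exist _ (mdirac R z) pz : cone_space R K) W ->
  exists2 U : set K, open_nbhs z U & forall rho : cone_space R K,
    sval rho = (fun A => ((complex.Re (nu U))^-1)%:C * measure_part nu U A) ->
    W rho.
Proof.
move=> pr zs /cone_subbase_nbhs[D Dp DW].
have pn := positive_radon_measure pr.
pose P (V : set (cone_space R K)) (G : set K) := forall U, open_nbhs z U ->
  U `<=` G -> forall rho : cone_space R K,
    sval rho = (fun A => ((complex.Re (nu U))^-1)%:C * measure_part nu U A) ->
    V rho.
have /choice[G GP] : forall V : set (cone_space R K), exists G : set K,
    V \in D -> nbhs z G /\ P V G.
  move=> V; have [/Dp[sV Vz]|] := boolP (V \in D); last by exists set0.
  suff [G zO PO] : exists2 G, nbhs z G & P V G by exists G.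
  have rhoU (U : set K) (rho : cone_space R K) : open_nbhs z U ->
      sval rho = (fun A => ((complex.Re (nu U))^-1)%:C * measure_part nu U A) ->
      [/\ positive_measure (sval rho), sval rho (~` U) = 0, sval rho U = 1
        & sval rho setT = 1].
    move=> [oU Uz] rE.
    have nU := msupp_measure_gt0 pr oU (zs _ oU Uz).
    have mU := open_borel oU.
    split; first exact: (positive_radon_measure (svalP rho)).
    - by rewrite rE /measure_part asboolT ?setICr ?positive_measure0 ?mulr0//;
        exact: measurableC.
    - rewrite rE /measure_part asboolT// setIid [X in _ * X]positive_measureE//.
      by rewrite -rmorphM mulVf ?gt_eqF.
    - rewrite rE /measure_part asboolT// setIT [X in _ * X]positive_measureE//.
      by rewrite -rmorphM mulVf ?gt_eqF.
  have intz (f : K -> R) (U : set K) (a b : R) (rho : cone_space R K) :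
      Cc_plus R K f -> open U ->
      positive_measure (sval rho) -> sval rho (~` U) = 0 -> sval rho U = 1 ->
      0 <= a -> (forall x, U x -> a <= f x <= b) ->
      a <= fine (\int[emeas (sval rho)]_x (f x)%:E)%E <= b.
    move=> [cf f0 _] oU pm nU U1 a0 fab.
    have := emeas_integral_bounds pm (open_borel oU) nU cf f0 a0 fab.
    rewrite U1 /= !mulr1; case: (\int[_]_x _)%E => [r||]/=.
    + by rewrite !lee_fin.
    + by rewrite ?andbF.
    + by rewrite ?andbF.
  case: sV => [[f [G [Cf oO VE]]]|[G [oO VE]]]; last first.
    exists setT; first exact: filterT.
    move=> U zU _ rho rE; rewrite VE /=.
    have [_ _ _ ->] := rhoU _ _ zU rE.
    by move: Vz; rewrite VE /= /mdirac asboolT// indicE in_setT.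
  have [cf f0 _] := Cf.
  have fz : fine (\int[emeas (mdirac R z)]_x (f x)%:E)%E = f z.
    have [m mE] := emeas_measure (positive_radon_measure pz).
    rewrite -mE (lower_integral_point (z := z : borel K))//; first exact: borel_set1.
    move=> A mA; rewrite mE /emeas /mdirac asboolT// diracE indicE.
    by case: (z \in A).
  have : nbhs (f z) G.
    by move: Vz; rewrite VE /= fz => Gz; exact: open_nbhs_nbhs.
  move=> /nbhs_ballP[e /= e0 eO].
  exists [set x | `|f z - f x| < e / 2].
    have /cvgrPdist_lt := cf z; apply; exact: divr_gt0.
  move=> U zU UO rho rE; rewrite VE /=; apply: eO.
  have [pm nU U1 _] := rhoU _ _ zU rE.
  have /andP[h1 h2] : Num.max 0 (f z - e / 2) <=
      fine (\int[emeas (sval rho)]_x (f x)%:E)%E <= f z + e / 2.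
    apply: (intz f U) => //; first by case: zU.
      by rewrite le_max lexx.
    move=> x /UO /=; rewrite ltr_distl => /andP[fx1 fx2].
    by rewrite ge_max f0 /=; apply/andP; split; lra.
  move: h1; rewrite ge_max => /andP[_ h1].
  rewrite /ball /= ltr_distl; apply/andP; split; lra.
pose I := \bigcap_(V in [set` D]) G V.
have zI : nbhs z I by apply: filter_bigI => V /GP[].
exists (I°)%classic; first by split; [exact: open_interior|].
move=> rho rE; apply: DW => V /= VD.
have [_ /(_ (I°)%classic)] := GP V VD; apply => //.
  by split; [exact: open_interior|].
by move=> x /interior_subset; apply.
Qed.

(** Let [z] be in the support of [nu := pconv x y]. As [mdirac x'] sends [nu]
    to the extreme point [mdirac y], it sends every part of [nu] to a multiple
    of [mdirac y]; parts close to [z] give [pconv x' z = mdirac y] by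
    continuity, hence [nu = pconv x (pconv x' z) = mdirac z]. *)
Lemma pconv_dirac x x' y :
  pconv H x x' = mdirac R (hunit H) -> pconv H x' x = mdirac R (hunit H) ->
  exists z, pconv H x y = mdirac R z.
Proof.
move=> xx' x'x; set nu := pconv H x y.
have pnu : positive_radon R K nu by exact: positive_radon_pconv.
have pmn := positive_radon_measure pnu.
have conv_x'nu : hconv H (mdirac R x') nu = mdirac R y.
  rewrite /nu /pconv hg_convA; try exact: complex_radon_mdirac.
  by rewrite -/(pconv H x' x) x'x hg_conv1l.
have partE (A : set (borel K)) : measurable A ->
    exists c, hconv H (mdirac R x') (measure_part nu A) =
      fun B => c * mdirac R y B.
  move=> mA; have mCA : measurable (~` A) by exact: measurableC.
  have pA := positive_radon_part hK pnu mA.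
  have pCA := positive_radon_part hK pnu mCA.
  have pxA := positive_radon_conv (positive_radon_mdirac R hK x') pA.
  have pxCA := positive_radon_conv (positive_radon_mdirac R hK x') pCA.
  exists (hconv H (mdirac R x') (measure_part nu A) setT).
  apply: dominated_by_mdirac pxA pxCA _.
  rewrite -conv_x'nu [in LHS](measure_part_split pnu mA) hg_convDr//.
  - exact: complex_radon_mdirac.
  - by case: pA.
  - by case: pCA.
have [S SE _] := hg_supp_continuous H.
(* [hg_supp_continuous] takes values in the nonempty sets. *)
have [_ [z]] := svalP (S (x, y)); rewrite SE /= -/(pconv H x y) -/nu => zs.
have pz := positive_radon_mdirac R hK z.
have px' := positive_radon_mdirac R hK x'.
have pom := positive_radon_pconv x' z.
have pmom := positive_radon_measure pom.
suff x'z : pconv H x' z = mdirac R y.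
  exists z; rewrite /nu /pconv -x'z /pconv hg_convA; try exact: complex_radon_mdirac.
  by rewrite -/(pconv H x x') xx' hg_conv1l.
have mdir_y c (B : set (borel K)) : measurable B -> ~ B y -> c * mdirac R y B = 0 :> R[i].
  by move=> mB nBy; rewrite /mdirac asboolT// indicE memNset// mulr0.
suff om0 : pconv H x' z (~` [set y]) = 0.
  apply/funext => A; rewrite /mdirac; case: asboolP => mA; last first.
    by rewrite (pm_out pmom).
  have null (B : set (borel K)) : measurable B -> ~ B y -> pconv H x' z B = 0.
    move=> mB nBy; rewrite positive_measureE//; congr (_ %:C).
    apply/eqP; rewrite eq_le positive_measure_Re_ge0// andbT.
    have -> : 0 = complex.Re (pconv H x' z (~` [set y])) by rewrite om0.
    apply: positive_measure_le => //.
      by apply: measurableC; exact: borel_set1.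
    by move=> b Bb /= by_; apply: nBy; rewrite -by_.
  rewrite indicE; have [Ay|nAy] := pselect (A y); last first.
    by rewrite memNset// null.
  rewrite mem_set//= -[1%:R](hg_conv_prob H x' z) -(setUv A).
  rewrite -/(pconv H x' z) positive_measureU//; last 2 first.
  - exact: measurableC.
  - by rewrite setICr.
  by rewrite [X in _ + X]null ?addr0//; exact: measurableC.
have my : measurable ([set y] : set (borel K)) by exact: borel_set1.
have mCy := measurableC my.
suff : ((complex.Re (pconv H x' z (~` [set y])))%:E <= 0%:E)%E.
  rewrite lee_fin => h; rewrite positive_measureE//; congr (_ %:C).
  by apply/eqP; rewrite eq_le h positive_measure_Re_ge0.
rewrite (positive_radon_inner hK)//; apply: ge_ereal_sup => _ [C [cC Cy] <-].
rewrite lee_fin leNgt; apply/negP => C0.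
have oCy : open (~` [set y]).
  by rewrite openC; apply: compact_closed => //; exact: compact_set1.
have [f [Cf f1 fC fy]] := urysohn_compact hK (hg_locally_compact H) R cC oCy Cy.
have [cf f0 _] := Cf.
pose W : set (cone_space R K) :=
  [set p | 0 < fine (\int[emeas (sval p)]_x (f x)%:E)%E].
have oW : open W.
  by apply: cone_open; left; exists f, [set r | 0 < r]; split.
have [F FE cF] := hg_conv_cone H.
pose dx' : cone_space R K := exist _ _ px'.
pose dz : cone_space R K := exist _ _ pz.
have FW : W (F (dx', dz)).
  rewrite /W /= FE /= -/(pconv H x' z).
  have := emeas_integral_bounds pmom (open_borel (@openT K)) _ cf f0 (lexx 0)
    (_ : forall x, setT x -> 0 <= f x <= 1).
  rewrite setCT positive_measure0// => /(_ erefl) h.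
  have {h} /andP[_ hi] := h (fun t _ => introT andP (conj (f0 t) (f1 t))).
  have lo : ((complex.Re (pconv H x' z C))%:E <=
      \int[emeas (pconv H x' z)]_x (f x)%:E)%E.
    have [m mE] := emeas_measure pmom; rewrite -mE.
    have mC : measurable (C : set (borel K)) by exact: compact_borel.
    have -> : (complex.Re (pconv H x' z C))%:E = (\int[m]_x (\1_C x)%:E)%E.
      by rewrite integral_indic// setIT mE.
    apply: le_lower_integral => t; rewrite lee_fin indicE ?ler0n//.
    by have [/set_mem Ct|_] := boolP (t \in C); [rewrite fC|exact: f0].
  move: lo hi; case: (\int[_]_x _)%E => [r||]//=; rewrite !lee_fin => lo _.
  exact: lt_le_trans lo.
have [[A B] [/= Ax Bz] AB] : nbhs (dx', dz) (F @^-1` W).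
  by apply: cF; exact: open_nbhs_nbhs.
have [U [oU Uz] UB] := normalized_parts_cvg pnu zs Bz.
have c0 : 0 <= (complex.Re (nu U))^-1 by rewrite invr_ge0 positive_measure_Re_ge0.
have prho := positive_radon_scale hK c0 (positive_radon_part hK pnu (open_borel oU)).
have := AB (dx', exist _ _ prho) (conj (nbhs_singleton Ax) (UB (exist _ _ prho) erefl)).
have [c cE] := partE _ (open_borel oU).
have pF := positive_radon_measure (svalP (F (dx', exist _ _ prho))).
rewrite /W /= => Fpos.
have FyE : sval (F (dx', exist _ _ prho)) =
    fun B0 => ((complex.Re (nu U))^-1)%:C * c * mdirac R y B0.
  rewrite FE /= hg_convZr; last 2 first.
  - exact: complex_radon_mdirac.
  - by have [] := positive_radon_part hK pnu (open_borel oU).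
  by apply/funext => B0; rewrite cE mulrA.
have := @emeas_integral_bounds _ _ _ _ f 0 0 pF my _ cf f0 (lexx 0) _.
rewrite {1}FyE mdir_y//; last by apply.
move=> /(_ erefl) h.
have fP : forall x, [set y] x -> 0 <= f x <= 0.
  by move=> _ ->; rewrite f0 leNgt; apply/negP => /lt0r_neq0 /fy; exact.
have {h} := h fP; rewrite !mul0r -eq_le => /eqP E.
by move: Fpos; rewrite -E /= ltxx.
Qed.

Lemma set_pow_sub (U : set K) n : U (hunit H) -> (0 < n)%N ->
  U `<=` set_pow H U n.
Proof.
move=> Ue; case: n => // n _; rewrite /set_pow /=; elim: n => // n IH x Ux /=.
exists (hunit H) => //; exists x; first exact: IH.
by rewrite /pconv hg_conv1l msupp_mdirac.
Qed.

(** The hypothesis quantifies over all compact neighborhoods of the identity,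
    and any given point can be added to one of them. *)
Lemma growth_invertible :
  (forall U : set K, compact U -> nbhs (hunit H) U -> exists2 n : nat, (0 < n)%N &
    forall x, set_pow H U n x -> pconv H x (hinv H x) = mdirac R (hunit H) /\
      mdirac R (hunit H) = pconv H (hinv H x) x) ->
  forall x, pconv H x (hinv H x) = mdirac R (hunit H) /\
    pconv H (hinv H x) x = mdirac R (hunit H).
Proof.
move=> gr x; have [U Ue cU] := compact_nbhs (hg_locally_compact H) (hunit H).
have [||n n0 nP] := gr (U `|` [set x]).
- by apply: compactU => //; exact: compact_set1.
- by apply: filterS Ue; exact: subsetUl.
have [|h1 h2] := nP x; last by split.
apply: set_pow_sub => //; [by left; exact: nbhs_singleton Ue|by right].
Qed.

(** The product of [x] and [y] is the point carrying [pconv x y]; the group laws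
    are those of convolution, and the product is continuous because a map into
    the singletons is continuous for the Michael topology only if it is so for
    the topology of [K]. *)
Lemma hypergroup_group :
  (forall x, pconv H x (hinv H x) = mdirac R (hunit H) /\
    pconv H (hinv H x) x = mdirac R (hunit H)) ->
  exists G : lc_group K, [/\ gone G = hunit H, ginv G = hinv H &
    forall x y, pconv H x y = mdirac R (gmul G x y)].
Proof.
move=> invH.
have /choice[f fE] : forall p : K * K, exists z, pconv H p.1 p.2 = mdirac R z.
  by move=> [x y]; have [h1 h2] := invH x; exact: pconv_dirac h1 h2.
pose m x y := f (x, y).
have mE x y : pconv H x y = mdirac R (m x y) by rewrite (fE (x, y)).
have inj := @mdirac_inj R K hK.
have mA : associative m.
  move=> x y z; apply: inj; rewrite -!mE /pconv -[in LHS]mE -[in RHS]mE /pconv.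
  by rewrite hg_convA//; exact: complex_radon_mdirac.
have m1x : left_id (hunit H) m by move=> x; apply: inj; rewrite -mE /pconv hg_conv1l.
have mx1 : right_id (hunit H) m by move=> x; apply: inj; rewrite -mE /pconv hg_conv1r.
have mVx : left_inverse (hunit H) (hinv H) m.
  by move=> x; apply: inj; rewrite -mE (invH x).2.
have mxV : right_inverse (hunit H) (hinv H) m.
  by move=> x; apply: inj; rewrite -mE (invH x).1.
have mcont : continuous (fun p : K * K => m p.1 p.2).
  have [S SE cS] := hg_supp_continuous H.
  have SE' p : sval (S p) = [set m p.1 p.2].
    by rewrite SE -/(pconv H _ _) mE msupp_mdirac.
  move=> p V; rewrite nbhsE => -[G [oG Gp] GV].
  pose W : set (compact_subsets K) :=
    [set C | sval C `&` setT !=set0 /\ sval C `<=` G].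
  have oW : open W by apply: michael_open; exists setT, G; split => //; exact: openT.
  have WSp : W (S p) by rewrite /W /= SE' setIT; split; [exists (m p.1 p.2)|move=> _ ->].
  have := cS p W (open_nbhs_nbhs (conj oW WSp)).
  move=> h; apply: (@filterS _ (nbhs p) _ (S @^-1` W)) => // q /= [_].
  by rewrite SE' => qG; apply: GV; exact: qG.
by exists (LcGroup hK (hg_locally_compact H) mA m1x mx1 mVx mxV mcont
  (@hg_inv_continuous _ _ H)); split.
Qed.

End GroupOfHypergroup.

(** * Products of sets and invariant measures *)

Definition gset_mul (K : ptopologicalType) (G : lc_group K) (A B : set K) : set K :=
  [set gmul G x y | x in A & y in B].

Definition gset_pow (K : ptopologicalType) (G : lc_group K) (U : set K) (n : nat) :
  set K := iter n.-1 (gset_mul G U) U.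

Definition left_invariant (R : realType) (K : ptopologicalType) (G : lc_group K)
    (mu : {measure set (borel K) -> \bar R}) : Prop :=
  [/\ is_radon mu, mu setT != 0%E & forall x f, Cc_plus R K f ->
    (\int[mu]_y (f y)%:E = \int[mu]_y (f (gmul G x y))%:E)%E].

Section GroupSets.
Context (K : ptopologicalType) (G : lc_group K).
Local Notation "x ** y" := (gmul G x y) (at level 40, left associativity).
Local Notation inv := (ginv G).
Local Notation e := (gone G).

Lemma gmulK x y : inv x ** (x ** y) = y.
Proof. by rewrite gmulA gmulVg gmul1g. Qed.

Lemma gmulVK x y : x ** (inv x ** y) = y.
Proof. by rewrite gmulA gmulgV gmul1g. Qed.

Lemma ginvM x y : inv (x ** y) = inv y ** inv x.
Proof.
have E : (x ** y) ** (inv y ** inv x) = e by rewrite -gmulA gmulVK gmulgV.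
by rewrite -[LHS](gmulg1 G) -E gmulA gmulVg gmul1g.
Qed.

Lemma ginvK : involutive inv.
Proof. by move=> x; rewrite -[RHS](gmul1g G) -(gmulVg G (inv x)) -gmulA gmulVg gmulg1. Qed.

Lemma gmull_continuous x : continuous (gmul G x).
Proof.
move=> y; apply: (@continuous_comp _ _ _ (fun z => (x, z)) (fun p => p.1 ** p.2)).
  by apply: cvg_pair => /=; [exact: cvg_cst|exact: cvg_id].
exact: (@gmul_continuous _ G).
Qed.

Lemma gmulr_continuous x : continuous (fun y => y ** x).
Proof.
move=> y; apply: (@continuous_comp _ _ _ (fun z => (z, x)) (fun p => p.1 ** p.2)).
  by apply: cvg_pair => /=; [exact: cvg_id|exact: cvg_cst].
exact: (@gmul_continuous _ G).
Qed.

Lemma compact_gset_mul A B : compact A -> compact B -> compact (gset_mul G A B).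
Proof.
move=> cA cB.
have -> : gset_mul G A B = (fun p => p.1 ** p.2) @` (A `*` B).
  apply/seteqP; split => [_ [x Ax [y By <-]]|_ [[x y] [/= Ax By] <-]].
    by exists (x, y).
  by exists x => //; exists y.
apply: continuous_compact; last exact: compact_setX.
by apply: continuous_subspaceT; exact: (@gmul_continuous _ G).
Qed.

Lemma compact_ginv A : compact A -> compact (inv @` A).
Proof.
move=> cA; apply: continuous_compact => //.
by apply: continuous_subspaceT; exact: (@ginv_continuous _ G).
Qed.

Lemma gset_mulA A B C :
  gset_mul G A (gset_mul G B C) = gset_mul G (gset_mul G A B) C.
Proof.
apply/seteqP; split => [_ [x Ax [_ [y By [z Cz <-]] <-]]|_ [_ [x Ax [y By <-]] [z Cz <-]]].
  by exists (x ** y); [exists x => //; exists y|exists z => //; rewrite gmulA].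
by exists x => //; exists (y ** z); [exists y => //; exists z|rewrite gmulA].
Qed.

Lemma gset_powD U m n :
  gset_pow G U (m.+1 + n.+1) = gset_mul G (gset_pow G U m.+1) (gset_pow G U n.+1).
Proof.
rewrite /gset_pow addSn /=; elim: m => [|m IH]; first by rewrite add0n.
by rewrite addSn /= IH gset_mulA.
Qed.

Lemma gset_pow_compact U n : compact U -> compact (gset_pow G U n).
Proof.
move=> cU; rewrite /gset_pow; elim: n.-1 => // k IH /=.
exact: compact_gset_mul.
Qed.

Lemma gset_pow_sub U m n : U e -> (0 < m <= n)%N ->
  gset_pow G U m `<=` gset_pow G U n.
Proof.
move=> Ue; case: m => // m; case: n => // n; rewrite /gset_pow /=.
rewrite ltnS => /subnK <-; elim: (n - m)%N => // k IH x /IH h /=.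
by exists e => //; exists x; rewrite // gmul1g.
Qed.

Lemma gset_pow_sym U n : (forall x, U x -> U (inv x)) ->
  forall x, gset_pow G U n x -> gset_pow G U n (inv x).
Proof.
move=> sU; case: n => [//|n]; elim: n => // n IH x.
rewrite -[in X in X -> _]addn1 gset_powD => -[y /IH Uy [z Uz <-]].
by rewrite ginvM; exists (inv z); [exact: sU|exists (inv y)].
Qed.

End GroupSets.

Section Haar.
Context (R : realType) (K : ptopologicalType) (G : lc_group K).
Context (mu : {measure set (borel K) -> \bar R}) (muG : left_invariant G mu).
Local Notation "x ** y" := (gmul G x y) (at level 40, left associativity).
Local Notation inv := (ginv G).
Local Notation e := (gone G).

Let hK := g_hausdorff G.
Let radon : is_radon mu. Proof. by case: muG. Qed.

Lemma continuous_preimage_borel (h : K -> K) (A : set (borel K)) :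
  continuous h -> measurable A -> measurable (h @^-1` A : set (borel K)).
Proof.
move=> /continuousP ch mA.
have : measurable_fun [set: borel K] (h : borel K -> borel K).
  apply: (@measurability _ _ (borel K) (borel K) setT h (@open K)) => //.
  by move=> _ [B oB <-]; rewrite setTI; apply: open_borel; exact: ch.
by move=> /(_ measurableT _ mA); rewrite setTI.
Qed.

Lemma compact_fin (C : set K) : compact C -> (mu C < +oo)%E.
Proof. by case: radon => + _ _; apply. Qed.

Lemma compact_fin_num (C : set K) : compact C -> mu C \is a fin_num.
Proof. by move=> cC; rewrite ge0_fin_numE// compact_fin. Qed.

Lemma mu_le (A B : set (borel K)) : measurable A -> measurable B -> A `<=` B ->
  (mu A <= mu B)%E.
Proof. by move=> mA mB AB; apply: le_measure => //; rewrite inE. Qed.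

Lemma mu_indic (A : set (borel K)) : measurable A ->
  mu A = (\int[mu]_x (\1_A x)%:E)%E.
Proof. by move=> mA; rewrite integral_indic// setIT. Qed.

Lemma preimage_gmulV x (A : set K) :
  gmul G (inv x) @^-1` (gmul G x @^-1` A) = A.
Proof. by apply/seteqP; split => y; rewrite /preimage /= gmulVK. Qed.

(** Invariance is given on test functions only. An open set is exhausted from
    inside by compact sets [C], and a test function between the indicators of
    [C] and of [U] compares [mu C] with the measure of the translate of [U]. *)
Let open_le x (U : set K) : open U -> (mu U <= mu (gmul G x @^-1` U))%E.
Proof.
move=> oU; have [_ _ /(_ _ oU) ->] := radon.
apply: ge_ereal_sup => _ [C [cC CU] <-].
have [u [Cu u1 uC uU]] := urysohn_compact hK (g_locally_compact G) R cC oU CU.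
have [cu u0 _] := Cu.
have mC : measurable (C : set (borel K)) by exact: compact_borel.
have mpU : measurable (gmul G x @^-1` U : set (borel K)).
  apply: continuous_preimage_borel; first exact: gmull_continuous.
  exact: open_borel.
have [_ _ /(_ x u Cu) inv_u] := muG.
apply: (@le_trans _ _ (\int[mu]_y (u y)%:E)%E).
  rewrite mu_indic//; apply: le_lower_integral => y.
    by rewrite lee_fin indicE.
  rewrite lee_fin indicE.
  by have [/set_mem Cy|_] := boolP (y \in C); [rewrite uC|exact: u0].
rewrite inv_u (mu_indic mpU); apply: le_lower_integral => y.
  by rewrite lee_fin.
rewrite lee_fin indicE; have [Uxy|nUxy] := pselect (U (x ** y)).
  by rewrite mem_set.
rewrite memNset//=; have [->//|/uU] := eqVneq (u (x ** y)) 0.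
by move=> /nUxy.
Qed.

Lemma haar_open x (U : set K) : open U -> mu (gmul G x @^-1` U) = mu U.
Proof.
move=> oU; apply/eqP; rewrite eq_le open_le// andbT.
have oV : open (gmul G x @^-1` U).
  by apply: open_comp => // y _; exact: gmull_continuous.
have := open_le (inv x) oV; by rewrite preimage_gmulV.
Qed.

Let translate_le x (A : set (borel K)) : measurable A ->
  (mu (gmul G x @^-1` A) <= mu A)%E.
Proof.
move=> mA; have [_ /(_ _ mA) -> _] := radon.
apply: le_ereal_inf_tmp => _ [U [oU AU] <-]; rewrite -(haar_open x oU).
apply: mu_le => [||y /= /AU//].
- by apply: continuous_preimage_borel => //; exact: gmull_continuous.
- apply: continuous_preimage_borel; first exact: gmull_continuous.
  exact: open_borel.
Qed.

Lemma haar_translate x (A : set (borel K)) : measurable A ->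
  mu (gmul G x @^-1` A) = mu A.
Proof.
move=> mA; apply/eqP; rewrite eq_le translate_le//=.
have mV : measurable (gmul G x @^-1` A : set (borel K)).
  by apply: continuous_preimage_borel => //; exact: gmull_continuous.
have := translate_le (inv x) mV; by rewrite preimage_gmulV.
Qed.

(** If the measure were finite, a compact set [C] of more than half of it would
    meet all its translates, so that [K] would be the product of [C] and its
    inverse. *)
Lemma haar_unbounded (L : R) : ~ compact [set: K] ->
  exists2 C : set K, compact C & (L%:E < mu C)%E.
Proof.
move=> ncK; apply: contrapT => nC.
have muT : mu setT = ereal_sup [set mu C | C in [set C : set K | compact C /\ C `<=` setT]].
  by have [_ _ ->] := radon; [|exact: openT].
have Cle (C : set K) : compact C -> (mu C <= L%:E)%E.
  by move=> cC; rewrite leNgt; apply/negP => LC; apply: nC; exists C.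
have muTL : (mu setT <= L%:E)%E.
  by rewrite muT; apply: ge_ereal_sup => _ [C [cC _] <-]; exact: Cle.
have fT : mu setT \is a fin_num.
  by rewrite ge0_fin_numE// (le_lt_trans muTL) ?ltry.
have [_ mu0 _] := muG.
have T0 : 0 < fine (mu setT).
  by rewrite fine_gt0// lt0e mu0 measure_ge0 /= -ge0_fin_numE.
have : ((fine (mu setT) / 2)%:E < mu setT)%E.
  by rewrite -[X in (_ < X)%E]fineK// lte_fin ltr_pdivrMr// ltr_pMr// ltr1n.
rewrite {2}muT => /ereal_sup_gt[_ [C [cC _] <-] hC].
apply: ncK; suff -> : [set: K] = gset_mul G C (inv @` C).
  by apply: compact_gset_mul => //; exact: compact_ginv.
apply/seteqP; split => // x _; apply: contrapT => nx.
have mC : measurable (C : set (borel K)) by exact: compact_borel.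
have mxC : measurable (gmul G (inv x) @^-1` C : set (borel K)).
  by apply: continuous_preimage_borel => //; exact: gmull_continuous.
have dis : C `&` (gmul G (inv x) @^-1` C) = set0.
  rewrite -subset0 => y [Cy /= Cxy]; apply: nx.
  exists y => //; exists (inv (inv x ** y)); first by exists (inv x ** y).
  by rewrite ginvM ginvK gmulVK.
have := mu_le (measurableU _ _ mC mxC) measurableT (@subsetT _ _).
have -> : mu (C `|` (gmul G (inv x) @^-1` C)) = (mu C + mu C)%E.
  by rewrite measureU//; congr (_ + _)%E; exact: haar_translate.
rewrite leNgt => /negP; apply.
rewrite -(fineK fT) -(fineK (compact_fin_num cC)) -EFinD lte_fin.
move: hC; rewrite -(fineK (compact_fin_num cC)) lte_fin; lra.
Qed.

End Haar.

(** * Large sets with bounded doubling, and subsets of given measure *)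

Section Growth.
Context (R : realType) (K : ptopologicalType) (G : lc_group K).
Context (mu : {measure set (borel K) -> \bar R}) (muG : left_invariant G mu).
Local Notation "x ** y" := (gmul G x y) (at level 40, left associativity).
Local Notation inv := (ginv G).
Local Notation e := (gone G).

Let hK := g_hausdorff G.

Lemma mu_le_compact (A B : set K) : compact A -> compact B -> A `<=` B ->
  (mu A <= mu B)%E.
Proof. by move=> cA cB AB; apply: mu_le => //; exact: compact_borel. Qed.

(** If the powers of some [U] have unbounded measures, the growth hypothesis for
    this [U] gives the sets [D], with its own [omega]. Otherwise the measures of
    the powers of each [U] have a finite supremum [S], hence [omega = 2] is good
    for a power of measure larger than [S / 2], and [U] itself can be chosen
    large. *)
Lemma haar_doubling : ~ compact [set: K] ->
  (forall U : set K, compact U -> nbhs e U ->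
    exists (omega : R) (n : nat -> nat),
      [/\ forall k, (0 < n k)%N, {homo n : i j / (i < j)%N}
        & forall k, (mu (gset_pow G U (2 * n k)) <
                     omega%:E * mu (gset_pow G U (n k)))%E]) ->
  exists omega : R, forall L : R, exists D : set K,
    [/\ compact D, forall x, D x -> D (inv x), (L%:E < mu D)%E
      & (mu (gset_mul G D D) <= omega%:E * mu D)%E].
Proof.
move=> ncK gr.
have [[U [[cU Ue symU] Uunb]]|bnd] := pselect (exists U : set K,
    [/\ compact U, nbhs e U & forall x, U x -> U (inv x)] /\
    forall L : R, exists n, (L%:E < mu (gset_pow G U n.+1))%E).
  have [omega [n [n0 nh nP]]] := gr U cU Ue.
  exists omega => L; have [k kL] := Uunb L.
  have nk : (k < n k.+1)%N.
    by elim: k {kL} => [|k IH]; [exact: n0|exact: leq_ltn_trans IH (nh _ _ _)].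
  exists (gset_pow G U (n k.+1)); split.
  - exact: gset_pow_compact.
  - exact: gset_pow_sym.
  - apply: lt_le_trans kL _; apply: mu_le_compact; try exact: gset_pow_compact.
    by apply: gset_pow_sub => //; exact: nbhs_singleton Ue.
  - have := ltW (nP k.+1); congr (mu _ <= _)%E.
    by rewrite mul2n -addnn -[n k.+1]prednK// gset_powD.
exists 2 => L.
have [U0 U0e cU0] := compact_nbhs (g_locally_compact G) e.
have [C cC CL] := haar_unbounded muG (Num.max L 0) ncK.
pose U1 := U0 `|` C; pose U := U1 `|` inv @` U1.
have cU1 : compact U1 by exact: compactU.
have cU : compact U by apply: compactU => //; exact: compact_ginv.
have Ue : nbhs e U by apply: filterS U0e => x U0x; left; left.
have symU x : U x -> U (inv x).
  by move=> [U1x|[y U1y <-]]; [right; exists x|left; rewrite ginvK].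
have [M UM] : exists M : R, forall n, (mu (gset_pow G U n.+1) <= M%:E)%E.
  apply: contrapT => nM; apply: bnd; exists U; split => // M.
  apply: contrapT => nM'; apply: nM; exists M => n.
  by rewrite leNgt; apply/negP => h; apply: nM'; exists n.
pose a n := fine (mu (gset_pow G U n.+1)).
have aE n : mu (gset_pow G U n.+1) = (a n)%:E.
  by rewrite fineK//; apply: (compact_fin_num muG); exact: gset_pow_compact.
have supa : has_sup (range a).
  split; first by exists (a 0%N), 0%N.
  by exists M => _ [n _ <-]; rewrite -lee_fin -aE.
have aS n : a n <= sup (range a) by apply: sup_upper_bound => //; exists n.
have aL n : ((Num.max L 0)%:E < (a n)%:E)%E.
  apply: lt_le_trans CL _; rewrite -aE; apply: mu_le_compact => //.
    exact: gset_pow_compact.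
  apply: (@subset_trans _ U); first by move=> x Cx; left; right.
  by apply: (@gset_pow_sub _ _ _ 1) => //; exact: nbhs_singleton Ue.
have a0 n : 0 < a n.
  by have := aL n; rewrite lte_fin; apply: le_lt_trans; rewrite le_max lexx orbT.
have S0 : 0 < sup (range a) / 2 by rewrite divr_gt0// (lt_le_trans (a0 0%N)).
have [_ [n _ <-] nS] := sup_adherent S0 supa.
exists (gset_pow G U n.+1); split.
- exact: gset_pow_compact.
- exact: gset_pow_sym.
- rewrite aE; apply: le_lt_trans (aL n).
  by rewrite lee_fin le_max lexx.
- rewrite -gset_powD addnS aE aE -EFinM lee_fin.
  have := aS (n.+1 + n)%N; lra.
Qed.

Lemma group_cover (W Z : set K) : open W -> W e -> compact Z ->
  exists l : seq K, Z `<=` \big[setU/set0]_(x <- l) (gmul G (inv x) @^-1` W).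
Proof.
move=> oW We cZ.
have [|||V [oV ZV [l Vl]]] := @compact_ind K (fun U => exists l : seq K,
    U `<=` \big[setU/set0]_(x <- l) (gmul G (inv x) @^-1` W)) Z cZ.
- by exists [::].
- move=> A B [l Al] [l' Bl']; exists (l ++ l'); rewrite big_cat /=.
  exact: setUSS.
- move=> x _; exists (gmul G (inv x) @^-1` W).
    split; last by rewrite /preimage /= gmulVg.
    by apply: open_comp => // y _; exact: gmull_continuous.
  by exists [:: x]; rewrite big_seq1.
by exists l; exact: subset_trans ZV Vl.
Qed.

(** Greedy filling: pieces of measure at most [eps] are added to [X] until the
    next one would exceed [s]. *)
Lemma fill_with_pieces (eps s : R) (D X : set (borel K)) (l : seq (set (borel K))) :
  (forall P, P \in l -> measurable P /\ (mu P <= eps%:E)%E) ->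
  measurable D -> measurable X -> X `<=` D -> (mu X <= s%:E <= mu D)%E ->
  D `<=` X `|` \big[setU/set0]_(P <- l) P ->
  exists Y : set (borel K), [/\ measurable Y, X `<=` Y, Y `<=` D, (mu Y <= s%:E)%E &
    mu Y = s%:E \/ (s%:E < mu Y + eps%:E)%E].
Proof.
move=> + mD; elim: l X => [|P l IH] X lP mX XD /andP[Xs sD] DX.
  have XE : X = D by apply/seteqP; split => //; move: DX; rewrite big_nil setU0.
  exists X; split => //; left; apply/eqP; rewrite eq_le Xs /=.
  by rewrite XE.
have [mP Peps] := lP P (mem_head _ _).
have mDP : measurable (D `&` P) by exact: measurableI.
pose X1 := X `|` (D `&` P).
have mX1 : measurable X1 by exact: measurableU.
have [X1s|sX1] := leP (mu X1) s%:E.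
  have [|||||Y [mY X1Y YD Ys Yeps]] := IH X1.
  - by move=> Q Ql; apply: lP; rewrite inE Ql orbT.
  - by [].
  - by move=> x [/XD//|[]].
  - by rewrite X1s.
  - move=> x Dx; have := DX x Dx; rewrite big_cons.
    by move=> [Xx|[Px|lx]]; [left; left|left; right|right].
  by exists Y; split => // x Xx; apply: X1Y; left.
exists X; split => //; right; apply: lt_le_trans sX1 _.
apply: (@le_trans _ _ (mu X + mu (D `&` P))%E); first exact: measureU2.
by apply: leeD2l; apply: le_trans Peps; apply: mu_le => //; exact: subIsetr.
Qed.

Lemma small_pieces (W Z : set K) : open W -> W e -> compact Z ->
  exists l : seq (set (borel K)),
    (forall P, P \in l -> measurable P /\ mu P = mu W) /\
    Z `<=` \big[setU/set0]_(P <- l) P.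
Proof.
move=> oW We cZ; have [l0 Zl] := group_cover oW We cZ.
exists [seq gmul G (inv x) @^-1` W | x <- l0]; split; last by rewrite big_map.
move=> _ /mapP[x _ ->]; have mW := open_borel oW; split.
  by apply: continuous_preimage_borel => //; exact: gmull_continuous.
by rewrite (haar_translate muG).
Qed.

Lemma haar_point x : mu [set x] = mu [set e].
Proof.
rewrite -(haar_translate muG (inv x) (borel_set1 hK e)).
congr (mu _); apply/seteqP; split => y /=; rewrite /preimage /=.
  by move=> ->; rewrite gmulVg.
by move=> /(congr1 (gmul G x)); rewrite gmulVK gmulg1.
Qed.

Lemma point_neighborhood (eps : \bar R) : (mu [set e] < eps)%E ->
  exists W : set K, [/\ open W, W e & (mu W < eps)%E].
Proof.
have [[_ outer _] _ _] := muG; rewrite (outer _ (borel_set1 hK e)).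
move=> /ereal_inf_lt[_ [W [oW eW] <-] We]; exists W; split => //; exact: eW.
Qed.

Section ExactSubset.
Variables (B D : set (borel K)) (ZB ZD : set K).
Hypotheses (mB : measurable B) (mD : measurable D) (cB : compact ZB)
  (cD : compact ZD) (BZ : B `<=` ZB) (DZ : D `<=` ZD) (BD : (mu B <= mu D)%E).

Let mZB := compact_borel hK cB.

Let fB : mu B \is a fin_num.
Proof.
rewrite ge0_fin_numE//; apply: le_lt_trans (compact_fin muG cB).
exact: mu_le.
Qed.

Let fill W X : open W -> W e -> mu W \is a fin_num ->
  measurable X -> X `<=` D -> (mu X <= mu B)%E ->
  exists Y : set (borel K), [/\ measurable Y, X `<=` Y, Y `<=` D,
    (mu Y <= mu B)%E & mu Y = mu B \/ (mu B < mu Y + mu W)%E].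
Proof.
move=> oW We fW mX XD XB; have [l [lP Zl]] := small_pieces oW We cD.
have [|||Y] := @fill_with_pieces (fine (mu W)) (fine (mu B)) D X l _ mD mX XD.
- by move=> P /lP[mP ->]; rewrite fineK.
- by rewrite fineK// XB.
- by move=> x /DZ/Zl; right.
by rewrite !fineK//; exists Y.
Qed.

(** Filling with translates of ever smaller neighborhoods of the identity. *)
Let subset_diffuse : mu [set e] = 0%E ->
  exists Y : set (borel K), [/\ measurable Y, Y `<=` D & mu Y = mu B].
Proof.
move=> mue0.
pose T (X : set (borel K)) := [/\ measurable X, X `<=` D & (mu X <= mu B)%E].
have /choice[f fP] : forall p : nat * set (borel K), exists Y : set (borel K),
    T p.2 -> [/\ T Y, p.2 `<=` Y & (mu B <= mu Y + (p.1.+1%:R^-1)%:E)%E].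
  move=> [k X] /=; have [[mX XD XB]|nT] := pselect (T X); last by exists X.
  have [|W [oW We Wk]] := @point_neighborhood (k.+1%:R^-1)%:E.
    by rewrite mue0 lte_fin invr_gt0.
  have fW : mu W \is a fin_num by rewrite ge0_fin_numE// (lt_trans Wk) ?ltry.
  have [Y [mY XY YD YB Yk]] := fill oW We fW mX XD XB.
  exists Y => _; split => //; case: Yk => [->|Yk].
    by rewrite leeDl// lee_fin.
  by apply: (le_trans (ltW Yk)); apply: leeD2l; exact: ltW.
pose fix u k := if k is k'.+1 then f (k', u k') else set0.
have uT k : T (u k).
  elim: k => [|k IH]; first by split; [exact: measurable0|exact: sub0set|rewrite measure0].
  by have [] := fP (k, u k) IH.
have uS k : u k `<=` u k.+1 by have [] := fP (k, u k) (uT k).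
have uB k : (mu B <= mu (u k.+1) + (k.+1%:R^-1)%:E)%E.
  by have [] := fP (k, u k) (uT k).
have mu_ k : measurable (u k) by have [] := uT k.
have mU : measurable (\bigcup_k u k) by exact: bigcup_measurable.
exists (\bigcup_k u k); split => //.
  by move=> x [k _]; have [_ + _] := uT k; apply.
apply/eqP; rewrite eq_le; apply/andP; split.
  have ucv : mu \o u @ \oo --> mu (\bigcup_k u k).
    apply: nondecreasing_cvg_mu => //.
    by apply/nondecreasing_seqP => n; apply/subsetPset.
  rewrite -(cvg_lim (@ereal_hausdorff R) ucv).
  apply: lime_le; first by apply/cvg_ex; exists (mu (\bigcup_k u k)).
  by apply: nearW => k; have [] := uT k.
apply/lee_addgt0Pr => eps eps0.
have [k ke] : exists k : nat, k.+1%:R^-1 < eps.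
  have := @near_infty_natSinv_lt R (PosNum eps0) => -[k _ kP].
  by exists k; apply: kP => /=.
apply: (le_trans (uB k)); apply: leeD; last by rewrite lee_fin ltW.
by apply: mu_le => // x ux; exists k.+1.
Qed.

(** Points are open and have the same measure [c], so all measures are multiples
    of [c] and filling with points stops at the exact value. *)
Let subset_discrete : (0 < mu [set e])%E ->
  exists Y : set (borel K), [/\ measurable Y, Y `<=` D & mu Y = mu B].
Proof.
move=> c0.
have fc : mu [set e] \is a fin_num.
  by apply: (compact_fin_num muG); exact: compact_set1.
pose c := fine (mu [set e]); have cE : mu [set e] = c%:E by rewrite fineK.
have {}c0 : 0 < c by rewrite -lte_fin -cE.
have mup x : mu [set x] = c%:E by rewrite haar_point.
have oe : open [set e].
  have [|W [oW We W2]] := @point_neighborhood (2 * c)%:E.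
    by rewrite cE lte_fin; lra.
  suff <- : W = [set e] by [].
  apply/seteqP; split => [y Wy /=|_ ->//]; apply: contrapT => ye.
  move: W2; apply/negP; rewrite -leNgt.
  apply: (@le_trans _ _ (mu ([set e] `|` [set y]))).
    rewrite measureU; [|exact: borel_set1|exact: borel_set1|].
      by have -> : (2 * c)%:E = (c%:E + c%:E)%E; [rewrite -EFinD; congr _%:E; lra|
        apply: leeD; [rewrite -(mup e)|rewrite -(mup y)]].
    by rewrite -subset0 => _ [/= -> /esym].
  apply: mu_le; [by apply: measurableU; exact: borel_set1|exact: open_borel|].
  by move=> _ [->|->].
have multiple (X : set (borel K)) (Z : set K) : measurable X -> compact Z ->
    X `<=` Z -> exists k : nat, mu X = (k%:R * c)%:E.
  move=> + cZ XZ0; have [l Zl] := group_cover oe erefl cZ.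
  move: (subset_trans XZ0 Zl); elim: l X {XZ0 Zl} => [|x l IH] X XZ mX.
    exists 0%N; rewrite mul0r (_ : X = set0) ?measure0//.
    by move: XZ; rewrite big_nil subset0.
  have mx : measurable ([set x] : set (borel K)) by exact: borel_set1.
  have mX1 : measurable (X `\ x) by exact: measurableD.
  have [|k kE] := IH (X `\ x) _ mX1.
    move=> y [Xy yx]; have := XZ y Xy; rewrite big_cons => -[|//].
    move=> /(congr1 (gmul G x)); rewrite gmulVK gmulg1 => yx'.
    by case: yx.
  have [Xx|nXx] := pselect (X x); last first.
    by exists k; rewrite -kE; congr (mu _); rewrite not_setD1.
  have E : mu X = (mu [set x] + mu (X `\ x))%E.
    rewrite -{1}(setD1K Xx) measureU//.
    by rewrite setDE setICA setICr setI0.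
  by exists k.+1; rewrite E (mup x) kE -EFinD; congr _%:E; rewrite -natr1; ring.
have [|Y [mY _ YD YB YBc]] := fill oe erefl fc measurable0 (@sub0set _ _).
  by rewrite measure0.
exists Y; split => //; case: YBc => // YBc.
have [k kE] := multiple Y ZD mY cD (subset_trans YD DZ).
have [j jE] := multiple B ZB mB cB BZ.
move: YB YBc; rewrite kE jE cE -EFinD lee_fin lte_fin => kj jk.
congr (_ * _)%:E; congr _%:R; apply/eqP; rewrite eqn_leq.
move: kj jk; rewrite ler_pM2r// ler_nat => -> /=.
have -> : k%:R * c + c = k.+1%:R * c by rewrite -natr1; ring.
by rewrite ltr_pM2r// ltr_nat ltnS.
Qed.

(** Haar measure is either diffuse or a multiple of the counting measure; in
    both cases a set has subsets of every smaller measure that occurs. *)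
Lemma subset_of_measure :
  exists Y : set (borel K), [/\ measurable Y, Y `<=` D & mu Y = mu B].
Proof.
have [|] := leP (mu [set e]) 0%E; last exact: subset_discrete.
by rewrite measure_le0 => /eqP; exact: subset_diffuse.
Qed.

End ExactSubset.

End Growth.

(** * Fubini inequality for continuous kernels with compact support *)

Section FubiniCompact.
Context (R : realType) (K : ptopologicalType) (hK : hausdorff_space K).
Context (mu : {measure set (borel K) -> \bar R}).
Hypothesis mu_compact : forall C : set K, compact C -> (mu C < +oo)%E.
Local Open Scope ereal_scope.

Lemma compact_bound (f : K -> R) (Z : set K) : continuous f -> compact Z ->
  exists2 M : R, (0 <= M)%R & forall x, Z x -> (f x <= M)%R.
Proof.
move=> cf cZ.
have : compact (f @` Z).
  by apply: continuous_compact => //; exact: continuous_subspaceT.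
move=> /compact_bounded[M [_ MP]].
exists (`|M| + 1)%R; first by rewrite addr_ge0.
move=> x Zx; apply: le_trans (ler_norm _) _.
apply: (MP (`|M| + 1)%R); last by exists x.
by rewrite (le_lt_trans (ler_norm _))// ltrDl.
Qed.

Lemma integral_compact_fin (f : K -> R) (Z : set K) (E : set (borel K)) :
  continuous f -> (forall x, 0 <= f x)%R -> compact Z ->
  (forall x, f x != 0 -> Z x)%R -> measurable E ->
  \int[mu]_(x in E) (f x)%:E \is a fin_num.
Proof.
move=> cf f0 cZ fZ mE.
have mZ : measurable (Z : set (borel K)) by exact: compact_borel.
have mf (A : set (borel K)) : measurable_fun A (EFin \o f).
  by apply: (@measurable_funS _ _ _ _ setT) => //; apply/measurable_EFinP; exact: continuous_borel.
have [M M0 fM] := compact_bound cf cZ.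
rewrite ge0_fin_numE; last by apply: integral_ge0 => x _; rewrite lee_fin.
apply: (@le_lt_trans _ _ (\int[mu]_(x in E) (M%:E * (\1_Z x)%:E))).
  apply: ge0_le_integral => //.
  - by move=> x _; rewrite lee_fin.
  - by apply: measurable_funeM; apply/measurable_EFinP; exact: measurable_indic.
  - move=> x _; rewrite -EFinM lee_fin indicE.
    have [Zx|nZx] := pselect (Z x); first by rewrite mem_set// mulr1 fM.
    have -> : f x = 0%R by apply/eqP; apply: contra_notT nZx => /fZ.
    by rewrite memNset// mulr0.
rewrite ge0_integralZl//.
- rewrite integral_indic//; apply: lte_mul_pinfty; rewrite ?lee_fin//.
  by apply: le_lt_trans (mu_compact cZ); apply: mu_le => //; exact: measurableI.
- by apply/measurable_EFinP; exact: measurable_indic.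
Qed.

Section Kernel.
Variables (F : K -> K -> R) (Z2 : set K).
Hypotheses (cF : continuous (fun p : K * K => F p.1 p.2))
  (F0 : forall x y, (0 <= F x y)%R) (cZ2 : compact Z2)
  (F2 : forall x y, F x y != 0%R -> Z2 y).

Lemma kernel_continuousr x : continuous (F x).
Proof.
move=> y; apply: (@continuous_comp _ _ _ (fun z => (x, z)) (fun p => F p.1 p.2)).
  by apply: cvg_pair => /=; [exact: cvg_cst|exact: cvg_id].
exact: cF.
Qed.

Lemma kernel_continuousl y : continuous (F ^~ y).
Proof.
move=> x; apply: (@continuous_comp _ _ _ (fun z => (z, y)) (fun p => F p.1 p.2)).
  by apply: cvg_pair => /=; [exact: cvg_id|exact: cvg_cst].
exact: cF.
Qed.

(** The tube lemma. The indicator makes the error integrable in [y]. *)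
Lemma kernel_equicontinuous (x0 : K) (eps : R) : (0 < eps)%R ->
  nbhs x0 [set x | forall y, (`|F x0 y - F x y| <= eps * \1_Z2 y)%R].
Proof.
move=> eps0.
have h : \forall x \near x0, Z2 `<=` [set y | (`|F x0 y - F x y| <= eps)%R].
  apply: ((compact_near_coveringP Z2).1 cZ2 K (nbhs x0)
    (fun x y => (`|F x0 y - F x y| <= eps)%R)) => y _.
  have h : \forall p \near (x0, y), (`|F x0 y - F p.1 p.2| < eps / 2)%R.
    have cFxy : (fun p : K * K => F p.1 p.2) @ (x0, y) --> F x0 y.
      by have := cF; move=> /(_ (x0, y)).
    by move/cvgrPdist_lt : cFxy; apply; rewrite divr_gt0.
  case: h => -[A B] /= [Ax By] AB.
  exists (B, A) => //= -[y' x] /= [By' Ax'].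
  have := AB (x, y') (conj Ax' By'); have := AB (x0, y') (conj (nbhs_singleton Ax) By').
  rewrite /= !ltr_distl ler_distl => /andP[h1 h2] /andP[h3 h4].
  by apply/andP; split; lra.
apply: filterS h => x hx y; rewrite indicE.
have [Zy|nZy] := pselect (Z2 y); first by rewrite mem_set// mulr1; exact: hx.
have F00 z : F z y = 0%R by apply/eqP; apply: contra_notT nZy => /F2.
by rewrite !F00 subrr normr0 memNset// mulr0.
Qed.

Let measurable_kernel x (E : set (borel K)) : measurable_fun E (fun y => (F x y)%:E).
Proof.
apply: (@measurable_funS _ _ _ _ setT) => //; apply/measurable_EFinP.
by apply: continuous_borel; exact: kernel_continuousr.
Qed.

Let kernel_int_le (E : set (borel K)) (b : R) x y : measurable E -> (0 <= b)%R ->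
  (forall t, (F x t <= F y t + b * \1_Z2 t)%R) ->
  \int[mu]_(t in E) (F x t)%:E <= \int[mu]_(t in E) (F y t)%:E + b%:E * mu Z2.
Proof.
move=> mE b0 Fxy.
have mZ2 : measurable (Z2 : set (borel K)) by exact: compact_borel.
have mI (A : set (borel K)) : measurable_fun A (fun t => (\1_Z2 t : R)%:E).
  by apply/measurable_EFinP; exact: measurable_indic.
apply: (@le_trans _ _ (\int[mu]_(t in E) ((F y t)%:E + b%:E * (\1_Z2 t)%:E))).
  apply: ge0_le_integral => //.
  - by move=> t _; rewrite lee_fin.
  - by apply: emeasurable_funD => //; exact: measurable_funeM.
  - by move=> t _; rewrite -EFinM -EFinD lee_fin.
rewrite ge0_integralD//.
- apply: leeD2l; rewrite ge0_integralZl// integral_indic//.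
  apply: lee_wpmul2l; first by rewrite lee_fin.
  by apply: mu_le => //; exact: measurableI.
- by move=> t _; rewrite lee_fin.
- by move=> t _; rewrite mule_ge0 ?lee_fin.
- exact: measurable_funeM.
Qed.

Lemma kernel_integral_fin x (E : set (borel K)) : measurable E ->
  \int[mu]_(y in E) (F x y)%:E \is a fin_num.
Proof.
move=> mE; apply: (integral_compact_fin (Z := Z2)) => //.
- exact: kernel_continuousr.
- exact: F2.
Qed.

Lemma kernel_integral_continuous (E : set (borel K)) : measurable E ->
  continuous (fun x => fine (\int[mu]_(y in E) (F x y)%:E)).
Proof.
move=> mE x0; apply/cvgrPdist_le => eps eps0.
have z2f : mu Z2 \is a fin_num by rewrite ge0_fin_numE// mu_compact.
pose z2 := fine (mu Z2); have z2E : mu Z2 = z2%:E by rewrite fineK.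
have z20 : (0 <= z2)%R by exact: fine_ge0.
have d0 : (0 < eps / (z2 + 1))%R by rewrite divr_gt0// ltr_wpDl.
have dz : (eps / (z2 + 1) * z2 <= eps)%R.
  by rewrite mulrAC ler_pdivrMr ?ltr_wpDl// ler_pM2l// lerDl.
apply: filterS (kernel_equicontinuous x0 d0) => x /= hx.
have h1 : \int[mu]_(t in E) (F x t)%:E <=
    \int[mu]_(t in E) (F x0 t)%:E + (eps / (z2 + 1))%:E * mu Z2.
  apply: kernel_int_le => //; first exact: ltW.
  by move=> t; have := hx t; rewrite ler_distl => /andP[]; lra.
have h2 : \int[mu]_(t in E) (F x0 t)%:E <=
    \int[mu]_(t in E) (F x t)%:E + (eps / (z2 + 1))%:E * mu Z2.
  apply: kernel_int_le => //; first exact: ltW.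
  by move=> t; have := hx t; rewrite ler_distl => /andP[]; lra.
move: h1 h2; rewrite -(fineK (kernel_integral_fin x mE)).
rewrite -(fineK (kernel_integral_fin x0 mE)) z2E -EFinM -!EFinD !lee_fin => h1 h2.
by rewrite ler_distl; apply/andP; split; lra.
Qed.

Lemma kernel_integral_measurable (E A : set (borel K)) : measurable E ->
  measurable_fun A (fun x => \int[mu]_(y in E) (F x y)%:E).
Proof.
move=> mE; rewrite (_ : (fun x => _) =
    EFin \o (fun x => fine (\int[mu]_(y in E) (F x y)%:E))); last first.
  by apply/funext => x /=; rewrite fineK// kernel_integral_fin.
apply: (@measurable_funS _ _ _ _ setT) => //; apply/measurable_EFinP.
by apply: continuous_borel; exact: kernel_integral_continuous.
Qed.

End Kernel.

Section Fubini.
Variables (F : K -> K -> R) (Z1 Z2 : set K).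
Hypotheses (cF : continuous (fun p : K * K => F p.1 p.2))
  (F0 : forall x y, (0 <= F x y)%R) (cZ1 : compact Z1) (cZ2 : compact Z2)
  (F1 : forall x y, F x y != 0%R -> Z1 x) (F2 : forall x y, F x y != 0%R -> Z2 y).

Let cFs : continuous (fun p : K * K => F p.2 p.1).
Proof.
move=> p; apply: (@continuous_comp _ _ _ (fun q : K * K => (q.2, q.1)) (fun p => F p.1 p.2)).
  by apply: cvg_pair => /=; [exact: cvg_snd|exact: cvg_fst].
exact: cF.
Qed.

Let yx (E : set (borel K)) := \int[mu]_(x in E) \int[mu]_y (F x y)%:E.
Let xy (E : set (borel K)) := \int[mu]_y \int[mu]_(x in E) (F x y)%:E.

Let mZ1 : measurable (Z1 : set (borel K)). Proof. exact: compact_borel. Qed.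
Let mZ2 : measurable (Z2 : set (borel K)). Proof. exact: compact_borel. Qed.

Let mFr x (E : set (borel K)) : measurable_fun E (fun y => (F x y)%:E).
Proof.
apply: (@measurable_funS _ _ _ _ setT) => //; apply/measurable_EFinP.
by apply: continuous_borel; exact: kernel_continuousr.
Qed.

Let mFl y (E : set (borel K)) : measurable_fun E (fun x => (F x y)%:E).
Proof.
apply: (@measurable_funS _ _ _ _ setT) => //; apply/measurable_EFinP.
by apply: continuous_borel; exact: kernel_continuousl.
Qed.

Let mfyx (E : set (borel K)) : measurable_fun E (fun x => \int[mu]_y (F x y)%:E).
Proof. exact: (kernel_integral_measurable cF F0 cZ2 F2). Qed.

Let mfxy (E D : set (borel K)) : measurable E ->
  measurable_fun D (fun y => \int[mu]_(x in E) (F x y)%:E).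
Proof.
move=> mE.
by apply: (@kernel_integral_measurable (fun y x => F x y) Z1 cFs _ cZ1) => // y x; exact: F1.
Qed.

Let F0E x y : 0 <= (F x y)%:E. Proof. by rewrite lee_fin. Qed.
Hint Resolve F0E : core.

Let yxU (E E' : set (borel K)) : measurable E -> measurable E' ->
  [disjoint E & E'] -> yx (E `|` E') = yx E + yx E'.
Proof.
move=> mE mE' EE'; rewrite /yx ge0_integral_setU//.
by move=> x _; apply: integral_ge0.
Qed.

Let xyU (E E' : set (borel K)) : measurable E -> measurable E' ->
  [disjoint E & E'] -> xy (E `|` E') = xy E + xy E'.
Proof.
move=> mE mE' EE'; rewrite /xy -ge0_integralD//.
- by apply: eq_integral => y _; rewrite ge0_integral_setU.
- by move=> x _; apply: integral_ge0.
- exact: mfxy.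
- by move=> x _; apply: integral_ge0.
- exact: mfxy.
Qed.

Let z1 := fine (mu Z1).
Let z2 := fine (mu Z2).
Let z1E : mu Z1 = z1%:E.
Proof. by rewrite fineK// ge0_fin_numE// mu_compact. Qed.
Let z2E : mu Z2 = z2%:E.
Proof. by rewrite fineK// ge0_fin_numE// mu_compact. Qed.

(** On a set [E] where [F] varies by at most [eps] in [x], both iterated
    integrals are close to the measure of [E] times the integral of [F x0]. *)
Let fubini_local (eps : R) (x0 : K) (E : set (borel K)) : (0 < eps)%R ->
  measurable E -> E `<=` Z1 ->
  (forall x, E x -> forall y, `|F x0 y - F x y| <= eps * \1_Z2 y)%R ->
  yx E <= xy E + (2 * eps * z2)%:E * mu E.
Proof.
move=> eps0 mE EZ FE.
have fE : mu E \is a fin_num.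
  rewrite ge0_fin_numE// (@le_lt_trans _ _ (mu Z1))//; last exact: mu_compact.
  exact: mu_le.
pose m := fine (mu E); have mEE : mu E = m%:E by rewrite fineK.
have m0 : (0 <= m)%R by exact: fine_ge0.
have I0 : \int[mu]_y (F x0 y)%:E \is a fin_num.
  exact: (kernel_integral_fin cF F0 cZ2 F2).
pose I := fine (\int[mu]_y (F x0 y)%:E).
have IE : \int[mu]_y (F x0 y)%:E = I%:E by rewrite fineK.
have mI c : measurable_fun [set: borel K] (fun t => c%:E * (\1_Z2 t : R)%:E).
  by apply: measurable_funeM; apply/measurable_EFinP; exact: measurable_indic.
have intI (c : R) : (0 <= c)%R ->
    \int[mu]_t (c%:E * (\1_Z2 t : R)%:E) = (c * z2)%:E.
  move=> c0; rewrite ge0_integralZl//.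
  - by rewrite integral_indic// setIT z2E.
  - by apply/measurable_EFinP; exact: measurable_indic.
have le1 : yx E <= ((I + eps * z2) * m)%:E.
  rewrite EFinM -mEE -integral_cst//; apply: ge0_le_integral => //.
  - by move=> x _; exact: integral_ge0.
  - move=> x Ex; rewrite /= EFinD -IE -intI; last exact: ltW.
    rewrite -ge0_integralD//; last first.
      by move=> y _; rewrite -EFinM lee_fin mulr_ge0// ltW.
    apply: ge0_le_integral => //; first by apply: emeasurable_funD.
    move=> y _; rewrite -EFinM -EFinD lee_fin.
    by have := FE x Ex y; rewrite ler_distl => /andP[]; lra.
have le2 : (m * I)%:E <= xy E + (m * eps * z2)%:E.
  rewrite EFinM -IE -ge0_integralZl// -intI ?mulr_ge0 ?(ltW eps0)//.
  rewrite /xy -ge0_integralD//; last 3 first.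
  - by move=> y _; exact: integral_ge0.
  - exact: mfxy.
  - by move=> y _; rewrite -EFinM lee_fin !mulr_ge0// ltW.
  apply: ge0_le_integral => //.
  - by move=> y _; rewrite -EFinM lee_fin mulr_ge0.
  - exact: measurable_funeM.
  - by apply: emeasurable_funD => //; exact: mfxy.
  move=> y _.
  apply: (@le_trans _ _ (\int[mu]_(x in E) ((F x y)%:E + (eps * \1_Z2 y)%:E))).
    rewrite muleC -mEE -integral_cst//; apply: ge0_le_integral => //.
    - by move=> x _; exact: F0E.
    - by apply: emeasurable_funD.
    - move=> x Ex /=; rewrite -EFinD lee_fin.
      by have := FE x Ex y; rewrite ler_distl => /andP[]; lra.
  rewrite ge0_integralD//; last first.
    by move=> x _; rewrite lee_fin mulr_ge0// ltW.
  by rewrite (integral_cst mu mE) mEE -!EFinM mulrC mulrA.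
apply: (le_trans le1).
have -> : ((I + eps * z2) * m)%:E = (m * I)%:E + (eps * z2 * m)%:E.
  by rewrite -EFinD; congr _%:E; ring.
apply: (le_trans (leeD2r _ le2)).
rewrite -addeA; apply: leeD2l; rewrite mEE -EFinM -EFinD lee_fin.
by rewrite le_eqVlt; apply/orP; left; apply/eqP; ring.
Qed.

(** The product of two Borel sigma-algebras may be smaller than the Borel
    sigma-algebra of the product, so the inequality is obtained directly: both
    iterated integrals are additive in the set where [x] ranges, which can be
    cut into finitely many sets to which [fubini_local] applies. *)
Lemma fubini_compact_le :
  \int[mu]_x \int[mu]_y (F x y)%:E <= \int[mu]_y \int[mu]_x (F x y)%:E.
Proof.
have yxT : \int[mu]_x \int[mu]_y (F x y)%:E = yx Z1.
  rewrite /yx [RHS]integral_mkcond; apply: eq_integral => x _.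
  rewrite patchE; case: ifPn => // /negP nZ.
  rewrite (eq_integral (cst 0)) ?integral_cst ?mul0e// => y _.
  by congr _%:E; apply/eqP; apply: contra_notT nZ => /F1; rewrite inE.
have xyT : \int[mu]_y \int[mu]_x (F x y)%:E = xy Z1.
  rewrite /xy; apply: eq_integral => y _; rewrite [RHS]integral_mkcond.
  apply: eq_integral => x _; rewrite patchE; case: ifPn => // /negP nZ.
  by congr _%:E; apply/eqP; apply: contra_notT nZ => /F1; rewrite inE.
rewrite yxT xyT.
have main (eps : R) : (0 < eps)%R -> yx Z1 <= xy Z1 + (2 * eps * z2)%:E * mu Z1.
  move=> eps0.
  have [|||U [oU ZU [mU PU]]] := @compact_ind K (fun U =>
     measurable (U : set (borel K)) /\
     forall E : set (borel K), measurable E -> E `<=` U -> E `<=` Z1 ->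
       yx E <= xy E + (2 * eps * z2)%:E * mu E) Z1 cZ1.
  - split; first exact: measurable0.
    move=> E _; rewrite subset0 => -> _.
    rewrite /yx integral_set0 measure0 mule0 adde0 /xy.
    by apply: integral_ge0 => *; rewrite integral_set0.
  - move=> U U' [mU PU] [mU' PU']; split; first exact: measurableU.
    move=> E mE EU EZ.
    have EE : E = (E `&` U) `|` (E `\` U) by rewrite setUIDK.
    have m1 : measurable (E `&` U) by exact: measurableI.
    have m2 : measurable (E `\` U) by exact: measurableD.
    have dis : [disjoint E `&` U & E `\` U].
      by rewrite disj_set2E; apply/eqP; rewrite -subset0 => x [[_ Ux] []].
    rewrite EE yxU// xyU// measureU//; last first.
      by move: dis; rewrite disj_set2E => /eqP.
    have h1 : yx (E `&` U) <= xy (E `&` U) + (2 * eps * z2)%:E * mu (E `&` U).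
      by apply: PU => // x [] // /EZ.
    have h2 : yx (E `\` U) <= xy (E `\` U) + (2 * eps * z2)%:E * mu (E `\` U).
      by apply: PU' => // [x [/EU[]//]|x [/EZ]].
    apply: (le_trans (leeD h1 h2)); rewrite ge0_muleDr//.
    by move: (xy _) (xy _) (_ * _) (_ * _) => a b c d; rewrite addeACA.
  - move=> x0 _; have := kernel_equicontinuous cF cZ2 F2 x0 eps0.
    rewrite nbhsE => -[U [oU Ux] UF]; exists U => //.
    split; first exact: open_borel.
    by move=> E mE EU EZ; apply: (fubini_local eps0 mE EZ) => x /EU /UF.
  exact: PU.
apply/lee_addgt0Pr => eps eps0.
have z10 : (0 <= z1)%R by exact: fine_ge0.
have z20 : (0 <= z2)%R by exact: fine_ge0.
have d0 : (0 < eps / (2 * z2 * z1 + 1))%R.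
  by rewrite divr_gt0// ltr_wpDl// !mulr_ge0.
apply: (le_trans (main _ d0)); apply: leeD2l.
rewrite z1E -EFinM lee_fin.
have -> : (2 * (eps / (2 * z2 * z1 + 1)) * z2 * z1 =
  eps * (2 * z2 * z1) / (2 * z2 * z1 + 1))%R by ring.
rewrite ler_pdivrMr ?ltr_wpDl ?mulr_ge0// ler_pM2l// lerDl //.
Qed.

End Fubini.
End FubiniCompact.

(** * Haar measure and inversion *)

Section HaarInverse.
Context (R : realType) (K : ptopologicalType) (G : lc_group K).
Context (mu : {measure set (borel K) -> \bar R}) (muG : left_invariant G mu).
Local Notation "x ** y" := (gmul G x y) (at level 40, left associativity).
Local Notation inv := (ginv G).
Local Notation e := (gone G).
Local Open Scope ereal_scope.

Let hK := g_hausdorff G.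
Let mu_compact (C : set K) : compact C -> mu C < +oo.
Proof. exact: (compact_fin muG). Qed.

Let u_kernel_continuous (u v : K -> R) : continuous u -> continuous v ->
  continuous (fun p : K * K => u p.1 * v (inv p.2 ** p.1))%R.
Proof.
move=> cu cv p; apply: cvgM.
  by apply: (@continuous_comp _ _ _ fst u); [exact: cvg_fst|exact: cu].
apply: (@continuous_comp _ _ _ (fun p : K * K => inv p.2 ** p.1) v); last exact: cv.
apply: (@continuous_comp _ _ _ (fun p : K * K => (inv p.2, p.1)) (fun p => p.1 ** p.2)).
  apply: cvg_pair => /=; last exact: cvg_fst.
  by apply: (@continuous_comp _ _ _ snd inv); [exact: cvg_snd|exact: ginv_continuous].
exact: (@gmul_continuous _ G).
Qed.

Let v_kernel_continuous (u v : K -> R) : continuous u -> continuous v ->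
  continuous (fun p : K * K => u (p.1 ** p.2) * v p.2)%R.
Proof.
move=> cu cv p; apply: cvgM.
  apply: (@continuous_comp _ _ _ (fun p : K * K => p.1 ** p.2) u); last exact: cu.
  exact: (@gmul_continuous _ G).
by apply: (@continuous_comp _ _ _ snd v); [exact: cvg_snd|exact: cv].
Qed.

(** The classical computation behind the modular function: the left-hand side is
    the double integral of [u x * v (inv y ** x)]; exchanging the variables,
    replacing [x] by [y ** x] and exchanging them again gives the integral of
    [v x] times that of [y |-> u (y ** x)], which is at most the measure of the
    set supporting it. *)
Lemma inverse_integral_le (u v : K -> R) (S Z : set K) : compact S -> compact Z ->
  Cc_plus R K u -> Cc_plus R K v ->
  (forall x, u x <= 1)%R -> (forall x, u x != 0%R -> S x) ->
  (forall x, v x != 0%R -> Z x) ->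
  \int[mu]_x (u x)%:E * \int[mu]_y (v (inv y))%:E <=
  mu (gset_mul G S (inv @` Z)) * \int[mu]_x (v x)%:E.
Proof.
move=> cS cZ Cu Cv u1 uS vZ; have [cu u0 _] := Cu; have [cv v0 _] := Cv.
have [_ _ inv_mu] := muG.
pose SZ := gset_mul G S (inv @` Z).
have cSZ : compact SZ by apply: compact_gset_mul => //; exact: compact_ginv.
have mSZ : measurable (SZ : set (borel K)) by exact: compact_borel.
have mc (f : K -> R) : continuous f -> measurable_fun [set: borel K] (fun x => (f x)%:E).
  by move=> cf; apply/measurable_EFinP; exact: continuous_borel.
have cvi : continuous (v \o inv).
  by move=> y; apply: (@continuous_comp _ _ _ inv v); [exact: ginv_continuous|exact: cv].
have invZ y : v (inv y) != 0%R -> (inv @` Z) y.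
  by move=> /vZ Zy; exists (inv y) => //; rewrite ginvK.
have Cvi : Cc_plus R K (v \o inv).
  by apply: (Cc_plus_support hK (Z := inv @` Z)) => //; [move=> x; exact: v0|exact: compact_ginv].
have s1 x : \int[mu]_y (v (inv y))%:E = \int[mu]_y (v (inv y ** x))%:E.
  rewrite (inv_mu (inv x) _ Cvi); apply: eq_integral => y _ /=.
  by rewrite ginvM ginvK.
pose F1 x y := (u x * v (inv y ** x))%R.
have F1S x y : F1 x y != 0%R -> S x /\ SZ y.
  rewrite /F1 mulf_eq0 negb_or => /andP[/uS Sx /vZ Zy]; split => //.
  exists x => //; exists (inv (inv y ** x)); first by exists (inv y ** x).
  by rewrite ginvM ginvK gmulVK.
have F10 x y : (0 <= F1 x y)%R by rewrite mulr_ge0.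
pose F2 y x := (u (y ** x) * v x)%R.
have F2S y x : F2 y x != 0%R -> SZ y /\ Z x.
  rewrite /F2 mulf_eq0 negb_or => /andP[/uS Sx /vZ Zy]; split => //.
  exists (y ** x) => //; exists (inv x); first by exists x.
  by rewrite -gmulA gmulgV gmulg1.
have F20 x y : (0 <= F2 x y)%R by rewrite mulr_ge0.
have cF1 : continuous (fun p : K * K => F1 p.1 p.2) by exact: u_kernel_continuous.
have cF2 : continuous (fun p : K * K => F2 p.1 p.2) by exact: v_kernel_continuous.
have e1 : \int[mu]_x (u x)%:E * \int[mu]_y (v (inv y))%:E =
    \int[mu]_x \int[mu]_y (F1 x y)%:E.
  rewrite -ge0_integralZr//.
  - apply: eq_integral => x _; rewrite (s1 x) -ge0_integralZl//.
    + apply: mc => y; apply: (@continuous_comp _ _ _ (fun y => inv y ** x) v); last exact: cv.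
      apply: (@continuous_comp _ _ _ inv (fun y => y ** x)); first exact: ginv_continuous.
      exact: gmulr_continuous.
    + by move=> y _; rewrite lee_fin.
    + by rewrite lee_fin.
  - exact: mc.
  - by move=> x _; rewrite lee_fin.
  - by apply: integral_ge0 => x _; rewrite lee_fin.
have e2 : \int[mu]_x \int[mu]_y (F1 x y)%:E <= \int[mu]_y \int[mu]_x (F1 x y)%:E.
  by apply: (fubini_compact_le hK mu_compact cF1 F10 cS cSZ) => x y /F1S[].
have e3 : \int[mu]_y \int[mu]_x (F1 x y)%:E = \int[mu]_y \int[mu]_x (F2 y x)%:E.
  apply: eq_integral => y _.
  have CF : Cc_plus R K (F1 ^~ y).
    apply: (Cc_plus_support hK (Z := S)) => //; last by move=> x /F1S[].
    exact: (kernel_continuousl cF1).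
  rewrite (inv_mu y _ CF); apply: eq_integral => x _.
  by rewrite /F1 /F2 gmulK.
have e4 : \int[mu]_y \int[mu]_x (F2 y x)%:E <= \int[mu]_x \int[mu]_y (F2 y x)%:E.
  by apply: (fubini_compact_le hK mu_compact cF2 F20 cSZ cZ) => x y /F2S[].
rewrite e1 (le_trans e2)// e3 (le_trans e4)//.
rewrite -ge0_integralZl//; last 2 first.
- exact: mc.
- by move=> x _; rewrite lee_fin.
apply: le_lower_integral => x; first by apply: integral_ge0 => y _; rewrite lee_fin.
rewrite muleC (mu_indic mu mSZ) -ge0_integralZl//; last 2 first.
- by apply/measurable_EFinP; exact: measurable_indic.
- by rewrite lee_fin.
apply: le_lower_integral => y; rewrite -?EFinM lee_fin//.
have [SZy|nSZy] := pselect (SZ y).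
  by rewrite indicE mem_set// mulr1 /F2 -[leRHS]mul1r ler_wpM2r.
suff -> : F2 y x = 0%R by rewrite mulr_ge0.
by apply/eqP; apply: contra_notT nSZy => /F2S[].
Qed.

(** Inversion does not preserve Haar measure, but distorts it by a bounded
    factor on compact sets. *)
Lemma haar_inverse (Z : set K) : compact Z -> exists2 M : R, (0 < M)%R &
  forall U : set K, open U -> U `<=` Z -> mu (inv @^-1` U) <= M%:E * mu U.
Proof.
move=> cZ; have [[_ _ inner] muT _] := muG.
have [C [cC C0]] : exists C : set K, compact C /\ 0 < mu C.
  apply: contrapT => nC; move/eqP: muT; apply; apply/eqP.
  rewrite eq_le measure_ge0 andbT inner; last exact: openT.
  apply: ge_ereal_sup => _ [C [cC _] <-]; rewrite leNgt; apply/negP => C0.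
  by apply: nC; exists C.
have [S [oS CS [Y cY SY]]] := compact_thicken (g_locally_compact G) cC.
have [u [Cu u1 uC uS]] := urysohn_compact hK (g_locally_compact G) R cC oS CS.
have [cu u0 _] := Cu.
have uY x : u x != 0%R -> Y x by move=> /uS/SY.
pose SZ := gset_mul G Y (inv @` Z).
have cSZ : compact SZ by apply: compact_gset_mul => //; exact: compact_ginv.
have mC := compact_borel hK cC.
have Iu : \int[mu]_x (u x)%:E \is a fin_num.
  exact: (integral_compact_fin hK mu_compact cu u0 cY uY measurableT).
have Iu0 : 0 < \int[mu]_x (u x)%:E.
  apply: (lt_le_trans C0); rewrite (mu_indic mu mC); apply: le_lower_integral => x.
    by rewrite lee_fin.
  rewrite lee_fin indicE; have [Cx|nCx] := pselect (C x).
    by rewrite mem_set// uC.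
  by rewrite memNset.
pose a := fine (\int[mu]_x (u x)%:E); pose b := fine (mu SZ).
have aE : \int[mu]_x (u x)%:E = a%:E by rewrite fineK.
have bE : mu SZ = b%:E by rewrite fineK// (compact_fin_num muG).
have a0 : (0 < a)%R by rewrite -lte_fin -aE.
have b0 : (0 <= b)%R by rewrite -lee_fin -bE.
exists ((b + 1) / a)%R; first by rewrite divr_gt0// ltr_wpDl.
move=> U oU UZ.
have oV : open (inv @^-1` U) by apply: open_comp => // x _; exact: ginv_continuous.
rewrite (inner _ oV); apply: ge_ereal_sup => _ [D [cD DV] <-].
have cD' : compact (inv @` D) by exact: compact_ginv.
have [|v [Cv v1 vD vU]] := urysohn_compact hK (g_locally_compact G) R cD' oU.
  by move=> _ [x /DV Ux <-].
have [cv v0 _] := Cv.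
have vZ x : v x != 0%R -> Z x by move=> /vU/UZ.
have := inverse_integral_le cY cZ Cu Cv u1 uY vZ.
rewrite -/SZ aE bE => h.
have vleU : \int[mu]_x (v x)%:E <= mu U.
  have mU := open_borel oU; rewrite (mu_indic mu mU); apply: le_lower_integral => x.
    by rewrite lee_fin.
  rewrite lee_fin indicE; have [Ux|nUx] := pselect (U x); first by rewrite mem_set.
  rewrite memNset//; have -> // : v x = 0%R.
  by apply/eqP; apply: contra_notT nUx => /vU.
have Dlev : mu D <= \int[mu]_y (v (inv y))%:E.
  have mD := compact_borel hK cD; rewrite (mu_indic mu mD); apply: le_lower_integral => x.
    by rewrite lee_fin.
  rewrite lee_fin indicE; have [Dx|nDx] := pselect (D x).
    by rewrite mem_set// vD//; exists x.
  by rewrite memNset.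
rewrite -(@lee_pmul2l _ a%:E)//.
apply: (le_trans (lee_wpmul2l _ Dlev)); first by rewrite lee_fin ltW.
apply: (le_trans h).
rewrite muleA -EFinM mulrCA mulfV ?gt_eqF// mulr1.
apply: lee_pmul => //.
- by apply: integral_ge0 => x _; rewrite lee_fin.
- by rewrite lee_fin lerDl.
Qed.

End HaarInverse.

(** * Young functions *)

Section YoungFunctions.
Context (R : realType) (phi : R -> \bar R) (Y : young_function phi).
Local Open Scope ereal_scope.

Let phi0 : phi 0 = 0 := yf_0 Y.
Let phi_ge0 : forall x, 0 <= phi x := yf_ge0 Y.

Lemma young_scale (t x : R) : (0 <= t <= 1)%R -> phi (t * x) <= t%:E * phi x.
Proof.
move=> t01; have := yf_convex Y x 0 t01.
by rewrite mulr0 addr0 phi0 mule0 adde0.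
Qed.

Lemma young_le (x y : R) : (0 <= x)%R -> (x <= y)%R -> phi x <= phi y.
Proof.
move=> x0; rewrite le_eqVlt => /orP[/eqP->//|xy].
have y0 : (0 < y)%R by exact: le_lt_trans xy.
have t01 : (0 <= x / y <= 1)%R.
  by rewrite divr_ge0 ?(ltW y0)//= ler_pdivrMr// mul1r ltW.
have := young_scale y t01; rewrite mulrVK ?unitfE ?gt_eqF// => /le_trans; apply.
have /andP[t0 t1] := t01.
by rewrite -[leRHS]mul1e lee_wpmul2r// lee_fin.
Qed.

Lemma young_large (M : R) : exists2 x : R, (0 < x)%R & M%:E <= phi x.
Proof.
have [x x0 px] := yf_neq0 Y.
have [r r0 rp] : exists2 r : R, (0 < r)%R & r%:E <= phi x.
  have : 0 < phi x by rewrite lt0e phi_ge0 andbT; apply/eqP.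
  case: (phi x) => [r||]//; first by exists r.
  by exists 1%R => //; rewrite leey.
have [k kM] : exists k : nat, (M <= k.+1%:R * r)%R.
  exists (Num.truncn (`|M| / r)).
  rewrite -ler_pdivrMr//; apply: le_trans (ltW (truncnS_gt _)).
  by rewrite ler_pM2r ?invr_gt0// ler_norm.
exists (k.+1%:R * x)%R; first by rewrite mulr_gt0.
have t01 : (0 <= (k.+1%:R : R)^-1 <= 1)%R by rewrite invr_ge0 ler0n/= invf_le1// ler1n.
have := young_scale (k.+1%:R * x) t01; rewrite mulrA mulVf ?mul1r ?pnatr_eq0//.
move=> h; have := le_trans rp h; rewrite lee_pdivlMl// -EFinM.
by apply: le_trans; rewrite lee_fin.
Qed.

Let S (y : R) := [set x : R | (0 <= x)%R /\ phi x <= y%:E].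

Let S_sup (y : R) : (0 <= y)%R -> has_sup (S y).
Proof.
move=> y0; split; first by exists 0%R; rewrite /S /= phi0 lexx lee_fin.
have [x x0 xP] := young_large (y + 1); exists x => z [z0 zP].
rewrite leNgt; apply/negP => xz; have := young_le (ltW x0) (ltW xz).
move=> /(le_trans xP)/le_trans/(_ zP); rewrite lee_fin; lra.
Qed.

Lemma young_inv_ge0 (y : R) : (0 <= y)%R -> (0 <= young_inv phi y)%R.
Proof.
by move=> y0; apply: sup_upper_bound; [exact: S_sup|rewrite /= phi0 lexx lee_fin].
Qed.

Lemma young_inv_lt (y b : R) : (0 <= y)%R -> (0 <= b < young_inv phi y)%R ->
  phi b <= y%:E.
Proof.
move=> y0 /andP[b0 bS]; have [x [x0 xy] bx] := sup_gt (S_sup y0).1 bS.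
exact: le_trans (young_le b0 (ltW bx)) xy.
Qed.

Lemma young_inv_gt (y b : R) : (0 <= y)%R -> (young_inv phi y < b)%R ->
  y%:E < phi b.
Proof.
move=> y0 Sb; rewrite ltNge; apply/negP => by_.
have b0 : (0 <= b)%R by apply: le_trans (ltW Sb); exact: young_inv_ge0.
have : (b <= young_inv phi y)%R by apply: sup_upper_bound; [exact: S_sup|].
by rewrite leNgt Sb.
Qed.

(** Concavity of the inverse, in the form in which it is used. *)
Lemma young_inv_scale (y k : R) : (0 <= y)%R -> (1 <= k)%R ->
  (young_inv phi (k * y) <= k * young_inv phi y)%R.
Proof.
move=> y0 k1; have k0 : (0 < k)%R by exact: lt_le_trans k1.
have ky0 : (0 <= k * y)%R by rewrite mulr_ge0// ltW.
apply: sup_le_ub; first exact: (S_sup ky0).1.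
move=> x [x0 xky]; rewrite mulrC -ler_pdivrMr//.
apply: sup_upper_bound; first exact: S_sup.
split; first by rewrite divr_ge0// ltW.
have t01 : (0 <= k^-1 <= 1)%R by rewrite invr_ge0 (ltW k0)/= invf_le1.
rewrite mulrC; apply: (le_trans (young_scale x t01)).
by rewrite lee_pdivrMl// -EFinM.
Qed.

Lemma young_measurable d (T : measurableType d) (f : T -> R) :
  measurable_fun setT f -> (forall x, 0 <= f x)%R ->
  measurable_fun setT (phi \o f).
Proof.
move=> mf f0; pose psi (t : R) := phi (Num.max t 0%R).
rewrite (_ : phi \o f = psi \o f); last first.
  by apply/funext => x /=; rewrite /psi max_l.
apply: measurableT_comp => //.
apply: (measurability _ (ErealGenOInfty.measurableE R)).
move=> _ [_ [r ->] <-]; rewrite setTI.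
apply: is_interval_measurable => x y /= + _ z /andP[xz _].
rewrite /psi !in_itv /= !andbT => /lt_le_trans; apply.
by apply: young_le; [rewrite le_max lexx orbT|rewrite ge_max !le_max xz lexx !orbT].
Qed.

End YoungFunctions.

(** * Functions measurable for the completed measure *)

Section MeasurableFunctions.
Context (R : realType) (K : ptopologicalType)
        (mu : {measure set (borel K) -> \bar R}).

Local Notation Kbar := (caratheodory_type (mu^*)%mu).
Local Notation mubar := (@completed_measure_extension _ _ _ mu).

Lemma borel_Kbar (A : set (borel K)) : measurable A -> measurable (A : set Kbar).
Proof. exact: caratheodory_measurable_mu_ext. Qed.

Lemma mubarE (A : set (borel K)) : measurable A -> mubar A = mu A.
Proof. exact: measurable_mu_extE. Qed.

Lemma L0_real (r : K -> R) : measurable_fun [set: Kbar] (r : Kbar -> R) ->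
  L0 mu (fun x => (r x)%:C).
Proof. by move=> mr; split => //=. Qed.

Lemma L0_add f g : L0 mu f -> L0 mu g -> L0 mu (fun x => f x + g x).
Proof.
move=> [f1 f2] [g1 g2]; split.
  rewrite (_ : (fun x => _) = (fun x : Kbar => complex.Re (f x) + complex.Re (g x))).
    exact: measurable_funD.
  by apply/funext => x; case: (f x) (g x) => a b [].
rewrite (_ : (fun x => _) = (fun x : Kbar => complex.Im (f x) + complex.Im (g x))).
  exact: measurable_funD.
by apply/funext => x; case: (f x) (g x) => a b [].
Qed.

Lemma L0_rscale (r : K -> R) f : measurable_fun [set: Kbar] (r : Kbar -> R) ->
  L0 mu f -> L0 mu (fun x => f x * (r x)%:C).
Proof.
move=> mr [f1 f2]; split.
  rewrite (_ : (fun x => _) = (fun x : Kbar => complex.Re (f x) * r x)).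
    exact: measurable_funM.
  by apply/funext => x; case: (f x) => a b /=; rewrite mulr0 subr0.
rewrite (_ : (fun x => _) = (fun x : Kbar => complex.Im (f x) * r x)).
  exact: measurable_funM.
by apply/funext => x; case: (f x) => a b /=; rewrite mulr0 add0r.
Qed.

Lemma L0_sub f g : L0 mu f -> L0 mu g -> L0 mu (fun x => f x - g x).
Proof.
move=> mf mg; have := L0_add mf (L0_rscale (measurable_cst (-1 : R)) mg).
by congr L0; apply/funext => x; rewrite rmorphN rmorph1 mulrN1.
Qed.

Lemma L0_divr f (l : R) : L0 mu f -> L0 mu (fun x => f x / l%:C).
Proof.
move=> mf; have := L0_rscale (measurable_cst l^-1) mf.
by congr L0; apply/funext => x; rewrite fmorphV.
Qed.

Lemma L0_cabs f : L0 mu f ->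
  measurable_fun [set: Kbar] (fun x : Kbar => cabs (f x)).
Proof.
move=> [f1 f2].
rewrite (_ : (fun x => _) = Num.sqrt \o (fun x : Kbar =>
  complex.Re (f x) ^+ 2 + complex.Im (f x) ^+ 2)); last first.
  by apply/funext => x /=; case: (f x).
apply: measurableT_comp.
  by apply: nondecreasing_measurable => // x y; exact: ler_wsqrtr.
by apply: measurable_funD; exact: measurable_funX.
Qed.

Lemma indic_real (E : set K) x : \1_E x = (\1_E x : R)%:C :> R[i].
Proof. by rewrite !indicE rmorph_nat. Qed.

Lemma L0_indic (E : set Kbar) (t : R) : measurable E ->
  L0 mu (fun x => (t * \1_E x)%:C).
Proof.
by move=> mE; apply: L0_real; exact: measurable_funM.
Qed.

(** Outer regularity for sets that need not be Borel. *)
Lemma outer_open (E : set K) (eta : \bar R) : is_radon mu -> (mubar E < eta)%E ->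
  exists U : set K, [/\ open U, E `<=` U & (mu U < eta)%E].
Proof.
move=> [_ outer _] /ereal_inf_lt[_ [A [mA EA] <-] Aeta].
have mUA : measurable (\bigcup_k A k) by exact: bigcup_measurable.
have : (mu (\bigcup_k A k) < eta)%E.
  apply: le_lt_trans Aeta.
  exact: measure_sigma_subadditive.
rewrite outer// => /ereal_inf_lt[_ [U [oU AU] <-] Ueta].
by exists U; split => //; apply: subset_trans AU.
Qed.

End MeasurableFunctions.

#[local] Instance completed_ae_filter (R : realType) (K : ptopologicalType)
    (mu : {measure set (borel K) -> \bar R}) :
    Filter (nbhs (almost_everywhere (@completed_measure_extension _ _ _ mu))) :=
  ae_filter_ringOfSetsType (@completed_measure_extension _ _ _ mu).

(** * Norms of indicators and modulars *)

Section BanachIdealSpaces.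
Context (R : realType) (K : ptopologicalType)
        (mu : {measure set (borel K) -> \bar R}).
Context (Om : set (K -> R[i])) (N : (K -> R[i]) -> R).
Hypotheses (bis : banach_ideal_space mu Om N) (Om_II : cond_II mu Om)
  (Om_IV : cond_IV mu Om N).

Local Notation Kbar := (caratheodory_type (mu^*)%mu).
Local Notation mubar := (@completed_measure_extension _ _ _ mu).

Lemma norm_indic_le (E F : set Kbar) : measurable E -> measurable F ->
  (mubar F < +oo)%E -> E `<=` F -> N \1_E <= N \1_F.
Proof.
move=> mE mF fF EF; have OF := Om_II mF fF.
have mE' : L0 mu \1_E.
  by have := L0_indic 1 mE; congr L0; apply/funext => x; rewrite mul1r indic_real.
apply: (bis_ideal bis OF mE' _).2; apply: aeW => x.
rewrite !indic_real !cabs_real !ger0_norm ?indicE//.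
by have [/set_mem /EF Fx|_] := boolP (x \in E); [rewrite mem_set|].
Qed.

Lemma norm_indic_ge0 (E : set Kbar) : measurable E -> (mubar E < +oo)%E ->
  0 <= N \1_E.
Proof. by move=> mE fE; apply: (bs_norm_ge0 (bis_banach bis)); exact: Om_II. Qed.

Lemma norm_indic_eq (E F : set Kbar) : measurable E -> measurable F ->
  (mubar E < +oo)%E -> mubar E = mubar F -> N \1_E = N \1_F.
Proof.
move=> mE mF fE EF; have fF : (mubar F < +oo)%E by rewrite -EF.
apply: Om_IV; [exact: Om_II|exact: Om_II| | |].
- by apply: aeW => x; rewrite indicE ler0n.
- by apply: aeW => x; rewrite indicE ler0n.
- have levelE (A : set K) (s : R) : 0 <= s ->
      [set x | s%:C < \1_A x] = if s < 1 then A else set0.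
    move=> s0; case: ifPn => s1; apply/seteqP; split => x //=; rewrite indicE.
    + by have [/set_mem//|_] := boolP (x \in A); rewrite ltcR ltNge s0.
    + by move=> Ax; rewrite mem_set// ltcR.
    + have [_|_] := boolP (x \in A); rewrite ltcR.
        by rewrite (negbTE s1).
      by rewrite ltNge s0.
  by move=> s s0; rewrite !levelE//; case: ifP.
Qed.

Lemma norm_indicU (E F : set Kbar) : measurable E -> measurable F ->
  (mubar E < +oo)%E -> (mubar F < +oo)%E -> E `&` F = set0 ->
  N \1_(E `|` F) <= N \1_E + N \1_F.
Proof.
move=> mE mF fE fF EF.
have -> : \1_(E `|` F) = (fun x => \1_E x + \1_F x) :> (K -> R[i]).
  apply/funext => x; rewrite !indicE in_setU.
  have [/set_mem Ex|nEx] := boolP (x \in E); last by rewrite add0r.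
  rewrite memNset ?addr0// => Fx.
  by have : (E `&` F) x by []; rewrite EF.
by apply: (bs_norm_add (bis_banach bis)); exact: Om_II.
Qed.

Lemma norm_indic_null (E : set Kbar) : measurable E -> mubar E = 0%E ->
  N \1_E = 0.
Proof.
move=> mE E0; apply/(bs_norm_eq0 (bis_banach bis)).
  by apply: Om_II => //; rewrite E0 ltry.
exists E; split => // x /= nx; apply: contrapT => nEx; apply: nx.
by rewrite indicE memNset.
Qed.

Section Modular.
Variables (phi : R -> \bar R) (Y : young_function phi).

(** Upper bounds of modulars come from comparison with a member of [Om]; that
    the composition with [phi] belongs to [Om] is then part of the conclusion. *)
Lemma modular_le f F : L0 mu f -> Om F ->
  {ae mubar, forall x, (phi (cabs (f x)) <= (cabs (F x))%:E)%E} ->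
  (modular mu Om N phi f <= (N F)%:E)%E.
Proof.
move=> mf OF fF; set h := fun x => phi (cabs (f x)).
have h0 x : (0 <= h x)%E by exact: (yf_ge0 Y).
have fin : {ae mubar, forall x, h x \is a fin_num}.
  apply: filterS fF => x; rewrite -/(h x) => hF.
  by rewrite ge0_fin_numE// (le_lt_trans hF)// ltry.
have mh : L0 mu (finite_part h).
  apply: L0_real; apply: (measurableT_comp (@fine_measurable R setT measurableT)).
  apply: (young_measurable Y); first exact: L0_cabs.
  by move=> x; exact: cabs_ge0.
have [Oh Nh] : Om (finite_part h) /\ N (finite_part h) <= N F.
  apply: (bis_ideal bis OF mh); apply: filterS2 fin fF => x hx hF.
  by rewrite cabs_real ger0_norm ?fine_ge0// -lee_fin fineK.
by rewrite /modular asboolT// lee_fin.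
Qed.

(** A Chebyshev inequality: [t] times the indicator of [A] lies below the
    composition with [phi]. *)
Lemma modular_ge f (c t : R) (A : set Kbar) : measurable A ->
  (mubar A < +oo)%E -> 0 <= t ->
  (modular mu Om N phi f <= c%:E)%E ->
  {ae mubar, forall x, A x -> (t%:E <= phi (cabs (f x)))%E} ->
  t * N \1_A <= c.
Proof.
move=> mA fA t0; rewrite /modular; case: asboolP => // -[fin Oh].
rewrite lee_fin => Nc tphi; apply: le_trans Nc.
have OA := Om_II mA fA.
have NtA : N (fun x => (t * \1_A x)%:C) = t * N \1_A.
  have -> : (fun x => (t * \1_A x)%:C) = (fun x => t%:C * \1_A x) :> (K -> R[i]).
    by apply/funext => x; rewrite indic_real rmorphM.
  by rewrite (bs_norm_scale (bis_banach bis))// cabs_real ger0_norm.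
rewrite -NtA; apply: (bis_ideal bis Oh (L0_indic t mA) _).2.
apply: filterS2 fin tphi => x hx tx.
rewrite !cabs_real ger0_norm ?mulr_ge0// indicE.
have [/set_mem Ax|nAx] := boolP (x \in A); last by rewrite mulr0.
rewrite mulr1 (le_trans _ (ler_norm _))//.
by rewrite -lee_fin fineK//; exact: tx.
Qed.

Lemma modular_finite_repr f (l : R) : L0 mu f -> 0 < l ->
  (modular mu Om N phi (fun x => f x / l%:C)%R < +oo)%E ->
  exists F, [/\ Om F, 0 <= N F & {ae mubar, forall x, exists2 r : R,
    F x = r%:C & (phi (cabs (f x) / l) = r%:E)%E /\ 0 <= r}].
Proof.
move=> mf l0; rewrite /modular; case: asboolP => // -[fin Oh] _.
exists (finite_part (fun x => phi (cabs (f x / l%:C)))); split => //.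
  exact: (bs_norm_ge0 (bis_banach bis) Oh).
apply: filterS fin => x; rewrite cabs_div// => hx.
exists (fine (phi (cabs (f x) / l))); first by rewrite /finite_part cabs_div.
by rewrite fineK//; split => //; rewrite fine_ge0//; exact: (yf_ge0 Y).
Qed.

(** The infimum defining the norm of a difference is taken over a nonempty
    set. *)
Lemma CL_sub_modular f g : CL_space mu Om N phi f -> CL_space mu Om N phi g ->
  exists l : R, 0 < l /\
    (modular mu Om N phi (fun x => (f x - g x) / l%:C)%R <= 1)%E.
Proof.
move=> [mf [l1 l10 fl1]] [mg [l2 l20 gl2]].
have [F [OF NF FE]] := modular_finite_repr mf l10 fl1.
have [F' [OF' NF' FE']] := modular_finite_repr mg l20 gl2.
pose l := Num.max l1 l2.
have l0 : 0 < l by rewrite lt_max l10.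
pose k : R := N F + N F' + 1.
have k1 : 1 <= k by rewrite lerDr addr_ge0.
have k0 : 0 < k by exact: lt_le_trans k1.
(* [2] splits the difference, [k] brings the sum of the two norms below [1]. *)
pose L := 2 * l * k.
have L0' : 0 < L by rewrite !mulr_gt0.
exists L; split => //.
pose FF := fun x => (k^-1)%:C * (F x + F' x).
have OFF : Om FF.
  by apply: (bs_scale (bis_banach bis)); exact: (bs_add (bis_banach bis)).
have NFF : N FF <= 1.
  rewrite (bs_norm_scale (bis_banach bis)); last exact: (bs_add (bis_banach bis)).
  rewrite cabs_real ger0_norm ?invr_ge0 ?(ltW k0)// mulrC ler_pdivrMr// mul1r.
  apply: (le_trans (bs_norm_add (bis_banach bis) OF OF')).
  by rewrite lerDl.
apply: (@le_trans _ _ (N FF)%:E); last by rewrite lee_fin.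
apply: (@modular_le (fun x => (f x - g x) / L%:C) FF _ OFF).
  by apply: L0_divr; exact: L0_sub.
apply: filterS2 FE FE' => x [r Fr [pr r0]] [r' Fr' [pr' r'0]].
rewrite /FF Fr Fr' -rmorphD -rmorphM cabs_real ger0_norm; last first.
  by rewrite mulr_ge0 ?addr_ge0// invr_ge0 ltW.
rewrite cabs_div//.
pose M := Num.max (cabs (f x)) (cabs (g x)).
have M0 : 0 <= M by rewrite le_max cabs_ge0.
have step1 : cabs (f x - g x) / L <= k^-1 * (M / l).
  have -> : k^-1 * (M / l) = (2 * M) / L.
    by rewrite /L; field; rewrite !gt_eqF.
  rewrite ler_pM2r ?invr_gt0//; apply: (le_trans (cabs_sub _ _)).
  rewrite mulr_natl mulr2n; apply: lerD; rewrite le_max lexx ?orbT//.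
have d0 : 0 <= cabs (f x - g x) / L by rewrite divr_ge0 ?cabs_ge0// ltW.
apply: (le_trans (young_le Y d0 step1)).
have t01 : 0 <= k^-1 <= 1 by rewrite invr_ge0 (ltW k0)/= invf_le1.
apply: (le_trans (young_scale Y _ t01)).
rewrite EFinM; apply: lee_wpmul2l; first by rewrite lee_fin invr_ge0 ltW.
rewrite EFinD -pr -pr'.
have mono (a b c : R) : 0 <= a -> 0 < c -> c <= b -> (phi (a / b) <= phi (a / c))%E.
  move=> a0 c0 cb; apply: (young_le Y); first by rewrite divr_ge0// (le_trans (ltW c0)).
  by rewrite ler_wpM2l// lef_pV2// posrE (lt_le_trans c0).
have [fg|gf] := leP (cabs (f x)) (cabs (g x)).
  rewrite /M max_r//; apply: (le_trans (mono _ _ _ (cabs_ge0 _) l20 _)).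
    by rewrite le_max lexx orbT.
  by rewrite leeDr//; exact: (yf_ge0 Y).
rewrite /M max_l ?(ltW gf)//; apply: (le_trans (mono _ _ _ (cabs_ge0 _) l10 _)).
  by rewrite le_max lexx.
by rewrite leeDl//; exact: (yf_ge0 Y).
Qed.

Lemma CL_norm_lt f g (d : R) : CL_space mu Om N phi f -> CL_space mu Om N phi g ->
  CL_norm mu Om N phi (fun x => f x - g x) < d ->
  exists l : R, [/\ 0 < l, l < d &
    (modular mu Om N phi (fun x => (f x - g x) / l%:C)%R <= 1)%E].
Proof.
move=> sf sg nd; have [l1 l1P] := CL_sub_modular sf sg.
have [|l [l0 lP] ld] := inf_lt _ nd.
  by exists l1.
by exists l.
Qed.

Lemma CL_norm_le f (l : R) : 0 < l ->
  (modular mu Om N phi (fun x => f x / l%:C)%R <= 1)%E ->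
  CL_norm mu Om N phi f <= l.
Proof.
by move=> l0 lP; apply: ge_inf => //; exists 0 => x [/ltW].
Qed.

End Modular.

(** A ball of [CL_space] is not visible pointwise; what survives of a small
    perturbation in the norm is that it is small off a set of small measure. *)
Lemma CL_level phi (Y : young_function phi) (Om_III : cond_III mu Om N)
    (D : set Kbar) (tau eta : R) : measurable D -> (mubar D < +oo)%E ->
  0 < tau -> 0 < eta -> exists2 delta : R, 0 < delta &
  forall f g, CL_space mu Om N phi f -> CL_space mu Om N phi g ->
    CL_norm mu Om N phi (fun x => f x - g x) < delta ->
    (mubar (D `&` [set x | (tau <= cabs (f x - g x))%R]) < eta%:E)%E.
Proof.
move=> mD fD tau0 eta0; have [C C0 CP] := Om_III D mD fD.
(* Large values of [phi] make the modular bound force a small indicator norm,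
   which [cond_III] turns into a small measure. *)
pose M := 2 * C / eta.
have M0 : 0 < M by rewrite divr_gt0// mulr_gt0.
have [x0 x00 Mx0] := young_large Y M.
exists (tau / x0); first by rewrite divr_gt0.
move=> f g sf sg /(CL_norm_lt Y sf sg)[l [l0 lt lP]].
set A := D `&` _.
have mfg : L0 mu (fun x => f x - g x).
  by apply: L0_sub; [case: sf|case: sg].
have mA : measurable A.
  apply: measurableI => //.
  have := L0_cabs mfg => /(_ measurableT `[tau, +oo[%classic (measurable_itv _)).
  rewrite setTI; congr measurable; apply/seteqP; split => x /=;
    by rewrite in_itv /= andbT.
have fA : (mubar A < +oo)%E.
  by apply: le_lt_trans fD; apply: le_measure; rewrite ?inE//; exact: subIsetl.
have MN : M * N \1_A <= 1.
  apply: (modular_ge mA fA (ltW M0) lP); apply: aeW => x [_ /= tx].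
  apply: (le_trans Mx0); apply: (young_le Y); first exact: ltW.
  rewrite cabs_div// ler_pdivlMr//.
  move: lt; rewrite ltr_pdivlMr// mulrC => /ltW /le_trans; exact.
have := CP _ (Om_II mA fA).
have -> : (\int[mubar]_(x in D) eabs \1_A x = mubar A)%E.
  transitivity (\int[mubar]_(x in D) (\1_A x : R)%:E)%E.
    apply: eq_integral => x _.
    by rewrite /eabs indic_real cabs_real ger0_norm.
  by rewrite integral_indic// setIidl//; exact: subIsetl.
move=> h; apply: (le_lt_trans h); rewrite lte_fin.
have : N \1_A <= M^-1 by rewrite -ler_pdivlMl// mulr1 in MN.
rewrite -(ler_pM2l C0) => /le_lt_trans; apply.
rewrite /M invf_div mulrA [X in X < _](_ : _ = eta / 2); last first.
  by field; rewrite gt_eqF.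
by rewrite ltr_pdivrMr// ltr_pMr// ltr1n.
Qed.

End BanachIdealSpaces.

(** * The fundamental function *)

Section FundamentalFunction.
Context (R : realType) (K : ptopologicalType) (G : lc_group K)
        (mu : {measure set (borel K) -> \bar R}) (muG : left_invariant G mu).
Context (Om : set (K -> R[i])) (N : (K -> R[i]) -> R).
Hypotheses (bis : banach_ideal_space mu Om N) (Om_II : cond_II mu Om)
  (Om_IV : cond_IV mu Om N).

Local Notation Kbar := (caratheodory_type (mu^*)%mu).
Local Notation mubar := (@completed_measure_extension _ _ _ mu).

Lemma mubar_fin (X : set (borel K)) (Z : set K) : measurable X -> compact Z ->
  X `<=` Z -> (mubar X < +oo)%E.
Proof.
move=> mX cZ XZ; rewrite mubarE//; apply: le_lt_trans (compact_fin muG cZ).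
by apply: mu_le => //; apply: compact_borel => //; exact: g_hausdorff G.
Qed.

(** The fundamental function is subadditive: a set that is at most [n] times
    as large as [E] splits into [n] sets equimeasurable with subsets of [E]. *)
Lemma norm_indic_scale (X E : set (borel K)) (ZX ZE : set K) (n : nat) :
  measurable X -> measurable E -> compact ZX -> compact ZE ->
  X `<=` ZX -> E `<=` ZE -> (mu X <= n%:R%:E * mu E)%E ->
  N \1_X <= n%:R * N \1_E.
Proof.
move=> + mE cX cE + EZ; elim: n X => [|n IH] X mX XZ XE.
  rewrite mul0r (norm_indic_null bis Om_II)//; first exact: borel_Kbar.
  rewrite mubarE//; apply/eqP; rewrite -measure_le0.
  by rewrite mul0e in XE.
have fX := mubar_fin mX cX XZ; have fE := mubar_fin mE cE EZ.
have [EX|XE'] := leP (mu E) (mu X).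
  have [Y [mY YX YE]] := subset_of_measure muG mE mX cE cX EZ XZ EX.
  have mXY : measurable (X `\` Y) by exact: measurableD.
  have XYZ : X `\` Y `<=` ZX by move=> x [/XZ].
  have XE1 : X = Y `|` (X `\` Y) by rewrite setDUK.
  have muX : mu X = (mu E + mu (X `\` Y))%E.
    rewrite {1}XE1 measureU//; last by rewrite setDE setICA setICr setI0.
    by congr (_ + _)%E; exact: YE.
  have EN : N \1_Y = N \1_E.
    apply: (norm_indic_eq Om_II Om_IV).
    - exact: borel_Kbar.
    - exact: borel_Kbar.
    - by rewrite mubarE// YE -mubarE.
    - by rewrite !mubarE.
  rewrite {1}XE1; apply: le_trans (norm_indicU bis Om_II _ _ _ _ _) _.
  - exact: borel_Kbar.
  - exact: borel_Kbar.
  - by rewrite mubarE// YE -mubarE.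
  - exact: (mubar_fin mXY cX).
  - by rewrite setDE setICA setICr setI0.
  rewrite EN -natr1 mulrDl mul1r addrC; apply: lerD => //.
  apply: IH => //.
  have fEn : mu E \is a fin_num by rewrite ge0_fin_numE// -mubarE.
  have fXY : mu (X `\` Y) \is a fin_num.
    by rewrite ge0_fin_numE// -mubarE// (mubar_fin mXY cX).
  move: XE; rewrite muX -(fineK fEn) -(fineK fXY) -!EFinM -EFinD !lee_fin -natr1.
  lra.
have [Y [mY YE YX]] := subset_of_measure muG mX mE cX cE XZ EZ (ltW XE').
have -> : N \1_X = N \1_Y.
  apply: (norm_indic_eq Om_II Om_IV) => //.
  - exact: borel_Kbar.
  - exact: borel_Kbar.
  - by rewrite !mubarE.
apply: (@le_trans _ _ (N \1_E)).
  by apply: (norm_indic_le bis Om_II) => //; exact: borel_Kbar.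
rewrite ler_peMl ?ler1n//; apply: (norm_indic_ge0 bis Om_II) => //.
exact: borel_Kbar.
Qed.

(** The limit at infinity is taken along attained values; compact sets attain
    theirs. *)
Lemma norm_indic_large (Om_VI : cond_VI mu N) (M : R) : exists L : R,
  forall D : set K, compact D -> (L%:E < mu D)%E -> M < N \1_D.
Proof.
have : \forall s \near within (attained mu) +oo, M < fundamental mu N s.
  by move/cvgryPgt : Om_VI => /(_ M).
move=> [L [_ LP]]; exists L => D cD LD.
have mD := compact_borel (g_hausdorff G) cD.
have fD : mu D \is a fin_num by exact: (compact_fin_num muG).
have mD' := borel_Kbar mu mD.
have muD : mubar D = (fine (mu D))%:E by rewrite mubarE// fineK.
have := LP (fine (mu D)); rewrite -lte_fin fineK// => /(_ LD) /=.
have at_ : attained mu (fine (mu D)) by exists D.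
move=> /(_ at_); rewrite /fundamental; set S := [set t | _].
have : S (get S) by apply: getPex; exists (N \1_D), D.
move=> [E' [mE' E'D ->]]; congr (_ < _).
by apply: (norm_indic_eq Om_II Om_IV) => //; rewrite ?E'D ?muD ?ltry.
Qed.

End FundamentalFunction.

(** * Convolution on the group *)

Section GroupConvolution.
Context (R : realType) (K : ptopologicalType) (H : hypergroup R K)
  (G : lc_group K) (mu : {measure set (borel K) -> \bar R}).
Hypotheses (GV : ginv G = hinv H)
  (GM : forall x y, pconv H x y = mdirac R (gmul G x y)).

Local Notation "x ** y" := (gmul G x y) (at level 40, left associativity).
Local Notation inv := (ginv G).
Local Notation mubar := (@completed_measure_extension _ _ _ mu).

Let hK := g_hausdorff G.

Lemma transl_group (g : K -> \bar R) x y : (forall z, 0 <= g z)%E ->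
  transl H g x y = g (x ** y).
Proof.
move=> g0; rewrite /transl GM.
have [m mE] := emeas_measure (positive_radon_measure (positive_radon_mdirac R hK (x ** y))).
rewrite -mE (lower_integral_point (z := (x ** y) : borel K))//; first exact: borel_set1.
move=> A mA; rewrite mE /emeas /mdirac asboolT// diracE indicE.
by case: (_ \in A).
Qed.

Lemma left_haar_invariant : left_haar H mu -> left_invariant G mu.
Proof.
move=> [rad mu0 mui]; split => // x f Cf; rewrite (mui x f Cf).
apply: eq_integral => y _; rewrite transl_group// => z.
by rewrite lee_fin; case: Cf.
Qed.

Lemma fun_convE (f g : K -> \bar R) x : (forall z, 0 <= g z)%E ->
  fun_conv mu H f g x = (\int[mubar]_y (f y * g (inv y ** x)))%E.
Proof.
move=> g0; rewrite /fun_conv; apply: eq_integral => y _.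
by rewrite transl_group// GV.
Qed.

Hypothesis muG : left_invariant G mu.

(** For [x] in [D] the product [y, inv y ** x] stays in [D] times [D * D], and
    [haar_inverse] controls the [y] for which [inv y ** x] falls into a small
    exceptional set. *)
Lemma fun_conv_ge (D : set K) (m : R) : compact D ->
  (forall x, D x -> D (inv x)) -> mu D = m%:E -> 0 < m ->
  exists2 eta : R, 0 < eta & forall (f g : K -> R[i]) (a b : R),
    0 <= a -> 0 <= b ->
    (mubar (D `&` [set y | (cabs (f y) < a)%R]) < (m / 4)%:E)%E ->
    (mubar (gset_mul G D D `&` [set y | (cabs (g y) < b)%R]) < eta%:E)%E ->
    forall x, D x ->
      ((a * b * (m / 2))%:E <= fun_conv mu H (eabs f) (eabs g) x)%E.
Proof.
move=> cD symD mD m0.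
have cDD : compact (gset_mul G D D) by exact: compact_gset_mul.
have [V [oV DDV [Z cZ VZ]]] := compact_thicken (g_locally_compact G) cDD.
have [M M0 MP] := haar_inverse muG cZ.
have rad : is_radon mu by case: muG.
(* A quarter of [m] is lost to each of the two exceptional sets. *)
exists (m / (4 * M)); first by rewrite divr_gt0// mulr_gt0.
move=> f g a b a0 b0 hf hg x Dx.
have [P [oP PE muP]] := outer_open rad hf.
have [Q0 [oQ0 QE muQ0]] := outer_open rad hg.
pose Q := Q0 `&` V.
have oQ : open Q by exact: openI.
have QZ : Q `<=` Z by move=> y [_ /VZ].
have QE' : gset_mul G D D `&` [set y | (cabs (g y) < b)%R] `<=` Q.
  by move=> y [DDy gy]; split; [apply: QE|apply: DDV].
have muQ : (mu Q <= (m / (4 * M))%:E)%E.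
  apply: (le_trans _ (ltW muQ0)); apply: mu_le; [exact: open_borel|exact: open_borel|].
  exact: subIsetl.
(* The [y] for which [inv y ** x] is exceptional form a translate of the
   inverse of [Q]. *)
pose W := gmul G (inv x) @^-1` (inv @^-1` Q).
have oiQ : open (inv @^-1` Q) by apply: open_comp => // y _; exact: ginv_continuous.
have oW : open W by apply: open_comp => // y _; exact: gmull_continuous.
have muW : (mu W <= (m / 4)%:E)%E.
  rewrite (haar_translate muG (inv x) (open_borel oiQ)).
  apply: (le_trans (MP _ oQ QZ)).
  apply: (@le_trans _ _ (M%:E * (m / (4 * M))%:E)%E).
    by apply: lee_wpmul2l => //; rewrite lee_fin ltW.
  rewrite -EFinM lee_fin (_ : M * _ = m / 4)//.
  by field; rewrite gt_eqF.
have mDb : measurable (D : set (borel K)) by exact: compact_borel.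
have mPb := open_borel oP; have mWb := open_borel oW.
pose T := (D `\` P) `\` W.
have mT : measurable (T : set (borel K)) by apply: measurableD => //; exact: measurableD.
have Tm : ((m / 2)%:E <= mu T)%E.
  have fT : mu T \is a fin_num.
    rewrite ge0_fin_numE//; apply: le_lt_trans (compact_fin muG cD).
    by apply: mu_le => // y [[]].
  have DT : (mu D <= mu T + (mu P + mu W))%E.
    apply: (@le_trans _ _ (mu (T `|` (P `|` W)))).
      apply: mu_le => //; first by do 2! apply: measurableU => //.
      move=> y Dy; have [Wy|nWy] := pselect (W y); first by right; right.
      by have [Py|nPy] := pselect (P y); [right; left|left].
    apply: (@le_trans _ _ (mu T + mu (P `|` W))%E).
      by apply: measureU2 => //; exact: measurableU.
    by apply: leeD2l; exact: measureU2.
  have : (m%:E <= mu T + ((m / 4)%:E + (m / 4)%:E))%E.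
    rewrite -mD; apply: (le_trans DT); apply: leeD2l; apply: leeD => //.
    exact: ltW.
  rewrite -(fineK fT) -!EFinD !lee_fin; lra.
rewrite fun_convE; last by move=> z; rewrite lee_fin cabs_ge0.
have kT := borel_Kbar mu mT.
have ab0 : (0 <= (a * b)%:E)%E by rewrite lee_fin mulr_ge0.
have indT : (\int[mubar]_y ((a * b)%:E * (\1_T y : R)%:E) = (a * b)%:E * mu T)%E.
  have mind : measurable_fun [set: caratheodory_type (mu^*)%mu]
      (fun y => (\1_T y : R)%:E).
    by apply/measurable_EFinP; exact: measurable_indic.
  have ind0 y : setT y -> (0 <= (\1_T y : R)%:E)%E by rewrite lee_fin indicE.
  rewrite (ge0_integralZl mubar measurableT mind ind0 ab0).
  rewrite (integral_indic mubar measurableT kT) setIT.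
  by congr (_ * _)%E; exact: mubarE.
apply: (@le_trans _ _ (\int[mubar]_y ((a * b)%:E * (\1_T y)%:E))%E).
  by rewrite indT EFinM; apply: lee_wpmul2l.
apply: le_lower_integral => y.
  by rewrite -EFinM lee_fin !mulr_ge0// indicE.
rewrite -EFinM /eabs -EFinM lee_fin indicE.
have [Ty|nTy] := pselect (T y); last first.
  by rewrite memNset// mulr0 mulr_ge0// cabs_ge0.
rewrite mem_set// mulr1; have [[Dy nPy] nWy] := Ty.
apply: ler_pM => //.
  by rewrite leNgt; apply/negP => fy; apply: nPy; exact: PE.
rewrite leNgt; apply/negP => gy; apply: nWy.
rewrite /W /preimage /= ginvM ginvK; apply: QE'; split => //.
by exists (inv y); [exact: symD|exists x].
Qed.

End GroupConvolution.

(** * Choice of the scale *)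

Lemma limf_einf_pinfty (R : realType) (f : R -> R) :
  limf_einf (fun x : R => (f x)%:E) 0^'+ = +oo%E ->
  forall A : R, exists2 delta : R, 0 < delta &
    forall x, 0 < x < delta -> A < f x.
Proof.
rewrite limf_einfE => supE A.
have : (A%:E < ereal_sup [set ereal_inf [set (f x)%:E | x in V] | V in 0^'+])%E.
  by rewrite supE ltry.
move=> /ereal_sup_gt[_ [V V0 <-] AV].
have [delta /= d0 dV] : exists2 delta : R, 0 < delta &
    forall x, 0 < x < delta -> V x.
  move: V0; rewrite /at_right /= => -[d /= d0 dP]; exists d => // x /andP[x0 xd].
  by apply: dP => //=; rewrite sub0r normrN gtr0_norm.
exists delta => // x /dV Vx; rewrite -lte_fin; apply: (lt_le_trans AV).
by apply: ereal_inf_lbound; exists x.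
Qed.

Section Scale.
Context (R : realType) (K : ptopologicalType) (G : lc_group K)
        (mu : {measure set (borel K) -> \bar R}) (muG : left_invariant G mu).
Context (Om : set (K -> R[i])) (N : (K -> R[i]) -> R).
Hypotheses (bis : banach_ideal_space mu Om N) (Om_II : cond_II mu Om)
  (Om_IV : cond_IV mu Om N) (Om_VI : cond_VI mu N).
Context (phi1 phi2 phi3 : R -> \bar R).
Hypotheses (Y1 : young_function phi1) (Y2 : young_function phi2)
  (Y3 : young_function phi3).

(** With [Phi := N \1_D] and [x := Phi^-1], [norm_indic_scale] gives
    [Phi <= C * m] and [N \1_(D * D) <= k * Phi]. So half of [young_inv phi1 x] on [D] and half of
    [young_inv phi2 (x / k)] on [D * D] have modular at most [1], and
    [c * d * m] is at least a constant times
    [young_inv phi1 x * young_inv phi2 x / x]. For [D] large, [x] is small and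
    this exceeds [young_inv phi3 x] by any prescribed factor. *)
Lemma scale_choice : ~ compact [set: K] ->
  (exists omega : R, forall L : R, exists D : set K,
    [/\ compact D, forall x, D x -> D (ginv G x), (L%:E < mu D)%E
      & (mu (gset_mul G D D) <= omega%:E * mu D)%E]) ->
  (forall A : R, exists2 delta : R, 0 < delta & forall x, 0 < x < delta ->
    A < young_inv phi1 x * young_inv phi2 x / (x * young_inv phi3 x)) ->
  forall r s : R, 0 < r -> 1 <= s -> exists (D : set K) (m c d : R),
    [/\ compact D, forall x, D x -> D (ginv G x), mu D = m%:E & 0 < m] /\
    [/\ 0 < c, 0 < d,
      exists2 t : R, 0 <= t & (phi1 (c / r) <= t%:E)%E /\ t * N \1_D <= 1,
      exists2 t : R, 0 <= t &
        (phi2 (d / r) <= t%:E)%E /\ t * N \1_(gset_mul G D D) <= 1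
    & exists2 t : R, 0 <= t &
        (t%:E <= phi3 (c * d * m / 8 / s))%E /\ s < t * N \1_D].
Proof.
move=> ncK [omega doubling] liminf r s r0 s1.
have s0 : 0 < s by exact: lt_le_trans s1.
have hK := g_hausdorff G.
have [E cE E0] := haar_unbounded muG 0 ncK.
have mE := compact_borel hK cE.
pose e := fine (mu E); have eE : mu E = e%:E by rewrite fineK// (compact_fin_num muG).
have e0 : 0 < e by rewrite -lte_fin -eE.
pose NE := N \1_E; have NE0 : 0 <= NE.
  by apply: (norm_indic_ge0 bis Om_II); [exact: borel_Kbar|exact: (mubar_fin muG mE cE)].
pose C := 2 * NE / e + 1.
have C0 : 0 < C by rewrite ltr_wpDl// divr_ge0 ?mulr_ge0// ltW.
pose k := (Num.truncn `|omega|).+1.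
have k0 : 0 < k%:R :> R by rewrite ltr0n.
have omk : omega <= k%:R by apply: (le_trans (ler_norm _)); exact/ltW/truncnS_gt.
(* The constant for which the ratio condition yields [kappaE] below. *)
pose A := 32 * k%:R * C * s ^+ 2 / r ^+ 2.
have A0 : 0 < A by rewrite divr_gt0 ?exprn_gt0// !mulr_gt0// exprn_gt0.
have [delta delta0 deltaP] := liminf A.
have [L LP] := norm_indic_large muG Om_II Om_IV Om_VI (delta^-1).
have [D [cD symD LD DD]] := doubling (Num.max L e).
have mD := compact_borel hK cD.
pose m := fine (mu D).
have DE : mu D = m%:E by rewrite fineK// (compact_fin_num muG).
have em : e < m.
  by rewrite -lte_fin -DE; apply: le_lt_trans LD; rewrite lee_fin le_max lexx orbT.
have m0 : 0 < m by exact: lt_trans em.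
have Phi_d : delta^-1 < N \1_D.
  by apply: LP => //; apply: le_lt_trans LD; rewrite lee_fin le_max lexx.
set Phi := N \1_D in Phi_d *.
have Phi0 : 0 < Phi by apply: lt_trans Phi_d; rewrite invr_gt0.
have cDD : compact (gset_mul G D D) by exact: compact_gset_mul.
have mDD := compact_borel hK cDD.
have PhiDD : N \1_(gset_mul G D D) <= k%:R * Phi.
  apply: (norm_indic_scale muG bis Om_II Om_IV mDD mD cDD cD) => //.
  apply: (le_trans DD); rewrite DE -!EFinM lee_fin ler_pM2r//.
have PhiC : Phi <= C * m.
  pose n := (Num.truncn (m / e)).+1.
  have PhiE : Phi <= n%:R * NE.
    apply: (norm_indic_scale muG bis Om_II Om_IV mD mE cD cE) => //.
    rewrite DE eE -EFinM lee_fin -ler_pdivrMr//.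
    exact/ltW/truncnS_gt.
  apply: (le_trans PhiE).
  have nE : n%:R <= 2 * m / e.
    rewrite /n -natr1 (_ : 2 * m / e = m / e + m / e); last by ring.
    apply: lerD; first by rewrite truncn_le// divr_ge0// ltW.
    by rewrite ler_pdivlMr// mul1r ltW.
  apply: (le_trans (ler_wpM2r NE0 nE)).
  rewrite /C [leRHS]mulrDl [1 * m]mul1r (_ : 2 * m / e * NE = 2 * NE / e * m); last by ring.
  by rewrite lerDl ltW.
pose x := Phi^-1.
have x0 : 0 < x by rewrite invr_gt0.
have xPhi : x * Phi = 1 by rewrite mulVf// gt_eqF.
have xd : 0 < x < delta.
  by rewrite x0 /= /x invf_plt.
have ratio := deltaP x xd.
set a1 := young_inv phi1 x in ratio; set a2 := young_inv phi2 x in ratio.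
set a3 := young_inv phi3 x in ratio.
have a10 : 0 <= a1 by apply: (young_inv_ge0 Y1); exact: ltW.
have a20 : 0 <= a2 by apply: (young_inv_ge0 Y2); exact: ltW.
have a30 : 0 <= a3 by apply: (young_inv_ge0 Y3); exact: ltW.
have a30' : 0 < a3.
  rewrite lt_neqAle a30 andbT; apply/eqP => a3E; move: ratio.
  by rewrite -a3E mulr0 invr0 mulr0 ltNge (ltW A0).
have a12 : A * (x * a3) < a1 * a2.
  by rewrite -ltr_pdivlMr// mulr_gt0.
have a12' : 0 < a1 * a2 by apply: lt_trans a12; apply: mulr_gt0 => //; exact: mulr_gt0.
have a1p : 0 < a1.
  rewrite lt_neqAle a10 andbT; apply/eqP => h.
  by move: a12'; rewrite -h mul0r ltxx.
pose b2 := young_inv phi2 (x / k%:R).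
have xk0 : 0 <= x / k%:R by rewrite divr_ge0// ltW.
have a2b2 : a2 <= k%:R * b2.
  have := young_inv_scale Y2 xk0 (_ : 1 <= k%:R); rewrite ler1n => /(_ isT).
  by rewrite [_ * (x / _)]mulrC divfK ?gt_eqF.
have b2p : 0 < b2.
  rewrite lt_neqAle (young_inv_ge0 Y2 xk0) andbT; apply/eqP => h.
  have a2E : a2 = 0 by apply/eqP; rewrite eq_le a20 andbT (le_trans a2b2)// -h mulr0.
  by move: a12'; rewrite a2E mulr0 ltxx.
exists D, m, (r * a1 / 2), (r * b2 / 2); split; first by split.
split.
- by rewrite divr_gt0// mulr_gt0.
- by rewrite divr_gt0// mulr_gt0.
- exists x; first exact: ltW.
  split; last by rewrite xPhi.
  apply: (young_inv_lt Y1 (ltW x0)); rewrite -/a1.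
  rewrite (_ : r * a1 / 2 / r = a1 / 2); last by field; rewrite gt_eqF.
  by rewrite divr_ge0//= ltr_pdivrMr// ltr_pMr// ltr1n.
- exists (x / k%:R) => //; split.
    apply: (young_inv_lt Y2 xk0); rewrite -/b2.
    rewrite (_ : r * b2 / 2 / r = b2 / 2); last by field; rewrite gt_eqF.
    by rewrite divr_ge0 ?(ltW b2p)//= ltr_pdivrMr// ltr_pMr// ltr1n.
  apply: (le_trans (ler_wpM2l xk0 PhiDD)).
  by rewrite mulrA divfK ?gt_eqF// xPhi.
set kappa := _ * m / 8.
have kappaE : s * a3 < kappa / s.
  rewrite ltr_pdivlMr//.
  have -> : kappa = r ^+ 2 * (a1 * b2) * m / 32 by rewrite /kappa; field.
  have h1 : a1 * a2 / k%:R <= a1 * b2.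
    by rewrite -mulrA ler_pM2l// ler_pdivrMr// mulrC.
  have h2 : 1 <= C * m * x.
    by rewrite -[leLHS]xPhi mulrC ler_pM2r.
  have h3 : A * a3 / C < a1 * a2 * m.
    rewrite ltr_pdivrMr//.
    have : A * a3 <= A * (x * a3) * (C * m).
      rewrite (_ : A * (x * a3) * (C * m) = A * a3 * (C * m * x)); last by ring.
      by rewrite ler_peMr// mulr_ge0// ltW.
    move=> /le_lt_trans; apply.
    rewrite (_ : a1 * a2 * m * C = a1 * a2 * (C * m)); last by ring.
    by rewrite ltr_pM2r// mulr_gt0.
  have h4 : A * a3 / C = 32 * k%:R * (s * a3 * s) / r ^+ 2.
    by rewrite /A; field; rewrite !gt_eqF.
  rewrite h4 in h3.
  have h5 : 32 * k%:R * (s * a3 * s) < a1 * a2 * m * r ^+ 2.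
    by move: h3; rewrite ltr_pdivrMr// exprn_gt0.
  have h6 : a1 * a2 * m * r ^+ 2 <= (a1 * b2 * k%:R) * m * r ^+ 2.
    rewrite ler_pM2r ?exprn_gt0// ler_pM2r//.
    by move: h1; rewrite ler_pdivrMr.
  have := lt_le_trans h5 h6.
  rewrite (_ : 32 * k%:R * (s * a3 * s) = (s * a3 * s) * (32 * k%:R)); last by ring.
  rewrite (_ : a1 * b2 * k%:R * m * r ^+ 2 =
    (r ^+ 2 * (a1 * b2) * m / 32) * (32 * k%:R)); last by field.
  by rewrite ltr_pM2r// mulr_gt0.
have sx0 : 0 <= s * x by rewrite mulr_ge0// ltW.
have phi3k : ((s * x)%:E < phi3 (kappa / s))%E.
  apply: (young_inv_gt Y3 sx0); apply: le_lt_trans kappaE.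
  by apply: (young_inv_scale Y3) => //; exact: ltW.
have [t tx tphi] : exists2 t : R, s * x < t & (t%:E <= phi3 (kappa / s))%E.
  move: phi3k; case: (phi3 _) => [t||]//.
    by rewrite lte_fin => h; exists t.
  by move=> _; exists (s * x + 1); rewrite ?ltrDl ?leey.
exists t; first by rewrite (le_trans sx0)// ltW.
split => //; rewrite -[ltLHS]mulr1 -xPhi mulrA ltr_pM2r//.
Qed.

End Scale.

(** * Perturbation of a function on a set *)

Section Perturbation.
Context (R : realType) (K : ptopologicalType)
        (mu : {measure set (borel K) -> \bar R}).
Context (Om : set (K -> R[i])) (N : (K -> R[i]) -> R).
Hypotheses (bis : banach_ideal_space mu Om N) (Om_II : cond_II mu Om).
Context (phi : R -> \bar R) (Y : young_function phi).

Local Notation Kbar := (caratheodory_type (mu^*)%mu).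
Local Notation mubar := (@completed_measure_extension _ _ _ mu).

Lemma CL_space_sub f g : CL_space mu Om N phi f -> CL_space mu Om N phi g ->
  CL_space mu Om N phi (fun x => f x - g x).
Proof.
move=> sf sg; split; first by apply: L0_sub; [case: sf|case: sg].
have [l [l0 lP]] := CL_sub_modular bis Y sf sg.
by exists l => //; apply: (le_lt_trans lP); rewrite ltry.
Qed.

(** Modulars decrease when the scaling factor grows, so one constant bounds them
    for all large factors. *)
Lemma modular_bounded f : CL_space mu Om N phi f -> exists l c : R,
  forall l', 0 < l' -> l <= l' ->
    (modular mu Om N phi (fun x => f x / l'%:C)%R <= c%:E)%E.
Proof.
move=> [mf [l l0 fl]]; have [F [OF NF FE]] := modular_finite_repr bis Y mf l0 fl.
exists l, (N F) => l' l'0 ll'.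
apply: (modular_le bis Y (L0_divr l' mf) OF).
apply: filterS FE => x [r -> [pr r0]].
rewrite cabs_real ger0_norm// -pr cabs_div//; apply: (young_le Y).
  by rewrite divr_ge0 ?cabs_ge0// ltW.
by rewrite ler_wpM2l ?cabs_ge0// lef_pV2.
Qed.

(** Moving [f0] away from [0] on [E], in the direction given by the sign of its
    real part, by an amount of norm at most [r]. *)
Lemma push_away_from0 f0 (E : set Kbar) (c r t : R) : CL_space mu Om N phi f0 ->
  measurable E -> (mubar E < +oo)%E -> 0 < c -> 0 < r -> 0 <= t ->
  (phi (c / r) <= t%:E)%E -> t * N \1_E <= 1 ->
  exists f1, [/\ CL_space mu Om N phi f1,
    CL_norm mu Om N phi (fun x => f0 x - f1 x) <= r
    & forall x, E x -> c <= cabs (f1 x)].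
Proof.
move=> sf0 mE fE c0 r0 t0 phit tN.
(* Subtracting [g] moves the real part of [f0] away from [0]. *)
pose sg (x : K) : R := if complex.Re (f0 x) < 0 then 1 else -1.
pose g (x : K) : R[i] := (sg x * (c * \1_E x))%:C.
have cabsg x : cabs (g x) = c * \1_E x.
  rewrite cabs_real normrM; have -> : `|sg x| = 1.
    by rewrite /sg; case: ifP => _; rewrite ?normrN normr1.
  by rewrite mul1r ger0_norm// mulr_ge0// ?ltW// indicE.
have mg : L0 mu g.
  apply: L0_real; apply: measurable_funM; last exact: measurable_funM.
  apply: (measurable_fun_ifT _ (measurable_cst _) (measurable_cst _)).
  by case: sf0 => -[mRe _] _; exact: (measurable_fun_ltr mRe (measurable_cst _)).
have Nt : N (fun x => (t * \1_E x)%:C) <= 1.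
  have -> : (fun x => (t * \1_E x)%:C) = (fun x => t%:C * \1_E x) :> (K -> R[i]).
    by apply/funext => x; rewrite indic_real rmorphM.
  by rewrite (bs_norm_scale (bis_banach bis)) ?cabs_real ?ger0_norm//; exact: Om_II.
have Ot : Om (fun x => (t * \1_E x)%:C).
  have -> : (fun x => (t * \1_E x)%:C) = (fun x => t%:C * \1_E x) :> (K -> R[i]).
    by apply/funext => x; rewrite indic_real rmorphM.
  by apply: (bs_scale (bis_banach bis)); exact: Om_II.
have modg : (modular mu Om N phi (fun x => g x / r%:C)%R <= 1)%E.
  apply: (@le_trans _ _ (N (fun x => (t * \1_E x)%:C))%:E); last by rewrite lee_fin.
  apply: (modular_le bis Y (L0_divr r mg) Ot).
  apply: aeW => x; rewrite cabs_div// cabsg cabs_real ger0_norm; last first.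
    by rewrite mulr_ge0// indicE.
  rewrite indicE; have [Ex|nEx] := pselect (E x).
    by rewrite mem_set// !mulr1.
  by rewrite memNset// !mulr0 mul0r (yf_0 Y).
have sg' : CL_space mu Om N phi g.
  by split => //; exists r => //; apply: (le_lt_trans modg); rewrite ltry.
exists (fun x => f0 x - g x); split; first exact: CL_space_sub.
  have -> : (fun x => f0 x - (f0 x - g x)) = g.
    by apply/funext => x; rewrite opprB addrC subrK.
  exact: (CL_norm_le r0 modg).
move=> x Ex; apply: le_trans (Re_le_cabs _).
rewrite /g indicE mem_set// mulr1 ReB /= /sg.
case: ltP => h; first by rewrite mul1r ler0_norm; lra.
by rewrite mulN1r opprK ger0_norm; lra.
Qed.

(** Being at least [a] outside of a small part of [E], for some [a] above the
    threshold [c], is an open condition: half of the gap between [a] and [c] is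
    left to the neighboring functions, by [CL_level]. The gap makes the
    condition open without the triangle inequality for the norm. *)
Lemma level_stable (Om_III : cond_III mu Om N) f (E : set Kbar) (c a eta : R) :
  measurable E -> (mubar E < +oo)%E -> CL_space mu Om N phi f -> c < a ->
  (mubar (E `&` [set x | (cabs (f x) < a)%R]) < eta%:E)%E ->
  exists2 delta : R, 0 < delta & forall g, CL_space mu Om N phi g ->
    CL_norm mu Om N phi (fun x => f x - g x) < delta ->
    exists2 a' : R, c < a' &
      (mubar (E `&` [set x | (cabs (g x) < a')%R]) < eta%:E)%E.
Proof.
move=> mE fE sf ca feta.
have mlt h (b : R) : L0 mu h -> measurable (E `&` [set x | (cabs (h x) < b)%R] : set Kbar).
  move=> mh; apply: measurableI => //.
  have := L0_cabs mh => /(_ measurableT `]-oo, b[%classic (measurable_itv _)).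
  by rewrite setTI; congr measurable; apply/seteqP; split => x /=; rewrite in_itv.
pose A := E `&` [set x | (cabs (f x) < a)%R].
have mA : measurable A by apply: mlt; case: sf.
have fA : mubar A \is a fin_num.
  rewrite ge0_fin_numE//; apply: le_lt_trans fE; apply: le_measure; rewrite ?inE//.
  exact: subIsetl.
pose s := fine (mubar A); have sE : mubar A = s%:E by rewrite fineK.
have seta : s < eta by rewrite -lte_fin -sE.
have tau0 : 0 < (a - c) / 2 by rewrite divr_gt0// subr_gt0.
have eta0 : 0 < eta - s by rewrite subr_gt0.
have [delta delta0 dP] := CL_level bis Om_II Y Om_III mE fE tau0 eta0.
exists delta => // g sg fg; exists ((a + c) / 2); first lra.
have := dP f g sf sg fg; set B := E `&` _ => Beta.
have mB : measurable B.
  apply: measurableI => //.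
  have mfg : L0 mu (fun x => f x - g x) by apply: L0_sub; [case: sf|case: sg].
  have := L0_cabs mfg => /(_ measurableT `[(a - c) / 2, +oo[%classic (measurable_itv _)).
  rewrite setTI; congr measurable; apply/seteqP; split => x /=;
    by rewrite in_itv /= andbT.
apply: (@le_lt_trans _ _ (mubar (A `|` B))).
  apply: le_measure; rewrite ?inE.
  - by apply: mlt; case: sg.
  - exact: measurableU.
  move=> x [Ex /= gx]; have [fx|fx] := ltP (cabs (f x)) a; [by left|right].
  split => //=.
  have := cabs_sub (f x - g x) (- g x); rewrite opprK subrK.
  have -> : cabs (- g x) = cabs (g x).
    by apply: (@complexI R); rewrite -!norm_cabs normrN.
  lra.
apply: (@le_lt_trans _ _ (mubar A + mubar B)%E); first exact: measureU2.
by rewrite sE -[eta](subrKC s) EFinD lteD2lE.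
Qed.

End Perturbation.

(** * First category *)

Section MainTheorem.
Context (R : realType) (K : ptopologicalType) (H : hypergroup R K).

Lemma set_pow_group (G : lc_group K) :
  (forall x y, pconv H x y = mdirac R (gmul G x y)) ->
  forall U n, set_pow H U n = gset_pow G U n.
Proof.
move=> GM.
have convE A B : set_conv H A B = gset_mul G A B.
  apply/seteqP; split => [z [x Ax [y By]]|_ [x Ax [y By <-]]].
    rewrite GM msupp_mdirac; last exact: g_hausdorff G.
    by move=> ->; exists x => //; exists y.
  by exists x => //; exists y => //; rewrite GM msupp_mdirac//; exact: g_hausdorff G.
move=> U n; rewrite /set_pow /gset_pow; elim: n.-1 => // k IH.
by rewrite !iterS IH convE.
Qed.

Context (G : lc_group K) (mu : {measure set (borel K) -> \bar R}).
Hypotheses (GV : ginv G = hinv H)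
  (GM : forall x y, pconv H x y = mdirac R (gmul G x y))
  (muG : left_invariant G mu) (ncK : ~ compact [set: K]).
Context (Om : set (K -> R[i])) (N : (K -> R[i]) -> R).
Hypotheses (bis : banach_ideal_space mu Om N) (Om_II : cond_II mu Om)
  (Om_III : cond_III mu Om N)
  (Om_IV : cond_IV mu Om N) (Om_VI : cond_VI mu N).
Context (phi1 phi2 phi3 : R -> \bar R).
Hypotheses (Y1 : young_function phi1) (Y2 : young_function phi2)
  (Y3 : young_function phi3).
Hypothesis doubling : exists omega : R, forall L : R, exists D : set K,
  [/\ compact D, forall x, D x -> D (ginv G x), (L%:E < mu D)%E
    & (mu (gset_mul G D D) <= omega%:E * mu D)%E].
Hypothesis ratio : forall A : R, exists2 delta : R, 0 < delta &
  forall x, 0 < x < delta ->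
    A < young_inv phi1 x * young_inv phi2 x / (x * young_inv phi3 x).

Local Notation mubar := (@completed_measure_extension _ _ _ mu).
Local Notation prod_space := (CL_prod mu Om N phi1 phi2).
Local Notation conv p := (fun_conv mu H (eabs (sval p).1) (eabs (sval p).2)).

Lemma prod_spaceP (q : prod_space) :
  CL_space mu Om N phi1 (sval q).1 /\ CL_space mu Om N phi2 (sval q).2.
Proof. exact: (svalP q). Qed.

Definition bounded_conv (s : R) : set prod_space :=
  [set p | ext_mem mu (CL_space mu Om N phi3) (conv p) /\
    (modular mu Om N phi3 (fun x => finite_part (conv p) x / s%:C)%R <= s%:E)%E].

(** One parameter serves as scaling factor and as bound on the modular. *)
Lemma conv_mem_bigcup :
  [set p : prod_space | ext_mem mu (CL_space mu Om N phi3) (conv p)] =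
  \bigcup_(n : nat) bounded_conv n.+1%:R.
Proof.
apply/seteqP; split => [p pP|p [n _ []]//].
have [l [c lcP]] := modular_bounded bis Y3 pP.2.
exists (Num.truncn (Num.max `|l| `|c|)) => //; split => //.
have /ltW := truncnS_gt (Num.max `|l| `|c|); rewrite ge_max => /andP[hl hc].
apply: (le_trans (lcP _ _ _)); first by rewrite ltr0n.
  by apply: le_trans hl; exact: ler_norm.
by rewrite lee_fin; apply: le_trans hc; exact: ler_norm.
Qed.

(** Arbitrarily close to any pair there is a pair which is at least [c] on [D]
    and at least [d] on [D * D]. Around it the open set [V] consists of pairs
    that are larger than [c / 2] and [d / 2] up to small parts of these sets;
    their convolutions are too large on [D] for the modular to be bounded by
    [s]. *)
Lemma bounded_conv_nowhere_dense (s : R) : 1 <= s ->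
  nowhere_dense (bounded_conv s).
Proof.
move=> s1; rewrite /nowhere_dense -subset0 => p0.
rewrite /interior nbhsE => -[U [oU Up0] UF].
have [r r0 rU] : exists2 r : R, 0 < r & forall q : prod_space,
    CL_prod_dist mu Om N phi1 phi2 (sval p0) (sval q) < r -> U q.
  by have := oU; move=> /(_ p0 Up0).
have r20 : 0 < r / 2 by rewrite divr_gt0.
have [D [m [c [d [[cD symD mD m0]
  [c0 d0 [t1 t10 [t1P t1N]] [t2 t20 [t2P t2N]] [t3 t30 [t3P t3N]]]]]]]] :=
  scale_choice muG bis Om_II Om_IV Om_VI Y1 Y2 Y3 ncK doubling ratio r20 s1.
have hK := g_hausdorff G.
have cDD : compact (gset_mul G D D) by exact: compact_gset_mul.
have bD := compact_borel hK cD; have bDD := compact_borel hK cDD.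
have kD := borel_Kbar mu bD; have kDD := borel_Kbar mu bDD.
have fD : (mubar D < +oo)%E by exact: (mubar_fin muG bD cD).
have fDD : (mubar (gset_mul G D D) < +oo)%E by exact: (mubar_fin muG bDD cDD).
have [sf0 sg0] := prod_spaceP p0.
have [f1 [sf1 nf1 f1D]] := push_away_from0 bis Om_II Y1 sf0 kD fD c0 r20 t10 t1P t1N.
have [g1 [sg1 ng1 g1D]] := push_away_from0 bis Om_II Y2 sg0 kDD fDD d0 r20 t20 t2P t2N.
pose p1 : prod_space := exist _ (f1, g1) (conj sf1 sg1).
have Up1 : U p1.
  apply: rU; rewrite /CL_prod_dist /= gt_max.
  by rewrite (le_lt_trans nf1) ?(le_lt_trans ng1)// ltr_pdivrMr// ltr_pMr// ltr1n.
have [eta eta0 etaP] := fun_conv_ge GV GM muG cD symD mD m0.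
have m40 : 0 < m / 4 by rewrite divr_gt0.
pose V : set prod_space := [set q |
  (exists2 a, c / 2 < a &
    (mubar (D `&` [set x | (cabs ((sval q).1 x) < a)%R]) < (m / 4)%:E)%E) /\
  (exists2 b, d / 2 < b &
    (mubar (gset_mul G D D `&` [set x | (cabs ((sval q).2 x) < b)%R]) < eta%:E)%E)].
have oV : open V.
  suff h : @metric_open R _ _ (CL_prod_dist mu Om N phi1 phi2) V by exact: h.
  move=> q [[a ca qa] [b db qb]].
  have [sq1 sq2] := prod_spaceP q.
  have [d1 d10 d1P] := level_stable bis Om_II Y1 Om_III kD fD sq1 ca qa.
  have [d2 d20 d2P] := level_stable bis Om_II Y2 Om_III kDD fDD sq2 db qb.
  exists (Num.min d1 d2); first by rewrite lt_min d10.
  move=> q'; rewrite /CL_prod_dist gt_max !lt_min.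
  move=> /andP[/andP[q1 _] /andP[_ q2]]; have [sq'1 sq'2] := prod_spaceP q'.
  by split; [exact: (d1P _ sq'1 q1)|exact: (d2P _ sq'2 q2)].
have Vp1 : V p1.
  split.
  - exists c; first by rewrite ltr_pdivrMr// ltr_pMr// ltr1n.
    rewrite (_ : D `&` _ = set0) ?measure0 ?lte_fin//.
    by rewrite -subset0 => x [/f1D /= h]; rewrite ltNge h.
  - exists d; first by rewrite ltr_pdivrMr// ltr_pMr// ltr1n.
    rewrite (_ : gset_mul G D D `&` _ = set0) ?measure0 ?lte_fin//.
    by rewrite -subset0 => x [/g1D /= h]; rewrite ltNge h.
have [q [[[fin _] qmod] [[a ca qa] [b db qb]]]] :=
  UF p1 Up1 V (open_nbhs_nbhs (conj oV Vp1)).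
have a0 : 0 <= a by apply: ltW; apply: lt_trans ca; rewrite divr_gt0.
have b0 : 0 <= b by apply: ltW; apply: lt_trans db; rewrite divr_gt0.
have hconv := etaP _ _ a b a0 b0 qa qb.
have s0 : 0 < s by exact: lt_le_trans s1.
have kappa_le : c * d * m / 8 <= a * b * (m / 2).
  have -> : c * d * m / 8 = (c / 2) * (d / 2) * (m / 2) by field.
  rewrite ler_pM2r ?divr_gt0//; apply: ler_pM; try exact: ltW;
    by rewrite divr_ge0// ltW.
have : t3 * N \1_D <= s.
  apply: (modular_ge bis Om_II kD fD t30 qmod).
  apply: filterS fin => x fx Dx; apply: (le_trans t3P).
  have hx : c * d * m / 8 <= fine (conv q x).
    by rewrite -lee_fin fineK//; apply: le_trans (hconv x Dx); rewrite lee_fin.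
  have k0 : 0 <= c * d * m / 8 by rewrite divr_ge0// !mulr_ge0// ltW.
  rewrite cabs_div// cabs_real ger0_norm; last exact: le_trans hx.
  apply: (young_le Y3); first by rewrite divr_ge0// ltW.
  by rewrite ler_pM2r ?invr_gt0.
by rewrite leNgt t3N.
Qed.

Lemma conv_mem_first_category : first_category
  [set p : prod_space | ext_mem mu (CL_space mu Om N phi3) (conv p)].
Proof.
exists (fun n => bounded_conv n.+1%:R); last exact: conv_mem_bigcup.
by move=> n; apply: bounded_conv_nowhere_dense; rewrite ler1n.
Qed.

End MainTheorem.

Local Close Scope complex_scope.

Theorem theorem2p10 (R : realType) (K : ptopologicalType)
  (H : hypergroup R K) (mu : {measure set (borel K) -> \bar R})
  (Om : set (K -> R[i])) (N : (K -> R[i]) -> R)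
  (phi1 phi2 phi3 : R -> \bar R)
  (K_noncompact : ~ compact [set: K])
  (mu_haar : left_haar H mu)
  (Om_bis : banach_ideal_space mu Om N)
  (Om_I : cond_I mu Om N) (Om_II : cond_II mu Om) (Om_III : cond_III mu Om N)
  (Om_IV : cond_IV mu Om N) (Om_V : cond_V mu N) (Om_VI : cond_VI mu N)
  (growth : forall U : set K, compact U -> nbhs (hunit H) U ->
    exists (omega : R) (n : nat -> nat),
      [/\ 1 < omega,
          forall k, (0 < n k)%N,
          {homo n : i j / (i < j)%N},
          forall k, (mu (set_pow H U (2 * n k)) <
                     omega%:E * mu (set_pow H U (n k)))%E
        & exists k0 : nat, forall x, set_pow H U (n k0) x ->
            pconv H x (hinv H x) = mdirac R (hunit H) /\
            mdirac R (hunit H) = pconv H (hinv H x) x])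
  (phi1_young : young_function phi1)
  (phi2_young : young_function phi2)
  (phi3_young : young_function phi3)
  (phi1_b : (0 < young_at_b phi1)%E)
  (phi2_b : (0 < young_at_b phi2)%E)
  (phi3_b : (0 < young_at_b phi3)%E)
  (phi_liminf :
    limf_einf (fun x : R => (young_inv phi1 x * young_inv phi2 x /
                             (x * young_inv phi3 x))%:E) 0^'+ = +oo%E) :
  first_category
    [set p : CL_prod mu Om N phi1 phi2 |
      ext_mem mu (CL_space mu Om N phi3)
        (fun_conv mu H (eabs (sval p).1) (eabs (sval p).2))].
Proof.
have invH := growth_invertible (H := H).
have {invH} invH x : pconv H x (hinv H x) = mdirac R (hunit H) /\
    pconv H (hinv H x) x = mdirac R (hunit H).
  apply: invH => U cU Ue; have [omega [n [_ n0 _ _ [k0 k0P]]]] := growth U cU Ue.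
  by exists (n k0).
have [G [G1 GV GM]] := hypergroup_group invH.
have muG := left_haar_invariant GM mu_haar.
apply: (conv_mem_first_category GV GM muG K_noncompact Om_bis Om_II Om_III Om_IV
  Om_VI phi1_young phi2_young phi3_young).
  apply: (haar_doubling muG K_noncompact) => U cU Ue.
  rewrite G1 in Ue; have [omega [n [_ n0 nh nP _]]] := growth U cU Ue.
  by exists omega, n; split => // k; rewrite -!(set_pow_group GM).
exact: limf_einf_pinfty phi_liminf.
Qed.
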